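(* For every $k\in\mathbb N$ there is a constant $C(k)>0$, depending only on $k$, such that the following holds. Let $n,d\in\mathbb N$ and let $\mu=\mu_1\otimes\cdots\otimes\mu_n$, where $\mu_1,\ldots,\mu_n$ are isotropic log-concave probability measures on $\mathbb R$. Then, for every $f\in\mathcal P_d(\mathbb R^n)$, one has \[ \|\nabla f\|_{L^{2k}(\mu)}\le C(k)\,d^2\,\|f\|_{L^{2k}(\mu)}. \] One may take $C(1)=24$ and $C(k)=736k^3$ for $k\ge2$.
   Context: $\mathbb N=\{1,2,\dots\}$. $\mathcal P_d(\mathbb R^n)$ is the space of all real algebraic polynomials in $n$ variables of (total) degree at most $d$. An isotropic log-concave probability measure on $\mathbb R$ is one with a log-concave density with respect to Lebesgue measure (i.e. of the form $e^{-V}$ with $V:\mathbb R\to(-\infty,+\infty]$ convex), mean $0$ and variance $1$. $\|\nabla f\|_{L^{2k}(\mu)}$ is the $L^{2k}(\mu)$ norm of the Euclidean length $|\nabla f|$. *)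

(* Defs.v *)
From HB Require Import structures.
From mathcomp Require Export all_boot all_order all_algebra.
From mathcomp Require Export all_classical all_reals all_analysis.
(* The notations of mpoly clash with those of MathComp-Analysis. *)
From mathcomp Require Export -(notations) mpoly.
Set Implicit Arguments.
Unset Strict Implicit.
Unset Printing Implicit Defensive.
Import Order.TTheory GRing.Theory Num.Theory.
Import numFieldNormedType.Exports.
Local Open Scope classical_set_scope.
Local Open Scope ring_scope.

Section IsotropicLogConcave.
Variable R : realType.

(* V : R -> (-oo, +oo] convex; the products below use 0 * +oo = 0. *)
Definition ext_convex (V : R -> \bar R) : Prop :=
  (forall x, V x != -oo%E) /\
  (forall (x y t : R), 0 <= t <= 1 ->
    (V (t * x + (1 - t) * y)%R <= t%:E * V x + (1 - t)%:E * V y)%E).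

Definition log_concave (P : probability R R) : Prop :=
  exists2 V : R -> \bar R, ext_convex V &
    forall A : set R, measurable A ->
      P A = (\int[lebesgue_measure]_(x in A) expeR (- V x))%E.

Definition isotropic (P : probability R R) : Prop :=
  ('E_P[id] = 0)%E /\ 'V_P[id] = 1%E.

End IsotropicLogConcave.

Section ProductProbability.
Context d (T : measurableType d) (R : realType).

Definition tcons n (z : T * n.-tuple T) : n.+1.-tuple T :=
  [tuple of z.1 :: z.2].

Lemma measurable_tcons n : measurable_fun [set: T * n.-tuple T] (@tcons n).
Proof. exact: measurable_cons. Qed.

HB.instance Definition _ n :=
  isMeasurableFun.Build _ _ _ _ (@tcons n) (@measurable_tcons n).

(* mu_0 (x) ... (x) mu_(n-1) on T^n, represented by n.-tuple T with the
   sigma-algebra generated by the coordinates: the image under tcons of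
   mu_0 \x (mu_1 (x) ... (x) mu_(n-1)). *)
Fixpoint prod_probability n : ('I_n -> probability T R) ->
    probability (n.-tuple T) R :=
  match n return ('I_n -> probability T R) -> probability (n.-tuple T) R with
  | 0 => fun=> dirac [tuple]
  | m.+1 => fun mu => distribution
      (mu ord0 \x prod_probability (fun i => mu (lift ord0 i)))%E (@tcons m)
  end.

Lemma prod_probability_box n (mu : 'I_n -> probability T R)
    (A : 'I_n -> set T) : (forall i, measurable (A i)) ->
  prod_probability mu [set x | forall i, A i (tnth x i)] =
  (\prod_(i < n) mu i (A i))%E.
Proof.
elim: n mu A => [|n IHn] mu A mA /=.
  rewrite big_ord0 diracE mem_set//= => -[]//.
rewrite big_ord_recl -IHn// -product_measure1E//; last first.
  rewrite (_ : mkset _ = \bigcap_(i in [set: 'I_n])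
      ((fun x : n.-tuple T => tnth x i) @^-1` A (lift ord0 i))); last first.
    by apply/seteqP; split => x /= Ax i => [_|]; exact: Ax.
  apply: fin_bigcap_measurable => // i _.
  by rewrite -[X in measurable X]setTI; exact: measurable_tnth.
rewrite /distribution /pushforward; congr (_ _).
apply/seteqP; split => -[x y] /=.
  move=> Axy; split => [|i]; first exact: (Axy ord0).
  by have := Axy (lift ord0 i); rewrite /tcons/= tnthS.
case=> Ax Ay i; case: (unliftP ord0 i) => [j ->|->//].
by rewrite /tcons/= tnthS.
Qed.

End ProductProbability.

Section Polynomials.
Variables (R : realType) (n : nat).

Definition peval (f : mpoly n R) (x : n.-tuple R) : R :=
  meval (tnth x) f.

Definition grad_norm (f : mpoly n R) (x : n.-tuple R) : R :=
  Num.sqrt (\sum_(i < n) peval (mderiv i f) x ^+ 2).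

(* mpoly.msize is 1 + the total degree (0 for the zero polynomial). *)
Definition degree_le (d : nat) (f : mpoly n R) : Prop :=
  (mpoly.msize f <= d.+1)%N.

End Polynomials.

(* Main.v *)
From HB Require Import structures.
Require Import Defs.
From mathcomp Require Import measurable_realfun.
From mathcomp Require Import ring lra.

(** The idea is to trade the algebraic polynomial [f] for a trigonometric one.
    On a circle, that is along [x = c + r cos t], a polynomial of degree [d]
    becomes a trigonometric polynomial of degree [d], for which Bernstein's
    inequality holds with the factor [d].

    Suppose that each [mu_i] is the law of the abscissa
    [x_i = c_i + r_i cos t_i] of a random point of a random circle whose angle
    is uniform, the [n] points being independent, and let [y_i = r_i sin t_i].
    Turning all the angles together by [t] produces a trigonometric polynomial
    of degree [d] in [t] whose derivative at [0] is, up to the sign,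
    [sum_i y_i D_i f(x)].  Riesz' interpolation formula writes this derivative
    as [d] times a convex combination, with signs, of values of [f] at turned
    points; turning preserves the law, so that Jensen's inequality gives
      [E (sum_i y_i D_i f(x))^(2k) <= d^(2k) E f(x)^(2k)]  ([bernstein_step]).
    The law is also invariant under each single reflection [y_i -> - y_i]; with
    the tangent inequality for the power [k] this yields
      [E (sum_i y_i^2 (D_i f(x))^2)^k <= E (sum_i y_i D_i f(x))^(2k)]
    ([symmetrization_step]).  Expanding the power [k] into products reduces the
    removal of the weights [y_i^2] to one variable: it is enough that
    [K^a E' p(x_i) <= E (y_i^(2a) p(x_i))] for nonnegative polynomials [p],
    where [E'] is close to the integral against [mu_i] ([weight_step]).

    It remains to realize a log-concave [mu_i] in this way with large [y_i].
    Its density [rho] has intervals as superlevel sets, so [mu_i] is a mixture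
    of uniform laws on intervals.  By Archimedes' theorem the uniform law on an
    interval is the law of one coordinate of a uniform point of a sphere, and
    the circles orthogonal to another coordinate axis exhibit it as a mixture
    of laws of abscissas on circles ([sphere_mean0]).  The superlevel sets are
    long: if [rho] is divided by [e^2] at distance [L] on both sides of a point
    [x0], then its exponential decay beyond bounds the second moment about [x0]
    by [(1 + 4/e) L^2], and by isotropy this moment is at least [1]; hence
    [L^2 >= 5/13], and every superlevel set at a height below a twelfth of the
    supremum of [rho] has at least this squared length ([drop_width], [level_geometry]).
    Only finitely many such levels, equally spaced, are spread over circles;
    the rest of [mu_i] is left at [y = 0].  The spread part is at least a
    twelfth of [mu_i] on the set where [rho] exceeds two steps
    ([core_le_layered]), a set that exhausts [mu_i] as the step tends to [0]
    ([core_mean_cvg]).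

    The second factor [d] is the price of the weight [sin^(2a)].  The mean of a
    trigonometric polynomial is the same over all equally spaced grids that are
    fine enough.  With [2 (k d + 1)] nodes, offset by half a step, a grid is
    fine enough for the polynomials at hand and [sin^2 >= 1 / (k d + 1)^2] at
    its nodes ([sin_grid_ge]), so the weight costs at most a factor
    [(k d + 1)^2] per square ([grid_mean_weight]).  Altogether
      [||grad f|| <= sqrt (1248 / 5) (k d + 1) d ||f||],
    and [k d + 1 <= (3/2) k d] as soon as [k d >= 2]; for [k = d = 1] the grid
    has four nodes, where [sin^2 = 1/2].

    All the functionals involved are applied to polynomials only.  The law of
    [(x_i, y_i)] is therefore represented by a linear functional, positive on
    nonnegative polynomials, and products of laws by iterating functionals over
    sums of products; no Fubini theorem is needed beyond monomials. *)

Set Implicit Arguments.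
Unset Strict Implicit.
Unset Printing Implicit Defensive.
Import Order.TTheory GRing.Theory Num.Theory.
Import numFieldNormedType.Exports.
Local Open Scope classical_set_scope.
Local Open Scope ring_scope.

(** * Iterated functionals *)

Section IteratedFunctional.
Variables (R : realType) (Z : Type).
Implicit Types (n : nat) (A : (Z -> R) -> Prop).

Definition fcons n (z : Z) (zs : 'I_n -> Z) (i : 'I_n.+1) : Z :=
  if unlift ord0 i is Some j then zs j else z.

Lemma fcons0 n z (zs : 'I_n -> Z) : fcons z zs ord0 = z.
Proof. by rewrite /fcons unlift_none. Qed.

Lemma fconsS n z (zs : 'I_n -> Z) j : fcons z zs (lift ord0 j) = zs j.
Proof. by rewrite /fcons liftK. Qed.

Definition fnil (i : 'I_0) : Z :=
  False_rect Z (notF (ltn_ord i)).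

Lemma fnil_eta (z : 'I_0 -> Z) : z = fnil.
Proof. by apply/funext => -[]. Qed.

(** The product of the functionals [l i], each acting on its own coordinate, as an
    iterated integral. *)
Fixpoint iterE n : ('I_n -> (Z -> R) -> R) -> (('I_n -> Z) -> R) -> R :=
  match n return ('I_n -> (Z -> R) -> R) -> (('I_n -> Z) -> R) -> R with
  | 0 => fun _ F => F fnil
  | m.+1 => fun l F =>
      l ord0 (fun z => iterE (fun i => l (lift ord0 i))
                             (fun zs => F (fcons z zs)))
  end.

(** Functionals are only required to be linear on a class [A] of test functions,
    since moments make sense for polynomials but not for all functions. *)
Record linear_class A : Prop := LinearClass {
  lcD : forall f g, A f -> A g -> A (fun z => f z + g z);
  lcZ : forall a f, A f -> A (fun z => a * f z) }.

Record linear_on A (l : (Z -> R) -> R) : Prop := LinearOn {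
  loD : forall f g, A f -> A g -> l (fun z => f z + g z) = l f + l g;
  loZ : forall a f, A f -> l (fun z => a * f z) = a * l f }.

Definition positive_on A (l : (Z -> R) -> R) : Prop :=
  forall f, A f -> (forall z, 0 <= f z) -> 0 <= l f.

(** The algebraic tensor product of [n] copies of [A]: the functions on which an
    iterated functional is again linear. *)
Inductive separable A n : (('I_n -> Z) -> R) -> Prop :=
| separable_prod a (phi : 'I_n -> Z -> R) : (forall i, A (phi i)) ->
    separable A (fun z => a * \prod_i phi i (z i))
| separable_add F G : separable A F -> separable A G ->
    separable A (fun z => F z + G z).

Lemma separable_scale A n a (F : ('I_n -> Z) -> R) : separable A F ->
  separable A (fun z => a * F z).
Proof.
elim=> [b phi Aphi|F1 F2 _ sF1 _ sF2].
  have -> : (fun z : 'I_n -> Z => a * (b * \prod_i phi i (z i))) =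
      (fun z => (a * b) * \prod_i phi i (z i)).
    by apply/funext => z; rewrite mulrA.
  exact: separable_prod.
have -> : (fun z => a * (F1 z + F2 z)) = (fun z => a * F1 z + a * F2 z).
  by apply/funext => z; rewrite mulrDr.
exact: separable_add.
Qed.

Lemma separable_sub A n (F G : ('I_n -> Z) -> R) : separable A F ->
  separable A G -> separable A (fun z => F z - G z).
Proof.
move=> sF sG.
have -> : (fun z => F z - G z) = (fun z => F z + (-1) * G z).
  by apply/funext => z; rewrite mulN1r.
by apply: separable_add => //; exact: separable_scale.
Qed.

Lemma separable_sum A n (I : Type) (r : seq I) (P : pred I)
    (F : I -> ('I_n -> Z) -> R) : A (cst 0) -> A (cst 1) ->
  (forall i, P i -> separable A (F i)) ->
  separable A (fun z => \sum_(i <- r | P i) F i z).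
Proof.
move=> A0 A1 sF; elim: r => [|i r IHr].
  have -> : (fun z : 'I_n -> Z => \sum_(i <- [::] | P i) F i z) =
      (fun z => 0 * \prod_(i < n) (cst 1 (z i))).
    by apply/funext => z; rewrite big_nil mul0r.
  exact: (@separable_prod A n 0 (fun=> cst 1)).
case Pi : (P i); last first.
  rewrite (_ : (fun z => _) = (fun z => \sum_(j <- r | P j) F j z))//.
  by apply/funext => z; rewrite big_cons Pi.
rewrite (_ : (fun z => _) = (fun z => F i z + \sum_(j <- r | P j) F j z)).
  by apply: separable_add => //; exact: sF.
by apply/funext => z; rewrite big_cons Pi.
Qed.

Lemma separable_mul A n (F G : ('I_n -> Z) -> R) :
  (forall f g, A f -> A g -> A (fun z => f z * g z)) ->
  separable A F -> separable A G -> separable A (fun z => F z * G z).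
Proof.
move=> Amul sF; elim: sF G => [a phi Aphi|F1 F2 _ sF1 _ sF2] G sG; last first.
  have -> : (fun z => (F1 z + F2 z) * G z) = (fun z => F1 z * G z + F2 z * G z).
    by apply/funext => z; rewrite mulrDl.
  by apply: separable_add; [exact: sF1|exact: sF2].
elim: sG => [b psi Apsi|G1 G2 _ sG1 _ sG2].
  have -> : (fun z : 'I_n -> Z =>
       a * (\prod_i phi i (z i)) * (b * \prod_i psi i (z i))) =
      (fun z => (a * b) * \prod_i (phi i (z i) * psi i (z i))).
    by apply/funext => z; rewrite big_split/=; ring.
  by apply: (@separable_prod A n (a * b) (fun i t => phi i t * psi i t)) => i;
    exact: Amul.
have -> : (fun z : 'I_n -> Z =>
      a * (\prod_i phi i (z i)) * (G1 z + G2 z)) =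
    (fun z => a * (\prod_i phi i (z i)) * G1 z +
              a * (\prod_i phi i (z i)) * G2 z).
  by apply/funext => z; rewrite mulrDr.
exact: separable_add.
Qed.

Lemma separable_const A n a : A (cst 1) ->
  separable A (fun=> a : R) (n := n).
Proof.
move=> A1; rewrite (_ : (fun=> a) = (fun z => a * \prod_(i < n) cst 1 (z i))).
  exact: (@separable_prod A n a (fun=> cst 1)).
by apply/funext => z; rewrite big1 ?mulr1.
Qed.

Lemma separable_exp A n (F : ('I_n -> Z) -> R) k :
  (forall f g, A f -> A g -> A (fun z => f z * g z)) -> A (cst 1) ->
  separable A F -> separable A (fun z => F z ^+ k).
Proof.
move=> Amul A1 sF; elim: k => [|k IHk]; first exact: separable_const.
rewrite (_ : (fun z => _) = (fun z => F z * F z ^+ k)); last first.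
  by apply/funext => z; rewrite exprS.
exact: separable_mul.
Qed.

Lemma separable_coord A n (i : 'I_n) (phi : Z -> R) : A (cst 1) -> A phi ->
  separable A (fun z => phi (z i)).
Proof.
move=> A1 Aphi.
rewrite (_ : (fun z => _) =
    (fun z => 1 * \prod_j (if j == i then phi else cst 1) (z j))).
  apply: (@separable_prod A n 1 (fun j => if j == i then phi else cst 1)).
  by move=> j; case: ifP.
apply/funext => z; rewrite mul1r (bigD1 i)//= eqxx big1 ?mulr1//.
by move=> j /negPf ->.
Qed.

Section Linearity.
Variables (A : (Z -> R) -> Prop).
Hypothesis lcA : linear_class A.

Lemma separable_slice n (F : ('I_n.+1 -> Z) -> R) z : separable A F ->
  separable A (fun zs => F (fcons z zs)).
Proof.
elim=> [a phi Aphi|F1 F2 _ sF1 _ sF2]; last exact: separable_add.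
rewrite (_ : (fun zs => _) = (fun zs => (a * phi ord0 z) *
    \prod_i phi (lift ord0 i) (zs i))).
  by apply: (@separable_prod A n _ (fun i => phi (lift ord0 i))) => i.
apply/funext => zs; rewrite big_ord_recl fcons0 mulrA; congr *%R.
by apply: eq_bigr => i _; rewrite fconsS.
Qed.

(** Both claims must be proved together by induction on [n]: additivity for [n]
    coordinates shows that the inner functional of a sum stays in [A], and the
    value on products shows that of a product does. *)
Lemma iterE_linear n (l : 'I_n -> (Z -> R) -> R) :
  (forall i, linear_on A (l i)) ->
  (forall a phi, (forall i, A (phi i)) ->
    iterE l (fun z => a * \prod_i phi i (z i)) = a * \prod_i l i (phi i)) /\
  (forall F G, separable A F -> separable A G ->
    iterE l (fun z => F z + G z) = iterE l F + iterE l G).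
Proof.
elim: n l => [|n IHn] l linl /=.
  by split=> // a phi _; rewrite !big_ord0.
have [IHp IHD] := IHn (fun i => l (lift ord0 i)) (fun i => linl _).
have inA F : separable A F -> A (fun z => iterE (fun i => l (lift ord0 i))
                             (fun zs => F (fcons z zs))).
  elim=> [a phi Aphi|F1 F2 sF1 AF1 sF2 AF2].
    rewrite (_ : (fun z => _) = (fun z =>
      (a * \prod_i l (lift ord0 i) (phi (lift ord0 i))) * phi ord0 z)).
      exact: lcZ.
    apply/funext => z; rewrite -[RHS]mulrAC -IHp//.
    congr iterE; apply/funext => zs.
    rewrite big_ord_recl fcons0 mulrA; congr *%R.
    by apply: eq_bigr => i _; rewrite fconsS.
  rewrite (_ : (fun z => _) = (fun z =>
      iterE (fun i => l (lift ord0 i)) (fun zs => F1 (fcons z zs)) +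
      iterE (fun i => l (lift ord0 i)) (fun zs => F2 (fcons z zs)))).
    exact: lcD.
  by apply/funext => z; rewrite IHD//; exact: separable_slice.
split=> [a phi Aphi|F G sF sG].
  rewrite big_ord_recl mulrCA mulrC -(loZ (linl ord0))//.
  congr (l ord0 _); apply/funext => z; rewrite mulrAC -IHp//.
  congr iterE; apply/funext => zs.
  rewrite big_ord_recl fcons0 mulrA; congr *%R.
  by apply: eq_bigr => i _; rewrite fconsS.
rewrite -(loD (linl ord0)); [|exact: inA|exact: inA].
by congr (l ord0 _); apply/funext => z; rewrite IHD//; exact: separable_slice.
Qed.

Lemma iterE_prod n (l : 'I_n -> (Z -> R) -> R) a phi :
  (forall i, linear_on A (l i)) -> (forall i, A (phi i)) ->
  iterE l (fun z => a * \prod_i phi i (z i)) = a * \prod_i l i (phi i).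
Proof. by move=> linl; have [h _] := iterE_linear linl; exact: h. Qed.

Lemma iterED n (l : 'I_n -> (Z -> R) -> R) F G :
  (forall i, linear_on A (l i)) -> separable A F -> separable A G ->
  iterE l (fun z => F z + G z) = iterE l F + iterE l G.
Proof. by move=> linl; have [_ h] := iterE_linear linl; exact: h. Qed.

Lemma iterEZ n (l : 'I_n -> (Z -> R) -> R) a F :
  (forall i, linear_on A (l i)) -> separable A F ->
  iterE l (fun z => a * F z) = a * iterE l F.
Proof.
move=> linl; elim=> [b phi Aphi|F1 F2 sF1 F1E sF2 F2E].
  rewrite iterE_prod// mulrA -iterE_prod//.
  by congr iterE; apply/funext => z; rewrite mulrA.
rewrite iterED// mulrDr -F1E -F2E -iterED//; try exact: separable_scale.
by congr iterE; apply/funext => z; rewrite mulrDr.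
Qed.

Lemma iterEB n (l : 'I_n -> (Z -> R) -> R) F G :
  (forall i, linear_on A (l i)) -> separable A F -> separable A G ->
  iterE l (fun z => F z - G z) = iterE l F - iterE l G.
Proof.
move=> linl sF sG.
rewrite -mulN1r -iterEZ// -iterED//; last exact: separable_scale.
by congr iterE; apply/funext => z; rewrite mulN1r.
Qed.

Lemma iterE_sum n (l : 'I_n -> (Z -> R) -> R) (I : Type) (r : seq I)
    (P : pred I) (F : I -> ('I_n -> Z) -> R) :
  A (cst 0) -> A (cst 1) ->
  (forall i, linear_on A (l i)) -> (forall i, P i -> separable A (F i)) ->
  iterE l (fun z => \sum_(i <- r | P i) F i z) =
  \sum_(i <- r | P i) iterE l (F i).
Proof.
move=> A0 A1 linl sF; elim: r => [|i r IHr].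
  rewrite big_nil (_ : (fun z => _) =
      (fun z => 0 * \prod_(i < n) (cst 1 (z i)))).
    by rewrite (@iterE_prod _ _ _ (fun=> cst 1))// mul0r.
  by apply/funext => z; rewrite big_nil mul0r.
case Pi : (P i); last first.
  rewrite big_cons Pi -IHr; congr iterE.
  by apply/funext => z; rewrite big_cons Pi.
rewrite big_cons Pi -IHr -iterED//; last exact: separable_sum.
- by congr iterE; apply/funext => z; rewrite big_cons Pi.
- exact: sF.
Qed.

Lemma iterE_in_class n (l : 'I_n.+1 -> (Z -> R) -> R) F :
  (forall i, linear_on A (l i)) -> separable A F ->
  A (fun z => iterE (fun i => l (lift ord0 i)) (fun zs => F (fcons z zs))).
Proof.
move=> linl; elim=> [a phi Aphi|F1 F2 sF1 AF1 sF2 AF2].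
  rewrite (_ : (fun z => _) = (fun z =>
    (a * \prod_i l (lift ord0 i) (phi (lift ord0 i))) * phi ord0 z)).
    exact: lcZ.
  apply/funext => z.
  rewrite -mulrAC -(iterE_prod _ (fun i => linl _) (fun i => Aphi _)).
  congr iterE; apply/funext => zs.
  rewrite big_ord_recl fcons0 mulrA; congr *%R.
  by apply: eq_bigr => i _; rewrite fconsS.
rewrite (_ : (fun z => _) = (fun z =>
    iterE (fun i => l (lift ord0 i)) (fun zs => F1 (fcons z zs)) +
    iterE (fun i => l (lift ord0 i)) (fun zs => F2 (fcons z zs)))).
  exact: lcD.
by apply/funext => z; rewrite iterED//; exact: separable_slice.
Qed.

Lemma le_on (l : (Z -> R) -> R) f g : linear_on A l -> positive_on A l ->
  A f -> A g -> (forall z, f z <= g z) -> l f <= l g.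
Proof.
move=> linl posl Af Ag fg; rewrite -subr_ge0 -mulN1r -(loZ linl)//.
rewrite -(loD linl)//; last exact: lcZ.
apply: posl => [|z]; first by apply: lcD => //; exact: lcZ.
by rewrite mulN1r subr_ge0.
Qed.

Lemma iterE_ge0 n (l : 'I_n -> (Z -> R) -> R) F :
  (forall i, linear_on A (l i)) -> (forall i, positive_on A (l i)) ->
  separable A F -> (forall z, 0 <= F z) -> 0 <= iterE l F.
Proof.
elim: n l F => [|n IHn] l F linl posl sF F0 /=; first exact: F0.
apply: (posl ord0); first exact: iterE_in_class.
by move=> z; apply: IHn => //; exact: separable_slice.
Qed.

Lemma iterE_le n (l : 'I_n -> (Z -> R) -> R) F G :
  (forall i, linear_on A (l i)) -> (forall i, positive_on A (l i)) ->
  separable A F -> separable A G -> (forall z, F z <= G z) ->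
  iterE l F <= iterE l G.
Proof.
move=> linl posl sF sG FG; rewrite -subr_ge0 -iterEB//.
apply: iterE_ge0 => //; first exact: separable_sub.
by move=> z; rewrite subr_ge0.
Qed.

(** Replacing the [N i] by the [L i] one coordinate at a time is possible because
    a nonnegative function stays nonnegative when positive functionals have
    been applied to its other coordinates. *)
Lemma iterE_compare n (L N : 'I_n -> (Z -> R) -> R) (K : 'I_n -> R) F :
  (forall i, linear_on A (L i)) -> (forall i, linear_on A (N i)) ->
  (forall i, 0 <= K i) -> (forall i, positive_on A (N i)) ->
  (forall i f, A f -> (forall z, 0 <= f z) -> K i * N i f <= L i f) ->
  separable A F -> (forall z, 0 <= F z) ->
  (\prod_i K i) * iterE N F <= iterE L F.
Proof.
move=> linL linN K0 posN; elim: n L N K F linL linN K0 posN =>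
  [|n IHn] L N K F linL linN K0 posN LN sF F0 /=.
  by rewrite big_ord0 mul1r.
have posL i : positive_on A (L i).
  by move=> f Af f0; apply: le_trans (LN i f Af f0); rewrite mulr_ge0// posN.
have AL := iterE_in_class linL sF; have AN := iterE_in_class linN sF.
set P := \prod_(i < n) K (lift ord0 i).
have P0 : 0 <= P by exact: prodr_ge0.
rewrite big_ord_recl -/P mulrAC.
apply: (@le_trans _ _ (P * L ord0 (fun z =>
    iterE (fun i => N (lift ord0 i)) (fun zs => F (fcons z zs))))).
  rewrite mulrC ler_wpM2l// LN// => z.
  by apply: iterE_ge0 => //; exact: separable_slice.
rewrite -(loZ (linL ord0))//; apply: le_on => //; first exact: lcZ.
move=> z; apply: IHn => //; first by move=> i; exact: LN.
exact: separable_slice.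
Qed.

End Linearity.

Lemma iterE_invariant n (l : 'I_n -> (Z -> R) -> R) (tau : 'I_n -> Z -> Z) F :
  (forall i phi, l i (fun z => phi (tau i z)) = l i phi) ->
  iterE l (fun z => F (fun i => tau i (z i))) = iterE l F.
Proof.
elim: n l tau F => [|n IHn] l tau F invl /=.
  by congr F; rewrite [LHS]fnil_eta.
rewrite -[RHS](invl ord0); congr (l ord0 _); apply/funext => z.
rewrite -[RHS](IHn _ (fun i => tau (lift ord0 i)))//; congr iterE.
apply/funext => zs; congr F; apply/funext => i.
case: (unliftP ord0 i) => [j ->|->]; first by rewrite !fconsS.
by rewrite !fcons0.
Qed.

End IteratedFunctional.

(** Functionals that factor through a map [x], up to weights depending on single
    coordinates, do so after iteration as well. *)
Lemma iterE_pullback (R : realType) (Z Y : Type) (A : (Z -> R) -> Prop)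
    (B : (Y -> R) -> Prop) n (l : 'I_n -> (Z -> R) -> R)
    (L : 'I_n -> (Y -> R) -> R) (w : 'I_n -> Z -> R) (x : Z -> Y) F :
  linear_class A -> linear_class B ->
  (forall i, linear_on A (l i)) ->
  (forall i f, B f -> A (fun z => w i z * f (x z))) ->
  (forall i f, B f -> L i f = l i (fun z => w i z * f (x z))) ->
  separable B F ->
  iterE l (fun z => (\prod_i w i (z i)) * F (fun i => x (z i))) = iterE L F.
Proof.
move=> lcA lcB linl AB LE.
have linL i : linear_on B (L i).
  split=> [f g Bf Bg|a f Bf]; rewrite !LE//; try exact: lcD; try exact: lcZ.
    rewrite -(loD (linl i)); try exact: AB.
    by congr (l i _); apply/funext => z; rewrite mulrDr.
  rewrite -(loZ (linl i)); last exact: AB.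
  by congr (l i _); apply/funext => z; rewrite mulrCA.
have wP a (phi : 'I_n -> Y -> R) :
    (fun z : 'I_n -> Z => \prod_i w i (z i) * (a * \prod_i phi i (x (z i)))) =
    (fun z => a * \prod_i (fun z => w i z * phi i (x z)) (z i)).
  by apply/funext => z; rewrite big_split/=; ring.
have sep G : separable B G ->
    separable A (fun z => (\prod_i w i (z i)) * G (fun i => x (z i))).
  elim=> [a phi Bphi|F1 F2 _ sF1 _ sF2].
    rewrite wP; apply: (@separable_prod R Z A n a
      (fun i z => w i z * phi i (x z))) => i; exact: AB.
  rewrite (_ : (fun z => _) = (fun z =>
      \prod_i w i (z i) * F1 (fun i => x (z i)) +
      \prod_i w i (z i) * F2 (fun i => x (z i)))).
    exact: separable_add.
  by apply/funext => z; rewrite mulrDr.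
elim=> [a phi Bphi|F1 F2 sF1 F1E sF2 F2E].
  rewrite wP (iterE_prod lcA _ linl (fun i => AB i _ (Bphi i)))//.
  rewrite (iterE_prod lcB)//; congr *%R; apply: eq_bigr => i _.
  by rewrite LE//.
rewrite (iterED lcB)// -F1E -F2E -(iterED lcA)//; try exact: sep.
by congr iterE; apply/funext => z; rewrite mulrDr.
Qed.

(** * Trigonometric polynomials and Riesz interpolation *)

Section TrigonometricPolynomials.
Variable R : realType.
Implicit Types (T U : R -> R) (N d m : nat).

(** [trigpoly D T T'] carries the derivative [T'] along with [T], so that
    derivatives of trigonometric polynomials never have to be computed.  The
    phase [phi] covers both sines and cosines. *)
Inductive trigpoly (D : nat) : (R -> R) -> (R -> R) -> Prop :=
| trigpoly_wave a m phi : (m <= D)%N ->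
    trigpoly D (fun t => a * cos (m%:R * t + phi))
               (fun t => - (a * m%:R * sin (m%:R * t + phi)))
| trigpoly_add T T' U U' : trigpoly D T T' -> trigpoly D U U' ->
    trigpoly D (fun t => T t + U t) (fun t => T' t + U' t).

Lemma trigpoly_eq D T T' U U' : T =1 U -> T' =1 U' ->
  trigpoly D T T' -> trigpoly D U U'.
Proof. by move=> /funext -> /funext ->. Qed.

Lemma trigpolyW D D' T T' : (D <= D')%N -> trigpoly D T T' -> trigpoly D' T T'.
Proof.
move=> DD'; elim=> [a m phi mD|T1 T1' T2 T2' _ h1 _ h2].
  by apply: trigpoly_wave; exact: leq_trans DD'.
exact: trigpoly_add.
Qed.

Lemma trigpoly_const D a : trigpoly D (fun=> a) (fun=> 0).
Proof.
apply: trigpoly_eq (trigpoly_wave a 0 (leq0n D)) => t.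
  by rewrite mul0r addr0 cos0 mulr1.
by rewrite mulr0 mul0r oppr0.
Qed.

Lemma trigpolyZ D a T T' : trigpoly D T T' ->
  trigpoly D (fun t => a * T t) (fun t => a * T' t).
Proof.
elim=> [b m phi mD|T1 T1' T2 T2' _ h1 _ h2].
  by apply: trigpoly_eq (trigpoly_wave (a * b) phi mD) => t; ring.
by apply: trigpoly_eq (trigpoly_add h1 h2) => t; rewrite mulrDr.
Qed.

Lemma trigpoly_sum D (I : Type) (r : seq I) (F F' : I -> R -> R) :
  (forall i, trigpoly D (F i) (F' i)) ->
  trigpoly D (fun t => \sum_(i <- r) F i t) (fun t => \sum_(i <- r) F' i t).
Proof.
move=> FF'; elim: r => [|i r IHr].
  by apply: trigpoly_eq (trigpoly_const D 0) => t; rewrite big_nil.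
by apply: trigpoly_eq (trigpoly_add (FF' i) IHr) => t; rewrite big_cons.
Qed.

Lemma trigpoly_waveM D1 D2 a m phi b n psi :
  (m <= D1)%N -> (n <= D2)%N ->
  trigpoly (D1 + D2)
    (fun t => a * cos (m%:R * t + phi) * (b * cos (n%:R * t + psi)))
    (fun t => - (a * m%:R * sin (m%:R * t + phi)) * (b * cos (n%:R * t + psi)) +
      a * cos (m%:R * t + phi) * - (b * n%:R * sin (n%:R * t + psi))).
Proof.
wlog mn : D1 D2 a m phi b n psi / (n <= m)%N => [hwlog|] mD nD.
  have [/hwlog|/ltnW /hwlog] := leqP n m; first exact.
  rewrite addnC => /(_ D2 D1 b psi a phi nD mD).
  by apply: trigpoly_eq => t; ring.
have mnD : (m + n <= D1 + D2)%N by exact: leq_add.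
have mnD' : (m - n <= D1 + D2)%N.
  by rewrite (leq_trans (leq_subr _ _))// (leq_trans mD)// leq_addr.
have := trigpoly_add (trigpoly_wave (a * b / 2) (phi + psi) mnD)
  (trigpoly_wave (a * b / 2) (phi - psi) mnD').
apply: trigpoly_eq => t; rewrite natrD natrB//.
  have -> : (m%:R + n%:R) * t + (phi + psi) =
    (m%:R * t + phi) + (n%:R * t + psi) by ring.
  have -> : (m%:R - n%:R) * t + (phi - psi) =
    (m%:R * t + phi) - (n%:R * t + psi) by ring.
  by rewrite cosD cosB; field.
have -> : (m%:R + n%:R) * t + (phi + psi) =
  (m%:R * t + phi) + (n%:R * t + psi) by ring.
have -> : (m%:R - n%:R) * t + (phi - psi) =
  (m%:R * t + phi) - (n%:R * t + psi) by ring.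
by rewrite sinD sinB; field.
Qed.

Lemma trigpolyM D1 D2 T T' U U' : trigpoly D1 T T' -> trigpoly D2 U U' ->
  trigpoly (D1 + D2) (fun t => T t * U t) (fun t => T' t * U t + T t * U' t).
Proof.
move=> hT hU; elim: hT => [a m phi mD|T1 T1' T2 T2' _ h1 _ h2]; last first.
  by apply: trigpoly_eq (trigpoly_add h1 h2) => t; ring.
elim: hU => [b n psi nD|U1 U1' U2 U2' _ h1 _ h2].
  exact: trigpoly_waveM.
by apply: trigpoly_eq (trigpoly_add h1 h2) => t; ring.
Qed.

Lemma trigpolyX D T T' k : trigpoly D T T' ->
  trigpoly (k * D) (fun t => T t ^+ k) (fun t => k%:R * T t ^+ k.-1 * T' t).
Proof.
move=> hT; elim: k => [|k IHk].
  by apply: trigpoly_eq (trigpoly_const 0 1) => t; rewrite ?expr0 ?mul0r.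
rewrite mulSn; apply: trigpoly_eq (trigpolyM hT IHk) => t.
  by rewrite exprS.
case: k {IHk} => [|k]; first by rewrite !expr0; ring.
by rewrite /= -[k.+2%:R]natr1 exprS; ring.
Qed.

Lemma trigpoly_cos c r phi :
  trigpoly 1 (fun t => c + r * cos (t + phi)) (fun t => - (r * sin (t + phi))).
Proof.
apply: trigpoly_eq (trigpoly_add (trigpoly_const 1 c)
  (trigpoly_wave r phi (leqnn 1))) => t; first by rewrite mul1r.
by rewrite mul1r add0r mulr1.
Qed.

Lemma trigpoly_sin : trigpoly 1 sin cos.
Proof.
apply: trigpoly_eq (trigpoly_wave 1 (- (pi / 2)) (leqnn 1)) => t.
  by rewrite !mul1r cosBpihalf.
by rewrite !mul1r sinBpihalf opprK.
Qed.

Lemma trigpoly_horner (p : {poly R}) c r :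
  exists T', trigpoly (size p).-1 (fun t => p.[c + r * cos t]) T'.
Proof.
have hc : trigpoly 1 (fun t => c + r * cos t) (fun t => - (r * sin t)).
  by apply: trigpoly_eq (trigpoly_cos c r 0) => t; rewrite addr0.
exists (fun t => \sum_(i < size p)
  p`_i * (i%:R * (c + r * cos t) ^+ i.-1 * - (r * sin t))).
apply: (@trigpoly_eq _ (fun t => \sum_(i < size p) p`_i * (c + r * cos t) ^+ i)).
- by move=> t; rewrite horner_coef.
- by [].
apply: trigpoly_sum => i.
have := trigpolyZ p`_i (trigpolyX i hc); rewrite muln1; apply: trigpolyW.
by case: (size p) i => [[]//|s i]; rewrite -ltnS.
Qed.

(** The [N] equally spaced angles that avoid [0] by half a step: this offset
    keeps [sin] away from [0] on the grid. *)
Definition grid N (q : nat) : R := (q%:R + 2^-1) * (2 * pi / N%:R).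

Lemma sum_cos_telescope (delta phi : R) N :
  2 * sin (delta / 2) * \sum_(q < N) cos (q%:R * delta + phi) =
  sin (N%:R * delta - delta / 2 + phi) - sin (phi - delta / 2).
Proof.
elim: N => [|N IHN].
  by rewrite big_ord0 mulr0 mul0r sub0r (addrC _ phi) subrr.
rewrite big_ord_recr/= mulrDr IHN -[N.+1%:R]natr1.
have -> : (N%:R + 1) * delta - delta / 2 + phi =
  (N%:R * delta + phi) + delta / 2 by field.
have -> : N%:R * delta - delta / 2 + phi =
  (N%:R * delta + phi) - delta / 2 by ring.
by rewrite (sinD _ (delta / 2)) (sinB (N%:R * delta + phi)); ring.
Qed.

Lemma sinD_pi_natmul (x : R) n : sin (x + n%:R * (2 * pi)) = sin x.
Proof.
rewrite -[RHS](periodicn (@sinD2pi R) n); congr sin.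
by rewrite -(mulr_natl (pi *+ 2)) -(mulr_natl pi).
Qed.

Lemma sin_pi_ratio_neq0 m N : (0 < m < N)%N -> sin (m%:R * (pi / N%:R)) != 0 :> R.
Proof.
move=> /andP[m0 mN]; apply: lt0r_neq0; apply: sin_gt0_pi.
have N0 : (0 < N%:R :> R) by rewrite ltr0n (leq_trans _ mN).
rewrite mulr_gt0 ?ltr0n ?divr_gt0 ?pi_gt0//=.
by rewrite mulrCA gtr_pMr ?pi_gt0// ltr_pdivrMr// mul1r ltr_nat.
Qed.

(** Multiplied by [2 sin (delta / 2)], where [delta] is the increment of the angle,
    the sum telescopes; this factor is not [0] for a frequency that is not a
    multiple of [N].  The frequency is a difference of two natural numbers
    because both signs occur. *)
Lemma sum_grid_cos N m n phi : m != n -> (m < N + n)%N -> (n < N + m)%N ->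
  \sum_(q < N) cos (m%:R * grid N q - n%:R * grid N q + phi) = 0.
Proof.
move=> mn mN nN.
have N0 : N%:R != 0 :> R.
  rewrite pnatr_eq0; apply: contra mn => /eqP N0.
  by move: mN nN; rewrite N0 !add0n; case: ltngtP.
pose delta : R := (m%:R - n%:R) * (2 * pi / N%:R).
have sd : sin (delta / 2) != 0.
  wlog nm : m n @delta {phi} mn mN nN / (n < m)%N => [hwlog|].
    move: (mn); rewrite neq_ltn => /orP[mltn|/hwlog]; last exact.
    rewrite (_ : delta / 2 = - ((n%:R - m%:R) * (2 * pi / N%:R) / 2)); last first.
      by rewrite /delta; field.
    rewrite sinN oppr_eq0; apply: (hwlog n m) => //; first by rewrite eq_sym.
  rewrite (_ : delta / 2 = (m - n)%:R * (pi / N%:R)).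
    apply: sin_pi_ratio_neq0; rewrite subn_gt0 nm/= ltn_subLR ?(ltnW nm)//.
    by rewrite addnC.
  by rewrite natrB ?(ltnW nm)// /delta; field.
have := sum_cos_telescope delta (delta / 2 + phi) N.
have -> : N%:R * delta - delta / 2 + (delta / 2 + phi) =
    phi + m%:R * (2 * pi) - n%:R * (2 * pi) by rewrite /delta; field.
have -> : delta / 2 + phi - delta / 2 = phi by ring.
rewrite -(sinD_pi_natmul (_ - _) n) subrK sinD_pi_natmul subrr => /eqP.
rewrite !mulf_eq0 pnatr_eq0/= (negPf sd)/= => /eqP s0.
by rewrite -[RHS]s0; apply: eq_bigr => q _; congr cos; rewrite /grid /delta; field.
Qed.

Lemma sum_grid_sin N m n phi : m != n -> (m < N + n)%N -> (n < N + m)%N ->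
  \sum_(q < N) sin (m%:R * grid N q - n%:R * grid N q + phi) = 0.
Proof.
move=> mn mN nN; rewrite -[RHS](sum_grid_cos (phi - pi / 2) mn mN nN).
by apply: eq_bigr => q _; rewrite addrA cosBpihalf.
Qed.

(** Equally spaced grids with more than [D] nodes integrate exactly the
    trigonometric polynomials of degree [D], so they all give the same mean. *)
Lemma trigpoly_mean D T T' : trigpoly D T T' ->
  exists c, forall N, (D < N)%N -> \sum_(q < N) T (grid N q) = N%:R * c.
Proof.
elim=> [a m phi mD|T1 T1' T2 T2' _ [c1 h1] _ [c2 h2]]; last first.
  by exists (c1 + c2) => N DN; rewrite big_split/= h1// h2// mulrDr.
have [->|m0] := eqVneq m 0%N.
  exists (a * cos phi) => N _; under eq_bigr do rewrite mul0r add0r.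
  by rewrite sumr_const card_ord mulr_natl.
exists 0 => N DN; rewrite -mulr_sumr mulr0.
rewrite (_ : \sum_(_ < _) _ = 0) ?mulr0//.
rewrite -[RHS](@sum_grid_cos N m 0%N phi)//.
- by apply: eq_bigr => q _; rewrite mul0r subr0.
- by rewrite addn0 (leq_ltn_trans mD).
- by rewrite addn_gt0 (leq_ltn_trans _ DN).
Qed.

Lemma normr_sin_natmul n (t : R) : `|sin (n%:R * t)| <= n%:R * `|sin t|.
Proof.
elim: n => [|n IHn]; first by rewrite !mul0r sin0 normr0.
rewrite -natr1 mulrDl mul1r sinD (le_trans (ler_normD _ _))//.
rewrite !normrM mulrDl mul1r lerD//.
  by rewrite (le_trans _ IHn)// ler_piMr ?normr_ge0 ?cos_max.
by rewrite ler_piMl ?normr_ge0 ?cos_max.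
Qed.

Lemma sin_half_pi_odd (q : nat) : sin ((q%:R + 2^-1) * pi) ^+ 2 = 1 :> R.
Proof.
have -> : (q%:R + 2^-1) * pi = q%:R * pi + pi / 2 :> R by field.
rewrite sinDpihalf; elim: q => [|q IHq]; first by rewrite mul0r cos0 expr1n.
by rewrite -natr1 mulrDl mul1r cosDpi sqrrN.
Qed.

(** Here [n t] is an odd multiple of [pi / 2] for every node [t], so
    [1 = |sin (n t)| <= n |sin t|]. *)
Lemma sin_grid_ge n q : (0 < n)%N ->
  (n%:R ^+ 2)^-1 <= sin (grid n.*2 q) ^+ 2.
Proof.
move=> n0; have n0' : 0 < n%:R :> R by rewrite ltr0n.
have ng : n%:R * grid n.*2 q = (q%:R + 2^-1) * pi.
  by rewrite /grid -muln2 natrM; field; rewrite gt_eqF.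
have h := normr_sin_natmul n (grid n.*2 q); rewrite ng in h.
have : `|sin ((q%:R + 2^-1) * pi) : R| ^+ 2 <=
    (n%:R * `|sin (grid n.*2 q)|) ^+ 2.
  by rewrite lerXn2r ?nnegrE ?mulr_ge0 ?normr_ge0 ?ler0n.
rewrite exprMn !real_normK ?num_real// sin_half_pi_odd => h2.
by rewrite -[leLHS]mul1r ler_pdivrMr ?exprn_gt0// mulrC.
Qed.

Lemma sin_grid4 q : sin (grid 4 q) ^+ 2 = 2^-1.
Proof.
have := sin_half_pi_odd q.
have -> : (q%:R + 2^-1) * pi = grid 4 q *+ 2 :> R.
  by rewrite /grid -mulr_natr; field.
rewrite sin_mulr2n -mulr_natr !exprMn cos2sin2 => h.
set s := sin (grid 4 q) ^+ 2 in h *.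
have : (2 * s - 1) ^+ 2 = 1 - (1 - s) * s * 2 ^+ 2 by ring.
by rewrite h subrr => /eqP; rewrite expf_eq0/= => /eqP; lra.
Qed.

(** Both sides are [N] times the mean of a trigonometric polynomial, which can be
    computed on the grid with [N0] nodes instead; there [sin^2 >= kappa] at
    each node. *)
Lemma grid_mean_weight N N0 r (kappa : R) (p : {poly R}) c s :
  (((size p).-1 + r.*2) < N)%N -> ((size p).-1 + r.*2 < N0)%N ->
  0 <= kappa ->
  (forall q, kappa <= sin (grid N0 q) ^+ 2) -> (forall x, 0 <= p.[x]) ->
  kappa ^+ r * (\sum_(q < N) p.[c + s * cos (grid N q)]) <=
  \sum_(q < N) sin (grid N q) ^+ r.*2 * p.[c + s * cos (grid N q)].
Proof.
move=> pN pN0 kappa0 kN0 p0.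
have [T' hT] := trigpoly_horner p c s.
have hU := trigpolyM hT (trigpolyX r.*2 trigpoly_sin).
rewrite muln1 in hU.
have [C hC] := trigpoly_mean hT; have [C' hC'] := trigpoly_mean hU.
have ltN M : ((size p).-1 + r.*2 < M)%N -> ((size p).-1 < M)%N.
  by apply: leq_ltn_trans; exact: leq_addr.
have hN := hC' _ pN; have hN0 := hC' _ pN0.
have N0_gt0 : 0 < N0%:R :> R by rewrite ltr0n (leq_ltn_trans _ pN0).
under [leRHS]eq_bigr do rewrite mulrC.
rewrite hN hC ?ltN// mulrCA ler_wpM2l ?ler0n//.
rewrite -(ler_pM2l N0_gt0) -hN0 mulrCA -hC ?ltN// mulr_sumr.
apply: ler_sum => q _; rewrite mulrC ler_wpM2l// -muln2 exprM.
rewrite -exprM mulnC exprM lerXn2r ?nnegrE ?sqr_ge0//.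
Qed.

Section Riesz.
Variable d : nat.
Hypothesis d0 : (0 < d)%N.

(** The Fejer kernel up to normalization, in the form of a double sum that is
    visibly the squared modulus of an exponential sum. *)
Definition fejer (t : R) : R :=
  \sum_(a < d) \sum_(b < d) cos (a%:R * t - b%:R * t).

Definition riesz_weight (j : nat) : R :=
  fejer (grid d.*2 j) / (2 * d%:R ^+ 2).

(** The nodes are the zeros of [cos (d t)], so this is [1] or [-1]. *)
Definition riesz_sign (j : nat) : R := sin (d%:R * grid d.*2 j).

Let d_gt0 : 0 < d%:R :> R. Proof. by rewrite ltr0n. Qed.

Lemma riesz_weight_ge0 j : 0 <= riesz_weight j.
Proof.
rewrite divr_ge0 ?mulr_ge0 ?exprn_ge0 ?ler0n// /fejer.
set t := grid _ _.
have -> : \sum_(a < d) \sum_(b < d) cos (a%:R * t - b%:R * t) =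
    (\sum_(a < d) cos (a%:R * t)) ^+ 2 + (\sum_(a < d) sin (a%:R * t)) ^+ 2.
  rewrite !expr2 !big_distrlr/= -big_split/=; apply: eq_bigr => a _.
  by rewrite -big_split/=; apply: eq_bigr => b _; rewrite cosB.
by rewrite addr_ge0 ?sqr_ge0.
Qed.

Lemma riesz_sign_sqr j : riesz_sign j ^+ 2 = 1.
Proof.
rewrite -(sin_half_pi_odd j); congr (sin _ ^+ _).
by rewrite /grid -muln2 natrM; field; rewrite gt_eqF.
Qed.

Lemma sum_riesz_weight : \sum_(j < d.*2) riesz_weight j = 1.
Proof.
rewrite -mulr_suml /fejer exchange_big/=.
under eq_bigr do rewrite exchange_big/=.
have -> : \sum_(a < d) \sum_(b < d) \sum_(j < d.*2)
    cos (a%:R * grid d.*2 j - b%:R * grid d.*2 j) =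
    \sum_(a < d) (d.*2)%:R :> R.
  apply: eq_bigr => a _; rewrite (bigD1 a)//= [X in _ + X]big1 ?addr0.
    under eq_bigr do rewrite subrr cos0.
    by rewrite sumr_const card_ord.
  move=> b ba; rewrite -[RHS](@sum_grid_cos d.*2 a b 0).
  - by apply: eq_bigr => j _; rewrite addr0.
  - by rewrite eq_sym.
  - by rewrite -addnn -addnA (leq_trans (ltn_ord a))// leq_addr.
  - by rewrite -addnn -addnA (leq_trans (ltn_ord b))// leq_addr.
rewrite sumr_const card_ord -[_ *+ d]mulr_natr -muln2 natrM; field.
by rewrite gt_eqF.
Qed.

(** At a node [t] one has [cos (d t) = 0], hence
    [sin (d t) cos (m t + psi) = sin ((d - m) t - psi)].  Multiplying by the
    Fejer kernel and summing over the nodes, only the pairs [(a, b)] with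
    [b = (d - m) + a] survive, and there are [m] of them. *)
Lemma riesz_wave m psi : (m <= d)%N ->
  d%:R * (\sum_(j < d.*2) riesz_weight j * riesz_sign j *
    cos (m%:R * grid d.*2 j + psi)) = - (m%:R * sin psi).
Proof.
move=> md; set n := (d - m)%N.
have mdn : m%:R = d%:R - n%:R :> R by rewrite natrB// opprB addrC subrK.
have signE j : riesz_sign j * cos (m%:R * grid d.*2 j + psi) =
    sin (n%:R * grid d.*2 j - psi).
  have dg : d%:R * grid d.*2 j = j%:R * pi + pi / 2.
    by rewrite /grid -muln2 natrM; field; rewrite gt_eqF.
  have c0 : cos (d%:R * grid d.*2 j) = 0.
    have := riesz_sign_sqr j; rewrite /riesz_sign sin2cos2 => /eqP.
    by rewrite subr_eq addrC -subr_eq subrr eq_sym sqrf_eq0 => /eqP.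
  have -> : n%:R * grid d.*2 j - psi =
      d%:R * grid d.*2 j - (m%:R * grid d.*2 j + psi).
    by rewrite mdn; ring.
  by rewrite sinB c0 mul0r subr0.
under eq_bigr do rewrite -mulrA signE /riesz_weight mulrAC.
rewrite -mulr_suml /fejer.
under eq_bigr do rewrite mulr_suml.
rewrite exchange_big/=.
under eq_bigr do (under eq_bigr do rewrite mulr_suml; rewrite exchange_big/=).
have half a b (t : R) : cos (a%:R * t - b%:R * t) * sin (n%:R * t - psi) =
    2^-1 * (sin ((n + a)%:R * t - b%:R * t - psi) +
            sin ((n + b)%:R * t - a%:R * t - psi)).
  rewrite !natrD.
  have -> : (n%:R + a%:R) * t - b%:R * t - psi =
    (n%:R * t - psi) + (a%:R * t - b%:R * t) by ring.
  have -> : (n%:R + b%:R) * t - a%:R * t - psi =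
    (n%:R * t - psi) - (a%:R * t - b%:R * t) by ring.
  by rewrite (sinD (n%:R * t - psi)) (sinB (n%:R * t - psi)); field.
under eq_bigr do under eq_bigr do
  (under eq_bigr do rewrite half; rewrite -mulr_sumr big_split/=).
pose S a b := \sum_(j < d.*2)
  sin ((n + a)%:R * grid d.*2 j - b%:R * grid d.*2 j - psi).
have -> : \sum_(a < d) \sum_(b < d) (2^-1 * (S a b + S b a)) =
    \sum_(a < d) \sum_(b < d) S a b.
  under eq_bigr do rewrite -mulr_sumr big_split/=.
  rewrite -mulr_sumr big_split/= [X in _ + X]exchange_big/=.
  by field.
have nd : (n <= d)%N by exact: leq_subr.
have SE (a b : 'I_d) : S a b =
    if (b == n + a :> nat)%N then (d.*2)%:R * - sin psi else 0.
  rewrite /S; case: eqVneq => [->|ban].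
    under eq_bigr do rewrite subrr add0r sinN.
    by rewrite sumr_const card_ord mulr_natl.
  rewrite sum_grid_sin//; first by rewrite eq_sym.
    rewrite -addnn -addnA (leq_trans (_ : _ < n + d)%N) ?ltn_add2l//.
    by rewrite leq_add// leq_addr.
  rewrite -addnn -addnA (leq_trans (ltn_ord b))// leq_addr//.
have -> : \sum_(a < d) \sum_(b < d) S a b = m%:R * ((d.*2)%:R * - sin psi).
  transitivity (\sum_(a < d) if (a < m)%N then (d.*2)%:R * - sin psi else 0).
    apply: eq_bigr => a _; under eq_bigr do rewrite SE.
    rewrite -big_mkcond/=; case: ifPn => am.
      have h : (n + a < d)%N by rewrite -ltn_subRL /n subKn.
      by rewrite (big_pred1 (Ordinal h)).
    rewrite big_pred0// => b; apply/negbTE/eqP => bE.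
    by move: (ltn_ord b); rewrite bE -ltn_subRL /n subKn// (negPf am).
  set Y := _ * - sin psi; rewrite -big_mkcond/= sumr_const mulr_natl; congr (_ *+ _).
  rewrite -[RHS](card_ord m) -!sum1_card.
  transitivity (\sum_(i < d | (i < m)%N) 1)%N; first exact: eq_bigl.
  by rewrite (big_ord_narrow md)/=; apply: eq_bigl.
rewrite -muln2 natrM; field.
by rewrite gt_eqF.
Qed.

(** Both sides are linear in [T], so it is enough to treat one wave.  The point
    of the formula for Bernstein inequalities is that the weights are
    nonnegative and have sum [1]. *)
Lemma riesz_interpolation T T' s : trigpoly d T T' ->
  T' s = d%:R * \sum_(j < d.*2)
    riesz_weight j * riesz_sign j * T (s + grid d.*2 j).
Proof.
elim=> [a m phi md|T1 T1' T2 T2' _ -> _ ->]; last first.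
  rewrite -mulrDr -big_split/=; congr (_ * _); apply: eq_bigr => j _.
  by rewrite mulrDr.
rewrite -(mulrA a) -mulrN -riesz_wave// mulrCA; congr (_ * _).
rewrite mulr_sumr; apply: eq_bigr => j _.
by rewrite mulrCA; congr (_ * (_ * cos _)); ring.
Qed.

End Riesz.
End TrigonometricPolynomials.

(** * Polynomial functions and tangent inequalities *)

Section Degree.
Variables (R : realType) (n : nat).
Implicit Types f g h : mpoly n R.

Lemma degree_leP d f :
  degree_le d f <-> (forall m, m \in mpoly.msupp f -> (mpoly.mdeg m <= d)%N).
Proof.
rewrite /degree_le msizeE; split => [|h].
  by move=> /bigmax_leqP_seq h m mf; exact: (h m mf isT).
by apply/bigmax_leqP_seq => m mf _; exact: h.
Qed.

Lemma degree_leM a b f g :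
  degree_le a f -> degree_le b g -> degree_le (a + b) (f * g).
Proof.
move=> /degree_leP fa /degree_leP gb; apply/degree_leP => m.
move=> /msuppM_le/allpairsP[[m1 m2] /= [m1f m2g ->]].
by rewrite mdegD leq_add ?fa ?gb.
Qed.

Lemma degree_le_prod a (I : finType) (F : I -> mpoly n R) :
  (forall i, degree_le a (F i)) -> degree_le (#|I| * a) (\prod_i F i).
Proof.
move=> Fa; rewrite -sum_nat_const.
apply: (big_rec2 (fun (h : mpoly n R) b => degree_le b h)) => [|i b h _ hb].
  by rewrite /degree_le msize1.
exact: degree_leM.
Qed.

Lemma degree_leX a k f : degree_le a f -> degree_le (k * a) (f ^+ k).
Proof.
move=> fa; rewrite -[X in degree_le (X * _) _](card_ord k).
rewrite -[X in degree_le _ (f ^+ X)](card_ord k) -prodr_const.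
by apply: degree_le_prod => _.
Qed.

Lemma degree_le_deriv d f i : degree_le d f -> degree_le d.-1 (mderiv i f).
Proof.
move=> /degree_leP fd; apply/degree_leP => m; rewrite mcoeff_msupp mcoeff_deriv.
move=> mf; have /fd : mnm_add m (mnm1 i) \in msupp f.
  by rewrite mcoeff_msupp; apply: contra mf => /eqP ->; rewrite mul0rn.
by rewrite mdegD mdeg1 addn1 => mfd; rewrite -ltnS (ltn_predK mfd).
Qed.

End Degree.

Section PolynomialFunctions.
Variable R : realType.

Definition polyclass D (phi : R -> R) : Prop :=
  exists2 p : {poly R}, (size p <= D.+1)%N & phi = horner p.

Lemma linear_polyclass D : linear_class (polyclass D).
Proof.
split=> [f g [p pD ->] [q qD ->]|a f [p pD ->]].
  exists (p + q); last by apply/funext => x; rewrite hornerD.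
  by rewrite (leq_trans (size_polyD _ _))// geq_max pD.
exists (a *: p); last by apply/funext => x; rewrite hornerZ.
exact: leq_trans (size_scale_leq _ _) pD.
Qed.

Lemma polyclass_cst D a : polyclass D (cst a).
Proof.
exists a%:P; last by apply/funext => x; rewrite hornerC.
by rewrite (leq_trans (size_polyC_leq1 _)).
Qed.

Lemma polyclass_exp D k : (k <= D)%N -> polyclass D (fun x => x ^+ k).
Proof.
by move=> kD; exists 'X^k; [rewrite size_polyXn|apply/funext => x; rewrite hornerXn].
Qed.

Lemma mnm_le_mdeg n (m : multinom n) i : (m i <= mdeg m)%N.
Proof. by rewrite mdegE (bigD1 i)//= leq_addr. Qed.

(** Monomials are products of functions of one coordinate. *)
Lemma separable_meval n D (h : mpoly n R) : degree_le D h ->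
  separable (polyclass D) (fun x : 'I_n -> R => meval x h).
Proof.
move=> /degree_leP hD.
rewrite (_ : (fun x => _) = (fun x => \sum_(m <- msupp h)
   if m \in msupp h then mcoeff m h * \prod_i (x i) ^+ m i else 0)); last first.
  apply/funext => x; rewrite mevalE big_seq [RHS]big_seq.
  by apply: eq_bigr => m ->.
apply: (@separable_sum _ _ _ _ _ (msupp h) xpredT (fun m x =>
    if m \in msupp h then mcoeff m h * \prod_i (x i) ^+ m i else 0)) => [||m _].
- exact: polyclass_cst.
- exact: polyclass_cst.
case mh : (m \in msupp h); last by apply: separable_const; exact: polyclass_cst.
apply: (@separable_prod _ _ _ _ _ (fun i x => x ^+ m i)) => i.
by apply: polyclass_exp; rewrite (leq_trans (mnm_le_mdeg _ _))// hD.
Qed.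

(** The polynomial functions of two real variables, generated inductively, which
    is the form in which continuity and substitution are proved. *)
Inductive polyclass2 : (R * R -> R) -> Prop :=
| polyclass2_cst a : polyclass2 (cst a)
| polyclass2_fst : polyclass2 fst
| polyclass2_snd : polyclass2 snd
| polyclass2_add f g : polyclass2 f -> polyclass2 g ->
    polyclass2 (fun u => f u + g u)
| polyclass2_mul f g : polyclass2 f -> polyclass2 g ->
    polyclass2 (fun u => f u * g u).

Lemma linear_polyclass2 : linear_class polyclass2.
Proof.
split=> [f g|a f pf]; first exact: polyclass2_add.
exact: polyclass2_mul (polyclass2_cst a) pf.
Qed.

Lemma polyclass2_exp k f : polyclass2 f -> polyclass2 (fun u => f u ^+ k).
Proof.
move=> pf; elim: k => [|k IHk]; first exact: polyclass2_cst.
rewrite (_ : (fun u => _) = (fun u => f u * f u ^+ k)).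
  exact: polyclass2_mul.
by apply/funext => u; rewrite exprS.
Qed.

Lemma polyclass2_horner (p : {poly R}) f : polyclass2 f ->
  polyclass2 (fun u => p.[f u]).
Proof.
move=> pf; elim/poly_ind: p => [|p c IHp].
  rewrite (_ : (fun u => _) = cst 0); first exact: polyclass2_cst.
  by apply/funext => u; rewrite horner0.
rewrite (_ : (fun u => _) = (fun u => p.[f u] * f u + cst c u)).
  apply: polyclass2_add; last exact: polyclass2_cst.
  exact: polyclass2_mul.
by apply/funext => u; rewrite hornerMXaddC.
Qed.

End PolynomialFunctions.

Section Convexity.
Variable R : realFieldType.

(** The power [k] is convex on the half-line, hence above its tangent at [s].
    The difference for [k.+1] is [t] times the one for [k] plus a multiple of
    [(t - s)^2]. *)
Lemma tangent_exp k (t s : R) : 0 <= t -> 0 <= s ->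
  s ^+ k + k%:R * s ^+ k.-1 * (t - s) <= t ^+ k.
Proof.
move=> t0 s0; elim: k => [|k IHk]; first by rewrite !expr0 !mul0r addr0.
rewrite [leRHS]exprS; apply: le_trans (ler_wpM2l t0 IHk).
case: k {IHk} => [|k]; first by rewrite !expr0 expr1; lra.
rewrite -subr_ge0 [leRHS](_ : _ = k.+1%:R * s ^+ k * (t - s) ^+ 2).
  by rewrite mulr_ge0 ?sqr_ge0// mulr_ge0 ?exprn_ge0.
by rewrite /= -[k.+2%:R]natr1 !exprS; ring.
Qed.

(** The tangent inequality for [s^2] and [t^2] gives the one for [s] and [t],
    because [t^2 - s^2 - 2 s (t - s)] is a square; no sign condition on [s] and
    [t] remains. *)
Lemma tangent_exp_even k (t s : R) :
  s ^+ k.*2 + k.*2%:R * (s ^+ k.*2.-1) * (t - s) <= t ^+ k.*2.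
Proof.
case: k => [|k]; first by rewrite double0 !expr0 !mul0r addr0.
have := tangent_exp k.+1 (sqr_ge0 t) (sqr_ge0 s).
rewrite [k.+1.-1]/= -!exprM !mul2n; apply: le_trans.
rewrite [in k.+1.*2.-1]doubleS [_.-1]/=.
rewrite -subr_ge0 [leRHS](_ : _ = k.+1%:R * s ^+ k.*2 * (t - s) ^+ 2).
  by rewrite mulr_ge0 ?sqr_ge0// mulr_ge0 ?ler0n// -muln2 mulnC exprM exprn_ge0 ?sqr_ge0.
by rewrite -[in (k.+1.*2)%:R](muln2 k.+1) natrM doubleS !exprS; ring.
Qed.

(** The tangent inequality at the weighted mean, averaged.  The signs [s i]
    disappear because the exponent is even. *)
Lemma jensen_exp_even k (I : finType) (w s a : I -> R) :
  (forall i, 0 <= w i) -> \sum_i w i = 1 -> (forall i, s i ^+ 2 = 1) ->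
  (\sum_i w i * s i * a i) ^+ k.*2 <= \sum_i w i * a i ^+ k.*2.
Proof.
move=> w0 w1 s1; set m := \sum_i w i * s i * a i.
have -> : \sum_i w i * a i ^+ k.*2 = \sum_i w i * (s i * a i) ^+ k.*2.
  apply: eq_bigr => i _.
  by rewrite exprMn -(mul2n k) (exprM (s i)) s1 expr1n mul1r.
have -> : m ^+ k.*2 = \sum_i w i *
    (m ^+ k.*2 + k.*2%:R * m ^+ k.*2.-1 * (s i * a i - m)).
  under eq_bigr do rewrite mulrDr mulrCA mulrBr mulrA.
  rewrite big_split/= -mulr_suml w1 mul1r -mulr_sumr sumrB -/m.
  by rewrite -mulr_suml w1 mul1r subrr mulr0 addr0.
by apply: ler_sum => i _; rewrite ler_wpM2l// tangent_exp_even.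
Qed.

End Convexity.

(** * Bernstein inequality for products of laws on circles *)

Section Curve.
Variables (R : realType) (n : nat) (c r theta : 'I_n -> R).

Let curve (t : R) (i : 'I_n) : R := c i + r i * cos (t + theta i).

(** Along a curve of points on circles turning at unit speed a polynomial is a
    trigonometric polynomial of the same degree, and the chain rule gives its
    derivative.  The property is stable under products and holds for
    variables, hence for monomials. *)
Lemma trigpoly_meval d (f : mpoly n R) : degree_le d f ->
  trigpoly d (fun t => meval (curve t) f)
    (fun t => \sum_i - (r i * sin (t + theta i)) * meval (curve t) (mderiv i f)).
Proof.
pose Q D (g : mpoly n R) := trigpoly D (fun t => meval (curve t) g)
    (fun t => \sum_i - (r i * sin (t + theta i)) * meval (curve t) (mderiv i g)).
have Q1 D : Q D 1.
  apply: trigpoly_eq (trigpoly_const D 1) => t; first by rewrite meval1.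
  by rewrite big1// => i _; rewrite -mpolyC1 mderivC meval0 mulr0.
have QX i : Q 1%N (mpolyX R (mnm1 i)).
  apply: trigpoly_eq (trigpoly_cos (c i) (r i) (theta i)) => t.
    by rewrite mevalXU.
  rewrite (bigD1 i)//= big1 ?addr0.
    rewrite mderivX mevalZ mnm1E eqxx mul1r (_ : mnm_sub _ _ = mnm0).
      by rewrite mpolyX0 meval1 mulr1.
    by apply/mnmP => j; rewrite mnmBE subnn mnm0E.
  move=> j ji; rewrite mderivX mevalZ mnm1E eq_sym (negPf ji) mul0r mulr0//.
have QM D1 D2 g h : Q D1 g -> Q D2 h -> Q (D1 + D2)%N (g * h).
  move=> Qg Qh; apply: trigpoly_eq (trigpolyM Qg Qh) => t.
    by rewrite mevalM.
  rewrite mulr_suml mulr_sumr -big_split/=; apply: eq_bigr => i _.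
  by rewrite mderivM mevalD !mevalM; ring.
have QXn i k : Q k (mpolyX R (mnm1 i) ^+ k).
  elim: k => [|k IHk]; first exact: Q1.
  by rewrite exprS -add1n; exact: QM.
have Qm m : Q (mdeg m) (mpolyX R m).
  rewrite mpolyXE_id mdegE.
  apply: (big_rec2 (fun (h : mpoly n R) D => Q D h)) => [|i D h _ hD].
    exact: Q1.
  exact: QM.
move=> /degree_leP fd; rewrite -/(Q d f) /Q.
apply: (@trigpoly_eq _ _ (fun t => \sum_(m <- msupp f) (if m \in msupp f then
      mcoeff m f * meval (curve t) (mpolyX R m) else 0))
    (fun t => \sum_(m <- msupp f) (if m \in msupp f then mcoeff m f *
      \sum_i - (r i * sin (t + theta i)) *
        meval (curve t) (mderiv i (mpolyX R m)) else 0))).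
- move=> t; rewrite [in RHS](mpolyE f) raddf_sum/= big_seq [RHS]big_seq.
  by apply: eq_bigr => m ->; rewrite mevalZ.
- move=> t; transitivity (\sum_(m <- msupp f) \sum_i mcoeff m f *
      (- (r i * sin (t + theta i)) *
        meval (curve t) (mderiv i (mpolyX R m)))).
    by rewrite big_seq [RHS]big_seq; apply: eq_bigr => m ->; rewrite mulr_sumr.
  rewrite exchange_big/=; apply: eq_bigr => i _.
  have -> : mderiv i f =
      \sum_(m <- msupp f) mcoeff m f *: mderiv i (mpolyX R m).
    rewrite {1}(mpolyE f) (linear_sum (mderiv i)).
    by apply: eq_bigr => m _; exact: mderivZ.
  rewrite raddf_sum mulr_sumr; apply: eq_bigr => m _.
  by rewrite [X in _ = _ * X](mevalZ (curve t)) mulrCA.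
- apply: trigpoly_sum => m.
  case mf : (m \in msupp f); last exact: trigpoly_const.
  by apply: trigpolyZ; apply: trigpolyW (Qm m); exact: fd.
Qed.

End Curve.

Section CircleBundle.
Variables (R : realType) (N' : nat).
Local Notation N := N'.+1.
Local Notation Z := (R * R * 'I_N)%type.

Definition abscissa (z : Z) : R := z.1.1 + z.1.2 * cos (grid R N z.2).
Definition ordinate (z : Z) : R := z.1.2 * sin (grid R N z.2).
Definition rot (s : nat) (z : Z) : Z := (z.1, z.2 + inZp s).
Definition flip (z : Z) : Z := (z.1, rev_ord z.2).

(** The law of a random circle, of centre [u.1] and radius [u.2], is given by
    [lam]; the angle is uniform on the grid and independent of the circle. *)
Definition circle_mean (lam : (R * R -> R) -> R) (phi : Z -> R) : R :=
  lam (fun u => N%:R^-1 * \sum_(q < N) phi (u, q)).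

(** Test functions are polynomial in the circle, and arbitrary in the angle, which
    takes finitely many values. *)
Definition fibre_poly (phi : Z -> R) : Prop :=
  forall q, polyclass2 (fun u => phi (u, q)).

Lemma cosD_pi_natmul (x : R) k : cos (x + k%:R * (2 * pi)) = cos x.
Proof.
rewrite -[RHS](periodicn (@cosD2pi R) k); congr cos.
by rewrite -(mulr_natl (pi *+ 2)) -(mulr_natl pi).
Qed.

(** The index of the angle is reduced modulo [N], that is the angle modulo
    [2 pi]. *)
Lemma abscissa_rot s z :
  abscissa (rot s z) = z.1.1 + z.1.2 * cos (grid R N z.2 + s%:R * (2 * pi / N%:R)).
Proof.
rewrite /abscissa /rot/= modnDmr; congr (_ + _ * _).
set q := (nat_of_ord z.2).
rewrite -(cosD_pi_natmul (grid R N ((q + s) %% N)) ((q + s) %/ N)).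
congr cos; rewrite /grid.
have -> : s%:R = ((q + s) %/ N)%:R * N%:R + ((q + s) %% N)%:R - q%:R :> R.
  by rewrite -natrM -natrD -divn_eq natrD; ring.
have : N%:R != 0 :> R by rewrite pnatr_eq0.
by move: (N%:R : R) => b b0; field.
Qed.

Lemma grid_rev (q : 'I_N) : grid R N (rev_ord q) = 2 * pi - grid R N q.
Proof.
have : N%:R != 0 :> R by rewrite pnatr_eq0.
rewrite /grid/= natrB// -[q.+1%:R]natr1.
by move: (N%:R : R) => b b0; field.
Qed.

Lemma abscissa_flip z : abscissa (flip z) = abscissa z.
Proof.
rewrite /abscissa /flip/= grid_rev; congr (_ + _ * _).
by rewrite -[2 * pi]mul1r addrC (cosD_pi_natmul _ 1) cosN.
Qed.

Lemma ordinate_flip z : ordinate (flip z) = - ordinate z.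
Proof.
rewrite /ordinate /flip/= grid_rev.
by rewrite -[2 * pi]mul1r addrC (sinD_pi_natmul _ 1) sinN mulrN.
Qed.

Lemma circle_mean_rot lam s phi :
  circle_mean lam (fun z => phi (rot s z)) = circle_mean lam phi.
Proof.
congr lam; apply/funext => u; congr (_ * _).
by rewrite [RHS](reindex_inj (addIr (inZp s))).
Qed.

Lemma circle_mean_flip lam phi :
  circle_mean lam (fun z => phi (flip z)) = circle_mean lam phi.
Proof.
congr lam; apply/funext => u; congr (_ * _).
by rewrite [RHS](reindex_inj rev_ord_inj).
Qed.

Lemma linear_fibre_poly : linear_class fibre_poly.
Proof.
split=> [f g pf pg q|a f pf q]; first exact: polyclass2_add.
exact: (lcZ (linear_polyclass2 R)).
Qed.

Lemma fibre_polyM f g : fibre_poly f -> fibre_poly g ->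
  fibre_poly (fun z => f z * g z).
Proof. by move=> pf pg q; exact: polyclass2_mul. Qed.

Lemma fibre_poly_cst a : fibre_poly (cst a).
Proof. by move=> q; exact: polyclass2_cst. Qed.

Lemma fibre_polyX k f : fibre_poly f -> fibre_poly (fun z => f z ^+ k).
Proof. by move=> pf q; exact: polyclass2_exp. Qed.

Lemma fibre_poly_abscissa : fibre_poly abscissa.
Proof.
move=> q; apply: polyclass2_add; first exact: polyclass2_fst.
exact: polyclass2_mul (polyclass2_snd R) (polyclass2_cst (cos (grid R N q))).
Qed.

Lemma fibre_poly_ordinate : fibre_poly ordinate.
Proof.
move=> q.
exact: polyclass2_mul (polyclass2_snd R) (polyclass2_cst (sin (grid R N q))).
Qed.

Lemma fibre_poly_horner (p : {poly R}) f : fibre_poly f ->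
  fibre_poly (fun z => p.[f z]).
Proof. by move=> pf q; exact: polyclass2_horner. Qed.

Lemma fibre_poly_rot s f : fibre_poly f -> fibre_poly (fun z => f (rot s z)).
Proof. by move=> pf q; exact: (pf (q + inZp s)). Qed.

Lemma polyclass2_circle_mean (phi : Z -> R) : fibre_poly phi ->
  polyclass2 (fun u => N%:R^-1 * \sum_(q < N) phi (u, q)).
Proof.
move=> pphi; apply: (lcZ (linear_polyclass2 R)).
elim: (index_enum _) => [|q s IHs].
  rewrite (_ : (fun u => _) = cst 0); first exact: polyclass2_cst.
  by apply/funext => u; rewrite big_nil.
rewrite (_ : (fun u => _) = (fun u => phi (u, q) + \sum_(q <- s) phi (u, q))).
  exact: polyclass2_add.
by apply/funext => u; rewrite big_cons.
Qed.

Lemma linear_circle_mean lam : linear_on (@polyclass2 R) lam ->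
  linear_on fibre_poly (circle_mean lam).
Proof.
move=> linl; split=> [f g pf pg|a f pf]; rewrite /circle_mean.
  rewrite -(loD linl); try exact: polyclass2_circle_mean.
  by congr lam; apply/funext => u; rewrite big_split/= mulrDr.
rewrite -(loZ linl); last exact: polyclass2_circle_mean.
by congr lam; apply/funext => u; rewrite -mulr_sumr mulrCA.
Qed.

Lemma positive_circle_mean lam : positive_on (@polyclass2 R) lam ->
  positive_on fibre_poly (circle_mean lam).
Proof.
move=> posl f pf f0; apply: posl; first exact: polyclass2_circle_mean.
by move=> u; rewrite mulr_ge0 ?invr_ge0 ?ler0n// sumr_ge0.
Qed.

End CircleBundle.

Section ProductInequality.
Variables (R : realType) (n d k N' Q : nat).
Local Notation N := N'.+1.
Local Notation Z := (R * R * 'I_N)%type.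
Local Notation x := (@abscissa R N').
Local Notation y := (@ordinate R N').
Local Notation A := (@fibre_poly R N').
Hypothesis d0 : (0 < d)%N.
Hypothesis NE : N = (4 * d * Q)%N.
Variables (lam : 'I_n -> (R * R -> R) -> R) (M E : 'I_n -> (R -> R) -> R).
Variable K : R.
Hypothesis K0 : 0 <= K.
Hypothesis linlam : forall i, linear_on (@polyclass2 R) (lam i).
Hypothesis poslam : forall i, positive_on (@polyclass2 R) (lam i).
Let l i := circle_mean (N' := N') (lam i).
Let Dtop := (k.*2 * d)%N.
Let Dgrad := (k * d.-1).*2.
Hypothesis lM : forall i phi, polyclass Dtop phi ->
  M i phi = l i (fun z => phi (x z)).
Hypothesis linE : forall i, linear_on (@polyclass R Dgrad) (E i).
Hypothesis posE : forall i, positive_on (@polyclass R Dgrad) (E i).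
Hypothesis lE : forall i a phi, (a <= k)%N -> polyclass Dgrad phi ->
  (forall t, 0 <= phi t) ->
  K ^+ a * E i phi <= l i (fun z => y z ^+ a.*2 * phi (x z)).

Let linl i : linear_on A (l i). Proof. exact: linear_circle_mean. Qed.
Let posl i : positive_on A (l i). Proof. exact: positive_circle_mean. Qed.
Let lcA : linear_class A. Proof. exact: linear_fibre_poly. Qed.
Let A1 : A (cst 1). Proof. exact: fibre_poly_cst. Qed.
Let A0 : A (cst 0). Proof. exact: fibre_poly_cst. Qed.
Let mulA := @fibre_polyM R N'.

Let X (z : 'I_n -> Z) (i : 'I_n) : R := x (z i).

Let separable_meval_comp (xi : Z -> R) (h : mpoly n R) : A xi ->
  separable A (fun z : 'I_n -> Z => meval (fun i => xi (z i)) h).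
Proof.
move=> Axi.
rewrite (_ : (fun z => _) = (fun z => \sum_(m <- msupp h)
   mcoeff m h * \prod_i (xi (z i)) ^+ m i)); last first.
  by apply/funext => z; rewrite mevalE.
apply: (@separable_sum _ _ _ _ _ (msupp h) xpredT
  (fun m z => mcoeff m h * \prod_i (xi (z i)) ^+ m i)) => // m _.
apply: (@separable_prod _ _ _ _ _ (fun i z => xi z ^+ m i)) => i.
exact: fibre_polyX.
Qed.

Let sepX (h : mpoly n R) : separable A (fun z : 'I_n -> Z => meval (X z) h).
Proof. exact/(@separable_meval_comp x)/fibre_poly_abscissa. Qed.

(** Riesz' formula at the angle [0] of the simultaneous rotation.  Its nodes
    [grid d.*2 j] are multiples of the step of the grid with [4 d Q] nodes: they
    are rotations of this grid by [(2 j + 1) Q] steps. *)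
Lemma riesz_pointwise (f : mpoly n R) (z : 'I_n -> Z) : degree_le d f ->
  \sum_i y (z i) * meval (X z) (mderiv i f) =
  - (d%:R * \sum_(j < d.*2) riesz_weight R d j * riesz_sign R d j *
      meval (fun i => x (rot (j.*2.+1 * Q) (z i))) f).
Proof.
move=> fd.
have h := trigpoly_meval (fun i => (z i).1.1) (fun i => (z i).1.2)
  (fun i => grid R N (z i).2) fd.
have := riesz_interpolation d0 0 h; rewrite -[LHS]opprK -sumrN => hr.
rewrite -[LHS]opprK -sumrN; congr (- _).
transitivity (d%:R * (\sum_(j < d.*2) riesz_weight R d j * riesz_sign R d j *
    meval (fun i => (z i).1.1 + (z i).1.2 *
      cos (0 + grid R d.*2 j + grid R N (z i).2)) f)).
  rewrite -(riesz_interpolation d0 0 h); apply: eq_bigr => i _.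
  rewrite add0r mulNr; congr (- (_ * _)); apply: meval_eq => j.
  by rewrite add0r.
congr (_ * _); apply: eq_bigr => j _; congr (_ * _); apply: meval_eq => i.
rewrite abscissa_rot; congr (_ + _ * cos _); rewrite add0r addrC; congr (_ + _).
have Q0 : Q%:R != 0 :> R.
  by rewrite pnatr_eq0; apply: contraPN NE => /eqP ->; rewrite muln0.
have dn0 : d%:R != 0 :> R by rewrite pnatr_eq0 -lt0n.
move: (nat_of_ord j) => {}j.
rewrite /grid NE -!muln2 !natrM -[(j * 2).+1%:R]natr1 natrM; field.
by rewrite dn0 Q0.
Qed.

(** Jensen's inequality for the convex combination in Riesz' formula; each rotated
    term has the same mean as [f(x)^(2k)] because the angles are uniform. *)
Lemma bernstein_step (f : mpoly n R) : degree_le d f ->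
  iterE l (fun z => (\sum_i y (z i) * meval (X z) (mderiv i f)) ^+ k.*2) <=
  d%:R ^+ k.*2 * iterE M (fun t => meval t f ^+ k.*2).
Proof.
move=> fd.
have sepf s : separable A (fun z : 'I_n -> Z =>
    meval (fun i => x (rot s (z i))) f ^+ k.*2).
  apply: separable_exp => //.
  apply: (@separable_meval_comp (fun z => x (rot s z))).
  exact/fibre_poly_rot/fibre_poly_abscissa.
have sepw : separable A (fun z : 'I_n -> Z =>
    \sum_(j < d.*2) riesz_weight R d j *
      meval (fun i => x (rot (j.*2.+1 * Q) (z i))) f ^+ k.*2).
  by apply: separable_sum => // j _; apply: separable_scale; exact: sepf.
have -> : iterE M (fun t => meval t f ^+ k.*2) =
    iterE l (fun z => meval (X z) f ^+ k.*2).
  symmetry.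
  rewrite -(@iterE_pullback R Z R A (polyclass Dtop) n l M (fun=> cst 1) x
    (fun t => meval t f ^+ k.*2)) //.
  - by congr iterE; apply/funext => z; rewrite big1 ?mul1r.
  - exact: linear_polyclass.
  - move=> i _ [p _ ->]; apply: mulA => //.
    exact/fibre_poly_horner/fibre_poly_abscissa.
  - by move=> i phi phiD; rewrite lM//; congr (l i _); apply/funext => z; rewrite mul1r.
  - rewrite (_ : (fun t => _) = (fun t => meval t (f ^+ k.*2))).
      by apply: separable_meval; exact: degree_leX.
    by apply/funext => t; rewrite rmorphXn.
apply: (@le_trans _ _ (iterE l (fun z => d%:R ^+ k.*2 *
    \sum_(j < d.*2) riesz_weight R d j *
      meval (fun i => x (rot (j.*2.+1 * Q) (z i))) f ^+ k.*2))).
  apply: (iterE_le lcA) => //.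
  - apply: separable_exp => //; apply: separable_sum => // i _.
    apply: (separable_mul mulA _ (sepX _)).
    by apply: separable_coord => //; exact: fibre_poly_ordinate.
  - exact: separable_scale.
  - move=> z; rewrite riesz_pointwise// -(mul2n k) exprM sqrrN -exprM mul2n.
    rewrite exprMn ler_wpM2l ?exprn_ge0//.
    apply: jensen_exp_even.
    + by move=> j; exact: riesz_weight_ge0.
    + exact: sum_riesz_weight.
    + by move=> j; exact: riesz_sign_sqr.
rewrite (iterEZ lcA)// ler_wpM2l ?exprn_ge0//.
rewrite (iterE_sum lcA)//; last first.
  by move=> j _; apply: separable_scale; exact: sepf.
rewrite -[leRHS]mul1r -(sum_riesz_weight R d0) mulr_suml.
apply: ler_sum => j _; rewrite (iterEZ lcA _ linl (sepf _)).
rewrite -(@iterE_invariant R Z n l (fun=> @rot R N' (j.*2.+1 * Q))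
  (fun z => meval (X z) f ^+ k.*2))// => i phi.
exact: circle_mean_rot.
Qed.

(** With [s = sum_i y_i^2 g_i^2] and [t = (sum_i y_i g_i)^2], the tangent inequality
    gives [s^k + k s^(k-1) (t - s) <= t^k].  The difference [t - s] consists of
    cross terms [y_i y_j g_i g_j], which change sign under the reflection
    [y_i -> - y_i] while [s] and the [g_i] do not; so their mean is [0]. *)
Lemma symmetrization_step (f : mpoly n R) :
  iterE l (fun z => (\sum_i y (z i) ^+ 2 *
    meval (X z) (mderiv i f) ^+ 2) ^+ k) <=
  iterE l (fun z => (\sum_i y (z i) * meval (X z) (mderiv i f)) ^+ k.*2).
Proof.
pose g i z := meval (X z) (mderiv i f).
have sg i : separable A (g i) by exact: sepX.
have sy i : separable A (fun z : 'I_n -> Z => y (z i)).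
  by apply: separable_coord => //; exact: fibre_poly_ordinate.
pose s z := \sum_i y (z i) ^+ 2 * g i z ^+ 2.
have ss : separable A s.
  by apply: separable_sum => // i _; apply: separable_mul => //; exact: separable_exp.
pose cross z := \sum_i \sum_(j | j != i)
  k%:R * s z ^+ k.-1 * (y (z i) * y (z j) * g i z * g j z).
have scr i j : separable A (fun z => k%:R * s z ^+ k.-1 *
    (y (z i) * y (z j) * g i z * g j z)).
  apply: separable_mul => //.
    by apply: separable_scale; exact: separable_exp.
  by do 3 (apply: separable_mul => //).
have scr' i : separable A (fun z => \sum_(j | j != i)
  k%:R * s z ^+ k.-1 * (y (z i) * y (z j) * g i z * g j z)).
  by apply: separable_sum.
have scross : separable A cross by exact: separable_sum.
have cross0 : iterE l cross = 0.
  rewrite (iterE_sum lcA)// big1// => i _.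
  rewrite (iterE_sum lcA)// big1// => j ji.
  set F := (X in iterE _ X).
  suff : iterE l F = - iterE l F by lra.
  rewrite -mulN1r -(iterEZ lcA)//; last exact: scr.
  rewrite -[LHS](@iterE_invariant R Z n l
    (fun m => if m == i then @flip R N' else id)); last first.
    by move=> m phi; case: ifP => // _; exact: circle_mean_flip.
  congr iterE; apply/funext => z; rewrite /F /=.
  set z' := (fun m => _).
  have Xz' : X z' = X z.
    by apply/funext => m; rewrite /X /z'; case: ifP => // _; rewrite abscissa_flip.
  have yz' m : y (z' m) = if m == i then - y (z m) else y (z m).
    by rewrite /z'; case: ifP => // _; rewrite ordinate_flip.
  have -> : s z' = s z.
    rewrite /s /g Xz'; apply: eq_bigr => m _.
    by rewrite yz'; case: ifP => // _; rewrite sqrrN.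
  by rewrite !yz' eqxx (negPf ji) /g Xz'; ring.
rewrite -[leLHS]/(iterE l (fun z => s z ^+ k)).
rewrite -[leLHS]addr0 -[X in _ + X <= _]cross0 -(iterED lcA _ (separable_exp k mulA A1 ss))//.
apply: (iterE_le lcA) => //.
- by apply: separable_add => //; exact: (separable_exp k mulA A1 ss).
- apply: (separable_exp k.*2 mulA A1 (F := fun z => \sum_i y (z i) * g i z)).
  apply: (@separable_sum _ _ _ _ _ _ xpredT (fun i z => y (z i) * g i z)) => // i _.
  exact: (separable_mul mulA (sy i) (sg i)).
- move=> z.
  have s0 : 0 <= s z by rewrite sumr_ge0// => i _; rewrite mulr_ge0 ?sqr_ge0.
  have := tangent_exp k (sqr_ge0 (\sum_i y (z i) * g i z)) s0.
  rewrite -exprM mul2n; apply: le_trans; rewrite lerD2l.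
  have -> : cross z = k%:R * s z ^+ k.-1 * \sum_i \sum_(j | j != i)
      (y (z i) * y (z j) * g i z * g j z).
    by rewrite mulr_sumr; apply: eq_bigr => i _; rewrite mulr_sumr.
  rewrite le_eqVlt; apply/orP; left; apply/eqP; congr (_ * _).
  rewrite expr2 big_distrlr/= -sumrB; apply: eq_bigr => i _.
  rewrite [in RHS](bigD1 i)//= addrAC -{1}expr2 exprMn subrr add0r.
  by apply: eq_bigr => j _; ring.
Qed.

(** The power [k] expands as a sum over maps [I : 'I_k -> 'I_n] of the square of
    [prod_j D_(I j) f] times [prod_i y_i^(2 a_i)], where [a_i] is the number of
    preimages of [i].  The first factor is a nonnegative polynomial and the
    weight is a product over the coordinates, so that the one-dimensional
    comparison applies in each of them; the exponents [a_i] add up to [k]. *)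
Lemma weight_step (f : mpoly n R) : degree_le d f ->
  K ^+ k * iterE E (fun t => (\sum_i meval t (mderiv i f) ^+ 2) ^+ k) <=
  iterE l (fun z => (\sum_i y (z i) ^+ 2 *
    meval (X z) (mderiv i f) ^+ 2) ^+ k).
Proof.
move=> fd.
pose al (I : {ffun 'I_k -> 'I_n}) i := #|[pred j | I j == i]|.
pose h (I : {ffun 'I_k -> 'I_n}) : mpoly n R := (\prod_j mderiv (I j) f) ^+ 2.
have expand (a : 'I_n -> R) : (\sum_i a i) ^+ k =
    \sum_(I : {ffun 'I_k -> 'I_n}) \prod_j a (I j).
  by rewrite -[in LHS](card_ord k) -prodr_const bigA_distr_bigA.
have regroup (b : 'I_n -> R) (I : {ffun 'I_k -> 'I_n}) :
    \prod_j b (I j) = \prod_i b i ^+ al I i.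
  rewrite (partition_big I xpredT)//=; apply: eq_bigr => i _.
  by rewrite -prodr_const; apply: eq_big => // j /eqP ->.
have hd I : degree_le Dgrad (h I).
  rewrite /Dgrad -mul2n; apply: degree_leX; rewrite -[k in (k * _)%N]card_ord.
  by apply: degree_le_prod => j; exact: degree_le_deriv.
have hE t I : meval t (h I) = \prod_j meval t (mderiv (I j) f) ^+ 2.
  by rewrite rmorphXn/= rmorph_prod prodrXl.
have h0 t I : 0 <= meval t (h I) by rewrite rmorphXn sqr_ge0.
have -> : (fun t => (\sum_i meval t (mderiv i f) ^+ 2) ^+ k) =
    (fun t => \sum_I meval t (h I)).
  by apply/funext => t; rewrite expand; apply: eq_bigr => I _; rewrite hE.
have -> : (fun z : 'I_n -> Z =>
      (\sum_i y (z i) ^+ 2 * meval (X z) (mderiv i f) ^+ 2) ^+ k) =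
    (fun z => \sum_I (\prod_i y (z i) ^+ (al I i).*2) * meval (X z) (h I)).
  apply/funext => z; rewrite expand; apply: eq_bigr => I _.
  rewrite big_split/= -hE; congr (_ * _).
  rewrite (regroup (fun i => y (z i) ^+ 2)); apply: eq_bigr => i _.
  by rewrite -exprM mul2n.
have yA a : A (fun z => y z ^+ a).
  by apply: fibre_polyX; exact: fibre_poly_ordinate.
rewrite (iterE_sum (linear_polyclass R Dgrad))//; last 3 first.
- exact: polyclass_cst.
- exact: polyclass_cst.
- by move=> I _; exact: separable_meval.
rewrite (iterE_sum lcA)//; last first.
  move=> I _; apply: (separable_mul mulA _ (sepX _)).
  rewrite (_ : (fun z => _) =
      (fun z => 1 * \prod_i (fun i z => y z ^+ (al I i).*2) i (z i))).
    by apply: (@separable_prod R Z A n 1 (fun i z => y z ^+ (al I i).*2)) => i.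
  by apply/funext => z; rewrite mul1r.
rewrite mulr_sumr; apply: ler_sum => I _.
pose L i phi := l i (fun z => y z ^+ (al I i).*2 * phi (x z)).
have LA i phi : polyclass Dgrad phi ->
    A (fun z => y z ^+ (al I i).*2 * phi (x z)).
  move=> [p _ ->]; apply: mulA => //.
  exact/fibre_poly_horner/fibre_poly_abscissa.
rewrite (@iterE_pullback R Z R A (polyclass Dgrad) n l L
  (fun i z => y z ^+ (al I i).*2) x (fun t => meval t (h I)))//; last 2 first.
- exact: linear_polyclass.
- exact: separable_meval.
have <- : \prod_i K ^+ al I i = K ^+ k.
  by rewrite -(regroup (fun=> K)) prodr_const card_ord.
apply: (iterE_compare (linear_polyclass R Dgrad)) => //.
- move=> i; split=> [phi psi pphi ppsi|a phi pphi]; rewrite /L.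
    rewrite -(loD (linl i)); try exact: LA.
    by congr (l i _); apply/funext => z; rewrite mulrDr.
  rewrite -(loZ (linl i)); last exact: LA.
  by congr (l i _); apply/funext => z; rewrite mulrCA.
- by move=> i; rewrite exprn_ge0.
- move=> i phi pphi phi0; apply: lE => //.
  by rewrite /al (leq_trans (max_card _))// card_ord.
- exact: separable_meval.
Qed.

(** The exact degree bounds for [M] and [E] matter: the number of nodes of a
    grid that integrates these polynomials determines the constant. *)
Theorem product_inequality (f : mpoly n R) : degree_le d f ->
  K ^+ k * iterE E (fun t => (\sum_i meval t (mderiv i f) ^+ 2) ^+ k) <=
  d%:R ^+ k.*2 * iterE M (fun t => meval t f ^+ k.*2).
Proof.
move=> fd; apply: le_trans (weight_step fd) _.
exact: le_trans (symmetrization_step f) (bernstein_step fd).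
Qed.

End ProductInequality.

(** * Polynomial moments of product probabilities *)

Section Moments.
Variable R : realType.
Implicit Type mu : {measure set R -> \bar R}.

Definition finite_moments mu : Prop :=
  forall a : nat, mu.-integrable [set: R] (EFin \o (fun x : R => x ^+ a)).

Lemma measurable_horner (p : {poly R}) : measurable_fun [set: R] (horner p).
Proof.
rewrite (_ : horner p = (fun x => \sum_(i < size p) p`_i * x ^+ i)).
  by apply: measurable_sum => i; apply: measurable_funM => //; exact: measurable_funX.
by apply/funext => x; rewrite horner_coef.
Qed.

Lemma integrable_horner mu (p : {poly R}) : finite_moments mu ->
  mu.-integrable [set: R] (EFin \o horner p).
Proof.
move=> mom.
rewrite (_ : EFin \o horner p = (fun x => \sum_(i < size p) (p`_i * x ^+ i)%:E)%E).
  apply: integrable_sum => // i _.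
  by have := integrableZl measurableT p`_i (mom i).
by apply/funext => x; rewrite /= horner_coef sumEFin.
Qed.

Lemma linear_on_Rintegral mu D : finite_moments mu ->
  linear_on (@polyclass R D) (fun phi => \int[mu]_x phi x).
Proof.
move=> mom; split=> [f g [p _ ->] [q _ ->]|a f [p _ ->]].
  by rewrite RintegralD//; exact: integrable_horner.
by rewrite RintegralZl//; exact: integrable_horner.
Qed.

End Moments.

Section ProductIntegral.
Context d1 d2 (T1 : measurableType d1) (T2 : measurableType d2) (R : realType).
Variables (m1 : probability T1 R) (m2 : probability T2 R).
Variables (f1 : T1 -> R) (f2 : T2 -> R).
Hypothesis if1 : m1.-integrable [set: T1] (EFin \o f1).
Hypothesis if2 : m2.-integrable [set: T2] (EFin \o f2).

Let f (z : T1 * T2) : \bar R := (f1 z.1 * f2 z.2)%:E.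

Let mf1 : measurable_fun [set: T1] f1.
Proof. exact/measurable_EFinP/measurable_int/if1. Qed.

Let mf2 : measurable_fun [set: T2] f2.
Proof. exact/measurable_EFinP/measurable_int/if2. Qed.

Let mf : measurable_fun [set: T1 * T2] f.
Proof.
apply/measurable_EFinP; apply: measurable_funM.
  by apply: (measurableT_comp (f := f1)).
by apply: (measurableT_comp (f := f2)).
Qed.

Lemma integrable_tensor : (m1 \x m2)%E.-integrable [set: T1 * T2] f.
Proof.
apply/(integrable12ltyP m1 m2 mf) => /=.
have [_ fin1] := integrableP _ _ _ if1; have [_ fin2] := integrableP _ _ _ if2.
under eq_integral => x _.
  under eq_integral => y _ do rewrite normrM EFinM.
  rewrite ge0_integralZl//; last first.
    by apply/measurable_EFinP; exact: measurableT_comp.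
  over.
rewrite ge0_integralZr//=.
- apply: lte_mul_pinfty => //; first exact: integral_ge0.
  by rewrite ge0_fin_numE ?integral_ge0.
- by apply/measurable_EFinP; exact: measurableT_comp.
- exact: integral_ge0.
Qed.

Lemma integral_tensor : (\int[m1 \x m2]_z f z =
  (\int[m1]_x (f1 x)%:E) * (\int[m2]_y (f2 y)%:E))%E.
Proof.
rewrite -(integral12_prod_meas1 integrable_tensor) /fubini_F /f /=.
under eq_integral => x _.
  under eq_integral => y _ do rewrite EFinM.
  rewrite integralZl//; over.
have [r rE] : exists r, (\int[m2]_y (f2 y)%:E = r%:E)%E.
  exists (fine (\int[m2]_y (f2 y)%:E)); rewrite fineK//.
  exact: integrable_fin_num.
by rewrite rE integralZr.
Qed.

End ProductIntegral.

Section ProbabilityProduct.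
Variable R : realType.

(** Fubini's theorem for a product of two functions of separate variables, one
    coordinate at a time. *)
Lemma integral_prod_monomial n (mu : 'I_n -> probability R R) (a : 'I_n -> nat) :
  (forall i, finite_moments (mu i)) ->
  (prod_probability mu).-integrable [set: n.-tuple R]
    (fun x => (\prod_i tnth x i ^+ a i)%:E) /\
  (\int[prod_probability mu]_x (\prod_i tnth x i ^+ a i)%:E =
   (\prod_i \int[mu i]_t t ^+ a i)%:E)%E.
Proof.
elim: n mu a => [|n IHn] mu a mom.
  rewrite (_ : (fun x : 0.-tuple R => _) = cst 1%E); last first.
    by apply/funext => x; rewrite big_ord0.
  split; first exact: finite_measure_integrable_cst.
  by rewrite integral_cst// mul1e big_ord0; exact: probability_setT.
have [IHi IHE] := IHn _ (fun i => a (lift ord0 i)) (fun i => mom (lift ord0 i)).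
set f := fun x => _.
pose g (y : n.-tuple R) := \prod_i tnth y i ^+ a (lift ord0 i).
have fE : f \o @tcons _ R n = (fun z => (z.1 ^+ a ord0 * g z.2)%:E).
  apply/funext => z; rewrite /f/= big_ord_recl; congr ((_ * _)%:E).
  by apply: eq_bigr => i _; rewrite /tcons tnthS.
have mf : measurable_fun [set: n.+1.-tuple R] f.
  apply/measurable_EFinP.
  apply: (@measurable_prod _ _ _ _ _ (index_enum 'I_n.+1)
    (fun i (x : n.+1.-tuple R) => tnth x i ^+ a i)) => i _.
  apply: (measurable_funX (f := fun x : n.+1.-tuple R => tnth x i)).
  exact: measurable_tnth.
have ifc : (mu ord0 \x prod_probability (fun i => mu (lift ord0 i)))%E.-integrable
    [set: R * n.-tuple R] (f \o @tcons _ R n).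
  by rewrite fE; exact: (integrable_tensor (mom ord0 (a ord0)) (f2 := g) IHi).
have mt := @measurable_tcons _ R n.
split.
  by apply: (integrable_pushforward mt mf).
rewrite /= /distribution (integral_pushforward mt mf)// preimage_setT fE.
rewrite (integral_tensor (mom ord0 (a ord0)) (f2 := g) IHi).
rewrite IHE big_ord_recl EFinM; congr (_ * _)%E.
by rewrite fineK//; apply: integrable_fin_num => //; exact: (mom ord0).
Qed.

(** Only the moments of the [M i] enter, and only finitely many of them. *)
Lemma iterE_meval n D (M : 'I_n -> (R -> R) -> R) (h : mpoly n R) :
  (forall i, linear_on (@polyclass R D) (M i)) -> degree_le D h ->
  iterE M (fun t => meval t h) =
  \sum_(m <- msupp h) mcoeff m h * \prod_i M i (fun x => x ^+ m i).
Proof.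
move=> linM /degree_leP hD.
have lc := linear_polyclass R D.
rewrite (_ : (fun t => meval t h) = (fun t => \sum_(m <- msupp h)
   if m \in msupp h then mcoeff m h * \prod_i (t i) ^+ m i else 0)); last first.
  apply/funext => x; rewrite mevalE big_seq [RHS]big_seq.
  by apply: eq_bigr => m ->.
have pm (m : multinom n) : m \in msupp h ->
    forall i, polyclass D (fun x : R => x ^+ m i).
  move=> mh i; apply: polyclass_exp.
  by rewrite (leq_trans (mnm_le_mdeg _ _))// hD.
rewrite (iterE_sum lc)//; last 3 first.
- exact: polyclass_cst.
- exact: polyclass_cst.
- move=> m _; case mh : (m \in msupp h); last first.
    by apply: separable_const; exact: polyclass_cst.
  by apply: (@separable_prod _ _ _ _ _ (fun i x => x ^+ m i)); exact: pm.
rewrite big_seq [RHS]big_seq; apply: eq_bigr => m mh; rewrite mh.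
exact: (iterE_prod lc _ linM (pm m mh)).
Qed.

Lemma integral_prod_peval n (mu : 'I_n -> probability R R) (h : mpoly n R) :
  (forall i, finite_moments (mu i)) ->
  (\int[prod_probability mu]_x (peval h x)%:E =
   (iterE (fun i phi => \int[mu i]_t phi t) (fun t => meval t h))%:E)%E.
Proof.
move=> mom.
have hD : degree_le (mpoly.msize h) h by exact: leqnSn.
rewrite (@iterE_meval _ (mpoly.msize h))//; last first.
  by move=> i; exact: linear_on_Rintegral.
under eq_integral => x _ do rewrite /peval mevalE -sumEFin.
have int m := integral_prod_monomial (fun i => (m : multinom n) i) mom.
rewrite integral_sum//=; last first.
  by move=> m; have [h1 _] := int m; have := integrableZl measurableT (mcoeff m h) h1.
rewrite -sumEFin; apply: eq_bigr => m _.
under eq_integral => x _ do rewrite EFinM.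
by have [h1 h2] := int m; rewrite integralZl// h2 EFinM.
Qed.

End ProbabilityProduct.

(** * Densities of log-concave probabilities *)

Section LogConcaveDensity.
Variable R : realType.
Local Notation leb := (@lebesgue_measure R).

(** Logarithmic concavity is expressed on the support, where [ln] is meaningful;
    the first conclusion says that the support is convex. *)
Record lc_density (P : probability R R) (rho : R -> R) : Prop := LcDensity {
  lcd_ge0 : forall x, 0 <= rho x;
  lcd_concave : forall x y t, 0 <= t <= 1 -> 0 < rho x -> 0 < rho y ->
    0 < rho (t * x + (1 - t) * y) /\
    t * ln (rho x) + (1 - t) * ln (rho y) <= ln (rho (t * x + (1 - t) * y));
  lcd_measurable : measurable_fun [set: R] rho;
  lcd_density : forall A : set R, measurable A ->
    P A = (\int[leb]_(x in A) (rho x)%:E)%E }.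

Lemma measurable_is_interval_levels (rho : R -> R) :
  (forall t, is_interval [set x | t < rho x]) -> measurable_fun [set: R] rho.
Proof.
move=> itv; apply: (measurability (@RGenOInfty.G R)) => [|/= _ [_] [r] -> <-].
  exact: RGenOInfty.measurableE.
rewrite setTI; apply: is_interval_measurable => s t/=.
rewrite !in_itv/= !andbT => rs rt u sut.
by rewrite in_itv/= andbT; exact: (itv r s t).
Qed.

Lemma convex_combination_between (x y z : R) : x <= z <= y -> x < y ->
  exists2 t, 0 <= t <= 1 & z = t * x + (1 - t) * y.
Proof.
move=> /andP[xz zy] xy; have yx0 : 0 < y - x by rewrite subr_gt0.
exists ((y - z) / (y - x)).
  by rewrite divr_ge0 ?subr_ge0 ?(ltW xy)//= ler_pdivrMr// mul1r lerD2l lerN2.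
by field; rewrite gt_eqF.
Qed.

(** On a chord the logarithm of the density is at least a convex combination of
    its end values, hence at least the smaller one. *)
Lemma log_concave_levels (rho : R -> R) :
  (forall x, 0 <= rho x) ->
  (forall x y t, 0 <= t <= 1 -> 0 < rho x -> 0 < rho y ->
    0 < rho (t * x + (1 - t) * y) /\
    t * ln (rho x) + (1 - t) * ln (rho y) <= ln (rho (t * x + (1 - t) * y))) ->
  forall t, is_interval [set x | t < rho x].
Proof.
move=> rho0 lc t x y /= tx ty z xzy.
have [t0|t0] := ltP t 0; first exact: lt_le_trans (rho0 z).
have rx := le_lt_trans t0 tx; have ry := le_lt_trans t0 ty.
have [xy|yx] := ltP x y; last first.
  have /andP[xz zy] := xzy.
  by have -> : z = x by apply/le_anti; rewrite xz (le_trans zy).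
have [s /andP[s0 s1] zE] := convex_combination_between xzy xy.
have [rz] := lc x y s (introT andP (conj s0 s1)) rx ry; rewrite -zE in rz *.
move=> h; rewrite ltNge; apply/negP => rzt.
have s1' : 0 <= 1 - s by rewrite subr_ge0.
have lt_ln u : t < rho u -> ln (rho z) < ln (rho u).
  by move=> tu; rewrite ltr_ln ?posrE//; [exact: le_lt_trans tu|exact: le_lt_trans tu].
have hx := lt_ln x tx; have hy := lt_ln y ty.
have : s * (ln (rho x) - ln (rho z)) + (1 - s) * (ln (rho y) - ln (rho z)) <= 0.
  by lra.
have [s00|s00] := eqVneq s 0; first by rewrite s00; lra.
have : 0 < s * (ln (rho x) - ln (rho z)).
  by rewrite mulr_gt0 ?subr_gt0// lt_neqAle eq_sym s00.
have : 0 <= (1 - s) * (ln (rho y) - ln (rho z)).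
  by rewrite mulr_ge0// subr_ge0 ltW.
lra.
Qed.

Lemma log_concave_density (P : probability R R) : log_concave P ->
  exists rho, lc_density P rho.
Proof.
move=> [V [Vny Vcvx] PV].
pose rho x := fine (expeR (- V x)%E).
have rhoE x : (expeR (- V x) = (rho x)%:E)%E.
  rewrite /rho fineK//; have := Vny x; case: (V x) => //=.
have rho0 x : 0 <= rho x by rewrite fine_ge0// expeR_ge0.
have Vr x : 0 < rho x -> V x = (- ln (rho x))%:E.
  rewrite /rho; have := Vny x; case: (V x) => //= [r _ _|]; last by rewrite ltxx.
  by rewrite expRK opprK.
have rhoV x r : V x = r%:E -> rho x = expR (- r).
  by rewrite /rho => ->.
have lc x y t : 0 <= t <= 1 -> 0 < rho x -> 0 < rho y ->
    0 < rho (t * x + (1 - t) * y) /\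
    t * ln (rho x) + (1 - t) * ln (rho y) <= ln (rho (t * x + (1 - t) * y)).
  move=> t01 /Vr Vx /Vr Vy; have := Vcvx x y t t01; rewrite Vx Vy.
  have := Vny (t * x + (1 - t) * y).
  case E : (V (t * x + (1 - t) * y)) => [r| |]//= _.
  rewrite -!EFinM -EFinD lee_fin (rhoV _ _ E) expRK => h.
  by rewrite expR_gt0; split => //; lra.
exists rho; split => //.
  by apply: measurable_is_interval_levels; exact: log_concave_levels.
by move=> A mA; rewrite PV//; apply: eq_integral => x _; rewrite rhoE.
Qed.

Section DensityIntegral.
Variables (P : probability R R) (rho : R -> R).
Hypothesis Prho : lc_density P rho.

(* The Lebesgue measure lives on [measurableTypeR R]; [P] has to be transported
   there along the identity to be compared with it. *)
Let idR : R -> measurableTypeR R := idfun.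

Let measurable_idR : measurable_fun [set: R] idR.
Proof. by move=> _ A mA; rewrite setTI. Qed.

HB.instance Definition _ :=
  isMeasurableFun.Build _ _ _ _ idR measurable_idR.

(** The identity is known for indicators of measurable sets by hypothesis; it
    extends to nonnegative functions since the density agrees almost
    everywhere with the Radon-Nikodym derivative. *)
Lemma integral_density (f : R -> \bar R) : measurable_fun [set: R] f ->
  (forall x, 0 <= f x)%E ->
  (\int[P]_x f x = \int[leb]_x (f x * (rho x)%:E))%E.
Proof.
move=> mf f0; pose Q := distribution P idR.
have mrho : measurable_fun [set: measurableTypeR R] (EFin \o rho).
  by apply/measurable_EFinP; exact: (lcd_measurable Prho).
have dom : Q `<< leb.
  apply/null_content_dominatesP => A mA A0.
  rewrite /Q /distribution /pushforward (lcd_density Prho)//.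
  by apply: null_set_integral => //; apply: measurable_funTS; exact: mrho.
have gint := Radon_Nikodym_SigmaFinite.f_integrable dom.
transitivity (\int[Q]_x f x)%E.
  rewrite /Q /distribution ge0_integral_pushforward//.
rewrite -(Radon_Nikodym_SigmaFinite.change_of_variables dom f0)//.
apply: ae_eq_integral => //.
- by apply: emeasurable_funM => //; exact: measurable_int gint.
- exact: emeasurable_funM.
apply: ae_eqe_mul2l; apply: integral_ae_eq => //.
move=> E _ mE; rewrite -Radon_Nikodym_SigmaFinite.f_integral//.
exact: (lcd_density Prho).
Qed.

End DensityIntegral.

End LogConcaveDensity.

(** * Exponential tails of log-concave densities *)

Section HalfLines.
Variable R : realType.
Local Notation leb := (@lebesgue_measure R).
Implicit Types p q L : R.

Lemma is_derive_exp_decay p L (x : R) : L != 0 ->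
  is_derive x 1 (fun x : R => - L * expR (- ((x - p) / L)))
    (expR (- ((x - p) / L))).
Proof.
move=> L0.
have d1 : is_derive x 1 (fun x : R => - ((x - p) / L)) (- L^-1).
  have d0 : is_derive x 1 (fun x : R => L^-1 *: (x - p)) (L^-1 *: (1 - 0)).
    by apply: is_deriveZ.
  have := is_deriveN d0; rewrite subr0.
  have -> : - (L^-1 *: (1 : R)) = - L^-1 by rewrite /GRing.scale/= mulr1.
  congr is_derive; apply/funext => y /=.
  by rewrite /GRing.opp/= /GRing.scale/= mulrC.
have d2 := @is_derive1_comp R expR (fun x : R => - ((x - p) / L)) x _ _
  (is_derive_expR _) d1.
have := is_deriveZ (- L) d2; set e := expR _.
by have -> : - L *: (e * - L^-1) = e by rewrite /GRing.scale/=; field.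
Qed.

Lemma continuous_exp_decay p L : continuous (fun x : R => expR (- ((x - p) / L))).
Proof.
move=> x; apply: (continuous_comp (f := fun x => - ((x - p) / L))); last first.
  exact: continuous_expR.
apply: continuousN; apply: continuousM; last exact: cst_continuous.
by apply: continuousB; [exact: id|exact: cst_continuous].
Qed.

Lemma integral_exp_right p L : 0 < L ->
  (\int[leb]_(x in `[p, +oo[) (expR (- ((x - p) / L)))%:E = L%:E)%E.
Proof.
move=> L0; have Ln0 : L != 0 by rewrite gt_eqF.
pose F : R -> R := fun x => - L * expR (- ((x - p) / L)).
have dF (x : R) : is_derive x 1 F (expR (- ((x - p) / L))).
  exact: is_derive_exp_decay.
rewrite (@ge0_continuous_FTC2y _ _ F p 0).
- by rewrite /F subrr mul0r oppr0 expR0 mulr1 EFinN oppeK add0e.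
- by move=> x _; exact: expR_ge0.
- by apply: continuous_subspaceT => x; exact: continuous_exp_decay.
- rewrite -(mulr0 (- L)); apply: cvgMr.
  apply: (cvg_comp (fun x => (x - p) / L) (fun y => expR (- y))); last exact: cvgr_expR.
  apply: gt0_cvgMly; first by rewrite invr_gt0.
  exact: cvg_addrr.
- by move=> x _; have [] := dF x.
- apply: cvg_at_right_filter; apply: differentiable_continuous.
  by apply/derivable1_diffP; have [] := dF p.
- by move=> x _; rewrite derive1E; have [_ ->] := dF x.
Qed.

Lemma integral_exp_left p L : 0 < L ->
  (\int[leb]_(x in `]-oo, p]) (expR ((x - p) / L))%:E = L%:E)%E.
Proof.
move=> L0; rewrite -(integral_exp_right (- p) L0).
have := @ge0_integration_by_substitutionNy R (fun x => expR ((x - p) / L)) (- p).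
rewrite opprK => ->.
- apply: eq_integral => x _ /=; congr (expR _)%:E.
  by field; rewrite gt_eqF.
- apply: continuous_subspaceT => x.
  rewrite (_ : (fun x => _) = (fun x => expR (- ((x - p) / - L)))).
    exact: continuous_exp_decay.
  by apply/funext => y; rewrite invrN mulrN opprK.
- by move=> x _; exact: expR_ge0.
Qed.

(** For [s = 1] the half-line to the right of [p], for [s = -1] the one to the
    left; the parameter [s] treats both tails at once. *)
Definition half_line (s p : R) : set R := [set x | 0 <= s * (x - p)].

Lemma half_line_right p : half_line 1 p = `[p, +oo[%classic.
Proof.
by apply/seteqP; split => x; rewrite /half_line/= mul1r subr_ge0 in_itv/= andbT.
Qed.

Lemma half_line_left p : half_line (-1) p = `]-oo, p]%classic.
Proof.
apply/seteqP; split => x; rewrite /half_line/= in_itv/=;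
  by rewrite mulN1r opprB subr_ge0.
Qed.

Lemma measurable_half_line s p : s = 1 \/ s = -1 -> measurable (half_line s p).
Proof. by case=> ->; rewrite ?half_line_right ?half_line_left. Qed.

Lemma integral_exp_half_line s p L : s = 1 \/ s = -1 -> 0 < L ->
  (\int[leb]_(x in half_line s p) (expR (- (s * (x - p) / L)))%:E = L%:E)%E.
Proof.
move=> [] -> L0.
  rewrite half_line_right -(integral_exp_right p L0).
  by apply: eq_integral => x _; rewrite mul1r.
rewrite half_line_left -(integral_exp_left p L0).
by apply: eq_integral => x _; rewrite mulN1r mulNr opprK.
Qed.

(** The bound is the integral over a half-line of an exponential with decay
    length [L] at its end point. *)
Lemma integral_half_line_le s p L c (f : R -> R) : s = 1 \/ s = -1 -> 0 < L ->
  0 <= c -> measurable_fun [set: R] f -> (forall x, 0 <= f x) ->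
  (forall x, half_line s p x -> f x <= c * expR (- (s * (x - p) / L))) ->
  (\int[leb]_(x in half_line s p) (f x)%:E <= (c * L)%:E)%E.
Proof.
move=> s1 L0 c0 mf f0 fle; have mH := measurable_half_line p s1.
have mexp : measurable_fun [set: R] (fun x : R => expR (- (s * (x - p) / L))).
  rewrite (_ : (fun x => _) = (fun x => expR (- ((x - p) / (s * L))))).
    by apply: continuous_measurable_fun => x; exact: continuous_exp_decay.
  apply/funext => x; congr expR; case: s1 => ->; field; lra.
rewrite EFinM -(integral_exp_half_line p s1 L0) -ge0_integralZl_EFin//; last first.
  by apply/measurable_EFinP; exact: measurable_funTS.
apply: ge0_le_integral => //.
- by move=> x _; rewrite lee_fin.
- by apply/measurable_EFinP; exact: measurable_funTS.
- by apply/measurable_EFinP; apply: measurable_funM => //; exact: measurable_funTS.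
Qed.

Lemma integral_three_pieces p q (f : R -> R) : p < q ->
  measurable_fun [set: R] f -> (forall x, 0 <= f x) ->
  (\int[leb]_x (f x)%:E = \int[leb]_(x in half_line (-1) p) (f x)%:E +
    (\int[leb]_(x in `]p, q[) (f x)%:E + \int[leb]_(x in half_line 1 q) (f x)%:E))%E.
Proof.
move=> pq mf f0; rewrite half_line_right half_line_left.
have mfS D : measurable D -> measurable_fun D (EFin \o f).
  by move=> mD; apply/measurable_EFinP; exact: measurable_funTS.
have f0' x : (0 <= (f x)%:E)%E by rewrite lee_fin.
rewrite -[X in (_ + X)%E]ge0_integral_setU//; last 2 first.
- by apply: mfS; exact: measurableU.
- apply/disj_setPS => x /= []; rewrite !in_itv/= andbT => /andP[_ xq] qx.
  by move: (lt_le_trans xq qx); rewrite ltxx.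
rewrite -ge0_integral_setU//.
- congr (integral _ _ _); apply/seteqP; split => // x _ /=.
  rewrite !in_itv/= andbT; have [xp|px] := leP x p; first by left.
  by right; have [qx|xq] := leP q x; [right|left].
- exact: measurableU.
- by apply: mfS; apply: measurableU => //; exact: measurableU.
- apply/disj_setPS => x /= []; rewrite !in_itv/= andbT => xp [/andP[px _]|qx].
    by move: (le_lt_trans xp px); rewrite ltxx.
  by move: (le_lt_trans xp (lt_le_trans pq qx)); rewrite ltxx.
Qed.

End HalfLines.

Section LogConcaveTails.
Variable R : realType.
Local Notation leb := (@lebesgue_measure R).
Variables (P : probability R R) (rho : R -> R).
Hypothesis Prho : lc_density P rho.

Let rho0 := lcd_ge0 Prho.
Let mrho := lcd_measurable Prho.
Let dens := lcd_density Prho.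

Lemma rho_between (t x y z : R) : t <= rho x -> t <= rho y -> x <= z <= y -> t <= rho z.
Proof.
move=> tx ty xzy; rewrite leNgt; apply/negP => zt.
have := log_concave_levels rho0 (lcd_concave Prho) (t := rho z).
move=> /(_ x y); rewrite /= => /(_ (lt_le_trans zt tx) (lt_le_trans zt ty) z xzy).
by rewrite ltxx.
Qed.

Lemma mass_ge (t a b : R) : a < b -> 0 <= t ->
  (forall x, a < x < b -> t <= rho x) -> ((t * (b - a))%:E <= P `]a, b[%classic)%E.
Proof.
move=> ab t0 h; rewrite dens//.
have <- : (\int[leb]_(x in `]a, b[) cst t%:E x = (t * (b - a))%:E)%E.
  rewrite integral_cst//= lebesgue_measure_itv/= lte_fin ab.
  by rewrite -EFinD -EFinM.
apply: ge0_le_integral => //.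
by apply/measurable_EFinP; exact: measurable_funTS.
Qed.

(** The density is at least [t] between [a] and [b], and its integral is [1]. *)
Lemma level_length (t a b : R) : a < b -> 0 <= t -> t <= rho a -> t <= rho b ->
  t * (b - a) <= 1.
Proof.
move=> ab t0 ta tb; rewrite -lee_fin.
apply: le_trans (probability_le1 P (measurable_itv `]a, b[%R)).
apply: mass_ge => // x /andP[ax xb].
by apply: (rho_between ta tb); rewrite !ltW.
Qed.

Lemma exists_rho_gt0 : exists x, 0 < rho x.
Proof.
apply/not_existsP => h.
have := probability_setT P; rewrite dens// integral0_eq.
  by move=> /eqP; rewrite eq_sym onee_eq0.
move=> x _; congr EFin; apply/le_anti; rewrite rho0 andbT leNgt.
by apply/negP; exact: h.
Qed.

(** Concavity of [ln rho] between [x0] and [x0 + s u]: its slope beyond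
    [x0 + s L] is at most its mean slope up to there, which is at most
    [- 2 / L]. *)
Lemma rho_tail (s x0 L u : R) : s = 1 \/ s = -1 -> 0 < L -> 0 < rho x0 ->
  rho (x0 + s * L) <= expR (- 2) * rho x0 -> L <= u ->
  rho (x0 + s * u) <= rho (x0 + s * L) * expR (- (2 * (u - L) / L)).
Proof.
move=> s1 L0 r0 rL Lu; have u0 := lt_le_trans L0 Lu.
have [ru|ru] := ltP 0 (rho (x0 + s * u)); last first.
  by rewrite (le_trans ru)// mulr_ge0// expR_ge0.
have t01 : 0 <= L / u <= 1.
  by rewrite divr_ge0 ?(ltW L0) ?(ltW u0)//= ler_pdivrMr// mul1r.
have [] := lcd_concave Prho t01 ru r0.
have -> : L / u * (x0 + s * u) + (1 - L / u) * x0 = x0 + s * L.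
  by field; rewrite gt_eqF.
move=> rL0 h.
have lnL : ln (rho (x0 + s * L)) <= ln (rho x0) - 2.
  have -> : ln (rho x0) - 2 = ln (expR (- 2) * rho x0).
    by rewrite lnM ?posrE ?expR_gt0// expRK addrC.
  by rewrite ler_ln ?posrE ?mulr_gt0 ?expR_gt0.
rewrite -[leLHS]lnK ?posrE// -[X in _ <= X * _]lnK ?posrE// -expRD ler_expR.
set a := ln (rho (x0 + s * u)) in h *; set b := ln (rho (x0 + s * L)) in h lnL *.
set c := ln (rho x0) in h lnL.
have /andP[_ t1] := t01.
have h2 : L / u * a <= L / u * b - 2 * (1 - L / u).
  have : (1 - L / u) * (b + 2 - c) <= 0.
    by rewrite mulr_ge0_le0 ?subr_ge0//; lra.
  by lra.
have h3 : u / L * (L / u * a) <= u / L * (L / u * b - 2 * (1 - L / u)).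
  by rewrite ler_wpM2l// divr_ge0 ?(ltW u0) ?(ltW L0).
have Ln0 : L != 0 by rewrite gt_eqF.
have un0 : u != 0 by rewrite gt_eqF.
have e1 : u / L * (L / u * a) = a by field; rewrite Ln0 un0.
rewrite e1 in h3; rewrite (le_trans h3)// le_eqVlt; apply/orP; left; apply/eqP.
by field; rewrite Ln0 un0.
Qed.

(** Otherwise the density would exceed [t] on an interval of length [2 / t]. *)
Lemma exists_drop (x0 : R) : 0 < rho x0 -> exists2 L, 0 < L &
  forall s, s = 1 \/ s = -1 -> rho (x0 + s * L) <= expR (- 2) * rho x0.
Proof.
move=> r0; pose t := expR (- 2) * rho x0.
have t0 : 0 < t by rewrite mulr_gt0 ?expR_gt0.
have tr : t <= rho x0.
  by rewrite ler_piMl ?ltW// -expR0 ler_expR; lra.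
exists (2 / t); first by rewrite divr_gt0.
have L0 : 0 < 2 / t by rewrite divr_gt0.
move=> s s1; rewrite -/t leNgt; apply/negP => ht.
have : t * (2 / t) <= 1.
  case: s1 ht => -> ht.
    rewrite mul1r in ht.
    have e : x0 + 2 / t - x0 = 2 / t by ring.
    by rewrite -[X in _ * X <= _]e; apply: level_length; rewrite ?ltrDl// ltW.
  rewrite mulN1r in ht.
  have e : x0 - (x0 - 2 / t) = 2 / t by ring.
  by rewrite -[X in _ * X <= _]e; apply: level_length; rewrite ?gtrBl// ltW.
by rewrite mulrCA divff ?gt_eqF//; lra.
Qed.

End LogConcaveTails.

(** * Moments and length of superlevel sets *)

Section ExpBounds.
Variable R : realType.

Lemma expRN2_ge : 9^-1 <= expR (- 2) :> R.
Proof.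
have h0 : 7 / 8 <= expR (- 8^-1) :> R.
  by apply: le_trans (expR_ge1Dx _); lra.
have sq (a b y : R) : 0 <= a -> a <= expR y -> b <= a ^+ 2 -> b <= expR (y + y).
  move=> a0 ay ba; rewrite expRD (le_trans ba)// expr2.
  by apply: ler_pM.
have -> : - 2 = (- 8^-1 + - 8^-1 + (- 8^-1 + - 8^-1) + (- 8^-1 + - 8^-1 + (- 8^-1 + - 8^-1)))
  + (- 8^-1 + - 8^-1 + (- 8^-1 + - 8^-1) + (- 8^-1 + - 8^-1 + (- 8^-1 + - 8^-1))) :> R by lra.
(* Four squarings, starting from [exp (- 1/8) >= 7/8]. *)
apply: (@sq (342 / 1000)); [lra| |lra].
apply: (@sq (585 / 1000)); [lra| |lra].
apply: (@sq (765 / 1000)); [lra| |lra].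
by apply: (@sq (7 / 8)); [lra| |lra].
Qed.

Lemma expRN1_lt : expR (- 1) < 2 / 5 :> R.
Proof.
have h0 : 9 / 8 <= expR 8^-1 :> R.
  by apply: le_trans (expR_ge1Dx _); lra.
have sq (a b y : R) : 0 <= a -> a <= expR y -> b <= a ^+ 2 -> b <= expR (y + y).
  move=> a0 ay ba; rewrite expRD (le_trans ba)// expr2.
  by apply: ler_pM.
have e1 : 256 / 100 <= expR 1 :> R.
  rewrite [X in expR X](_ : 1 = (8^-1 + 8^-1 + (8^-1 + 8^-1)) +
    (8^-1 + 8^-1 + (8^-1 + 8^-1))); last by lra.
  (* Three squarings, starting from [exp (1/8) >= 9/8]. *)
  apply: (@sq (16 / 10)); [lra| |lra].
  apply: (@sq (1265 / 1000)); [lra| |lra].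
  by apply: (@sq (9 / 8)); [lra| |lra].
by rewrite expRN -(ltr_pM2r (expR_gt0 1)) mulVf ?gt_eqF ?expR_gt0//; lra.
Qed.

Lemma exp_le_fact_expR (y : R) a : 0 <= y -> y ^+ a <= a`!%:R * expR y.
Proof.
move=> y0; case: a => [|a].
  by rewrite expr0 fact0 mul1r -expR0 ler_expR.
have := expR_ge1Dxn a y0.
rewrite -lerBrDl => h; rewrite mulrC -ler_pdivrMr ?ltr0n ?fact_gt0//.
by rewrite (le_trans h)// gerBl.
Qed.

End ExpBounds.

Section LogConcaveMoments.
Variable R : realType.
Local Notation leb := (@lebesgue_measure R).
Variables (P : probability R R) (rho : R -> R).
Hypothesis Prho : lc_density P rho.

Let rho0 := lcd_ge0 Prho.
Let mrho := lcd_measurable Prho.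
Let dens := lcd_density Prho.

Lemma integral_density_real (f : R -> R) : measurable_fun [set: R] f ->
  (forall x, 0 <= f x) ->
  (\int[P]_x (f x)%:E = \int[leb]_x (f x * rho x)%:E)%E.
Proof.
move=> mf f0; rewrite (integral_density Prho)//.
by apply/measurable_EFinP.
Qed.

Lemma half_line_shift (s x0 L x : R) : s = 1 \/ s = -1 ->
  half_line s (x0 + s * L) x ->
  [/\ L <= s * (x - x0), x = x0 + s * (s * (x - x0)) &
      s * (x - (x0 + s * L)) = s * (x - x0) - L].
Proof.
by rewrite /half_line/=; case=> ->; rewrite ?mul1r ?mulN1r => h; split; lra.
Qed.

(** The density decays at the rate [2 / L]; half of this rate absorbs the growth
    of [f], and the other half makes the integral converge to [L]. *)
Lemma tail_integral (s x0 L c : R) (f : R -> R) : s = 1 \/ s = -1 -> 0 < L ->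
  0 < rho x0 -> rho (x0 + s * L) <= expR (- 2) * rho x0 ->
  0 <= c -> measurable_fun [set: R] f -> (forall x, 0 <= f x) ->
  (forall u, L <= u -> f (x0 + s * u) <= c * expR ((u - L) / L)) ->
  (\int[leb]_(x in half_line s (x0 + s * L)) (f x * rho x)%:E <=
   (c * rho (x0 + s * L) * L)%:E)%E.
Proof.
move=> s1 L0 r0 rL c0 mf f0 fc; apply: integral_half_line_le => //.
- by rewrite mulr_ge0.
- exact: measurable_funM.
- by move=> x; rewrite mulr_ge0.
- move=> x /(half_line_shift s1)[uL xE ->]; set u := s * (x - x0) in uL xE *.
  rewrite xE.
  rewrite (le_trans (ler_pM (f0 _) (rho0 _) (fc u uL)
    (rho_tail Prho s1 L0 r0 rL uL)))// mulrACA -expRD le_eqVlt.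
  apply/orP; left; apply/eqP; congr (_ * expR _).
  by field; rewrite gt_eqF.
Qed.

(** The density has exponential tails, and [(1 + v)^a] is at most
    [a! exp (1 + v)]. *)
Lemma lc_density_moments : finite_moments P.
Proof.
have [x0 r0] := exists_rho_gt0 Prho.
have [L L0 drop] := exists_drop Prho r0.
move=> a; apply/integrableP; split.
  by apply/measurable_EFinP; exact: measurable_funX.
rewrite [ltLHS](_ : _ = \int[P]_x (`|x| ^+ a)%:E)%E; last first.
  by apply: eq_integral => x _; rewrite /= normrX.
have mf : measurable_fun [set: R] (fun x : R => `|x| ^+ a).
  by apply: measurable_funX; exact: normr_measurable.
have f0 (x : R) : 0 <= `|x| ^+ a by rewrite exprn_ge0.
rewrite integral_density_real//.
rewrite (@integral_three_pieces _ (x0 - L) (x0 + L)); first last.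
- by move=> x; rewrite mulr_ge0.
- exact: measurable_funM.
- by rewrite ltrD2l gtrN.
set B := `|x0| + L.
have B0 : 0 <= B by rewrite addr_ge0// ltW.
pose c := B ^+ a * (a`!%:R * expR 1).
have c0 : 0 <= c by rewrite !mulr_ge0 ?exprn_ge0 ?expR_ge0.
have tail s : s = 1 \/ s = -1 ->
    (\int[leb]_(x in half_line s (x0 + s * L)) (`|x| ^+ a * rho x)%:E < +oo)%E.
  move=> s1; apply: le_lt_trans (ltry (c * rho (x0 + s * L) * L)).
  apply: tail_integral => //; first exact: drop.
  move=> u Lu; set v := (u - L) / L.
  have v0 : 0 <= v by rewrite divr_ge0 ?subr_ge0// ltW.
  have uE : u = L * (1 + v) by rewrite /v; field; rewrite gt_eqF.
  rewrite /c -!mulrA -expRD; apply: (@le_trans _ _ ((B * (1 + v)) ^+ a)).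
    have Bv0 : 0 <= B * (1 + v) by rewrite mulr_ge0// addr_ge0.
    apply: lerXn2r; rewrite ?nnegrE//.
    rewrite (le_trans (ler_normD _ _))// normrM.
    have -> : `|s| = 1 by case: s1 => ->; rewrite ?normrN normr1.
    rewrite mul1r (ger0_norm (le_trans (ltW L0) Lu)) uE /B mulrDl lerD2r.
    by rewrite ler_peMr// lerDl.
  rewrite exprMn ler_wpM2l ?exprn_ge0//.
  by apply: exp_le_fact_expR; rewrite addr_ge0.
apply: lte_add_pinfty.
  by have := @tail (-1); rewrite mulN1r; apply; right.
apply: lte_add_pinfty; last first.
  by have := @tail 1; rewrite mul1r; apply; left.
apply: (@le_lt_trans _ _ (\int[leb]_(x in `](x0 - L)%R, (x0 + L)%R[)
    ((B ^+ a)%:E * (rho x)%:E))%E).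
  apply: ge0_le_integral => //.
  - by move=> x _; rewrite lee_fin mulr_ge0.
  - by apply/measurable_EFinP/measurable_funTS; exact: measurable_funM.
  - by apply/measurable_EFinP/measurable_funTS; exact: measurable_funM.
  - move=> x /=; rewrite in_itv/= => xL; rewrite -EFinM lee_fin ler_wpM2r//.
    rewrite lerXn2r ?nnegrE//.
    have := ler_normD x0 (x - x0); rewrite addrC subrK => h.
    by rewrite (le_trans h)// lerD2l ler_norml; lra.
rewrite ge0_integralZl_EFin ?exprn_ge0//; last 2 first.
- by move=> x _; rewrite lee_fin.
- by apply/measurable_EFinP; exact: measurable_funTS.
rewrite -dens//; apply: lte_mul_pinfty => //; first by rewrite lee_fin exprn_ge0.
exact: le_lt_trans (probability_le1 P _) (ltry 1).
Qed.

(** The second moment about [x0] splits into the part within distance [L], at most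
    [L^2], and two tails.  As [(1 + v)^2 <= 4 exp (v - 1)], a tail is at most
    [4 / e] times [L^2] times [rho (x0 + s L) L].  The two numbers
    [rho (x0 + s L) L] add up to at most [1], since the density is at least
    [rho (x0 + s L)] between [x0] and [x0 + s L]. *)
Lemma drop_width (x0 L : R) : 0 < L -> 0 < rho x0 ->
  (1 <= \int[P]_x ((x - x0) ^+ 2)%:E)%E ->
  (forall s, s = 1 \/ s = -1 -> rho (x0 + s * L) <= expR (- 2) * rho x0) ->
  1 <= (1 + 4 * expR (- 1)) * L ^+ 2.
Proof.
move=> L0 r0 var drop.
have mf : measurable_fun [set: R] (fun x : R => (x - x0) ^+ 2).
  by apply: measurable_funX; exact: measurable_funB.
have f0 (x : R) : 0 <= (x - x0) ^+ 2 by rewrite sqr_ge0.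
pose c := L ^+ 2 * (4 * expR (- 1)).
have c0 : 0 <= c by rewrite mulr_ge0 ?sqr_ge0 ?mulr_ge0 ?expR_ge0.
have tail s : s = 1 \/ s = -1 ->
    (\int[leb]_(x in half_line s (x0 + s * L)) ((x - x0) ^+ 2 * rho x)%:E <=
     (c * rho (x0 + s * L) * L)%:E)%E.
  move=> s1; apply: tail_integral => //; first exact: drop.
  move=> u Lu; set v := (u - L) / L.
  have v0 : 0 <= v by rewrite divr_ge0 ?subr_ge0// ltW.
  have uE : u = L * (1 + v) by rewrite /v; field; rewrite gt_eqF.
  have -> : (x0 + s * u - x0) ^+ 2 = u ^+ 2 by case: s1 => ->; ring.
  rewrite uE exprMn /c -(mulrA (L ^+ 2)) -(mulrA 4) -expRD.
  rewrite ler_wpM2l ?sqr_ge0//.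
  have h : (1 + v) / 2 <= expR ((v - 1) / 2).
    by apply: le_trans (expR_ge1Dx _); lra.
  have -> : (1 + v) ^+ 2 = 4 * ((1 + v) / 2) ^+ 2 by field.
  have -> : -1 + v = (v - 1) / 2 + (v - 1) / 2 by field.
  rewrite expRD -expr2 ler_wpM2l// lerXn2r ?nnegrE ?expR_ge0//.
  by rewrite divr_ge0// addr_ge0.
have re : expR (- 2) * rho x0 <= rho x0.
  by rewrite ler_piMl ?ltW// -expR0 ler_expR; lra.
have mass1 : ((rho (x0 + L) * L)%:E <= P `]x0, (x0 + L)%R[%classic)%E.
  have := @mass_ge _ _ _ Prho (rho (x0 + L)) x0 (x0 + L).
  rewrite (_ : x0 + L - x0 = L); last by ring.
  apply; rewrite ?ltrDl// => x xI; apply: (@rho_between _ _ _ Prho _ x0 (x0 + L)) => //.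
    by have := drop 1; rewrite mul1r => h; apply: le_trans re; apply: h; left.
  by lra.
have massN1 : ((rho (x0 - L) * L)%:E <= P `](x0 - L)%R, x0[%classic)%E.
  have := @mass_ge _ _ _ Prho (rho (x0 - L)) (x0 - L) x0.
  rewrite (_ : x0 - (x0 - L) = L); last by ring.
  apply; rewrite ?gtrBl// => x xI; apply: (@rho_between _ _ _ Prho _ (x0 - L) x0) => //.
    by have := drop (-1); rewrite mulN1r => h; apply: le_trans re; apply: h; right.
  by lra.
have total : rho (x0 - L) * L + rho (x0 + L) * L <= 1.
  rewrite -lee_fin EFinD (le_trans (leeD massN1 mass1))//.
  rewrite -measureU//; first by apply: probability_le1; exact: measurableU.
  by apply/seteqP; split => // x /= []; rewrite !in_itv/= => h1 h2; lra.
have mid : (\int[leb]_(x in `](x0 - L)%R, (x0 + L)%R[)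
    ((x - x0) ^+ 2 * rho x)%:E <= (L ^+ 2)%:E)%E.
  apply: (@le_trans _ _ (\int[leb]_(x in `](x0 - L)%R, (x0 + L)%R[)
      ((L ^+ 2)%:E * (rho x)%:E))%E).
    apply: ge0_le_integral => //.
    - by move=> x _; rewrite lee_fin mulr_ge0.
    - by apply/measurable_EFinP/measurable_funTS; exact: measurable_funM.
    - by apply/measurable_EFinP/measurable_funTS; exact: measurable_funM.
    - move=> x /=; rewrite in_itv/= => xL; rewrite -EFinM lee_fin ler_wpM2r//.
      by rewrite -subr_ge0 subr_sqr mulr_ge0//; lra.
  rewrite ge0_integralZl_EFin ?sqr_ge0//; last 2 first.
  - by move=> x _; rewrite lee_fin.
  - by apply/measurable_EFinP; exact: measurable_funTS.
  rewrite -dens// -[leRHS]mule1 lee_wpmul2l ?lee_fin ?sqr_ge0//.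
  exact: probability_le1.
move: var; rewrite integral_density_real//.
rewrite (@integral_three_pieces _ (x0 - L) (x0 + L)); first last.
- by move=> x; rewrite mulr_ge0.
- exact: measurable_funM.
- by rewrite ltrD2l gtrN.
have tl := tail (-1) (or_intror erefl); have tr := tail 1 (or_introl erefl).
rewrite mulN1r in tl; rewrite mul1r in tr.
move=> var; have := le_trans var (leeD tl (leeD mid tr)).
rewrite -!EFinD lee_fin => h.
have : c * (rho (x0 - L) * L + rho (x0 + L) * L) <= c by rewrite ler_piMr.
by move: h; rewrite /c; lra.
Qed.

Hypothesis var : forall x0, (1 <= \int[P]_x ((x - x0) ^+ 2)%:E)%E.

Let l := Num.sqrt (5 / 13 : R).

Let l_gt0 : 0 < l. Proof. by rewrite sqrtr_gt0; lra. Qed.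

Let l_sqr : l ^+ 2 = 5 / 13. Proof. by rewrite sqr_sqrtr//; lra. Qed.

(** The contrary would be a drop by [9 >= e^2] on both sides, and
    [(1 + 4 / e) 5 / 13 < 1]. *)
Lemma level_reaches x0 : 0 < rho x0 ->
  exists2 s, s = 1 \/ s = -1 & rho x0 / 9 < rho (x0 + s * l).
Proof.
move=> r0; apply: contrapT => h.
have := @drop_width x0 l l_gt0 r0 (var x0).
have drop s : s = 1 \/ s = -1 -> rho (x0 + s * l) <= expR (- 2) * rho x0.
  move=> s1; rewrite leNgt; apply/negP => hs; apply: h; exists s => //.
  apply: le_lt_trans hs; rewrite mulrC ler_wpM2r//; exact: expRN2_ge.
move=> /(_ drop); rewrite l_sqr; have := expRN1_lt R; lra.
Qed.

(** Take for [t0] a ninth of a value of [rho] that exceeds three quarters of its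
    supremum [M]; then [t0 >= M / 12].  The superlevel set at height [t0] of
    this point reaches as far as [sqrt (5 / 13)] on one side. *)
Lemma level_geometry : exists M t0, [/\ 0 < t0, forall x, rho x <= M,
  3 * M <= 36 * t0 & forall a b, (forall x, t0 < rho x -> a <= x <= b) ->
    5 / 13 <= (b - a) ^+ 2].
Proof.
have bounded x : rho x <= 9 / l.
  have [r0|] := ltP 0 (rho x); last by move=> /le_trans; apply; rewrite divr_ge0 ?ltW.
  have [s s1 hs] := level_reaches r0.
  have hx : rho x / 9 <= rho x by rewrite ler_pdivrMr//; lra.
  have r9 : 0 <= rho x / 9 by rewrite divr_ge0// ltW.
  have : rho x / 9 * l <= 1.
    case: s1 hs => ->; rewrite ?mul1r ?mulN1r => /ltW hs.
      have e : x + l - x = l by ring.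
      by rewrite -[X in _ * X <= _]e; apply: (level_length Prho); rewrite ?ltrDl.
    have e : x - (x - l) = l by ring.
    by rewrite -[X in _ * X <= _]e; apply: (level_length Prho); rewrite ?gtrBl.
  rewrite ler_pdivlMr//; lra.
have [y0 ry0] := exists_rho_gt0 Prho.
pose S : set R := range rho.
have supS : has_sup S.
  split; first by exists (rho y0), y0.
  by exists (9 / l) => _ [x _ <-].
pose M := sup S.
have rM x : rho x <= M by apply: ub_le_sup; [case: supS|exists x].
have M0 : 0 < M by apply: lt_le_trans (rM y0).
have [_ [x0 _ <-] hx0] : exists2 y, S y & M - M / 4 < y.
  by apply: sup_adherent => //; rewrite divr_gt0.
have r0 : 0 < rho x0 by lra.
exists M, (rho x0 / 9); split => //.
- by rewrite divr_gt0.
- by lra.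
move=> a b ab; have [s s1 hs] := level_reaches r0.
have hx : rho x0 / 9 < rho x0 by rewrite ltr_pdivrMr//; lra.
have /andP[ax xb] := ab _ hx; have /andP[asx sxb] := ab _ hs.
have lb : l <= b - a by case: s1 asx sxb => ->; rewrite ?mul1r ?mulN1r; lra.
by rewrite -l_sqr lerXn2r ?nnegrE ?(le_trans (ltW l_gt0))// ltW.
Qed.

End LogConcaveMoments.

(** * Projections of the uniform law on a sphere *)

Section Archimedes.
Variable R : realType.
Local Notation leb := (@lebesgue_measure R).

Lemma continuous_integrable (f : R -> R) a b : continuous f ->
  leb.-integrable `[a, b] (EFin \o f).
Proof.
move=> cf; apply: continuous_compact_integrable; first exact: segment_compact.
exact: continuous_subspaceT.
Qed.

Lemma RintegralD_cont (f g : R -> R) a b : continuous f -> continuous g ->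
  \int[leb]_(x in `[a, b]) (f x + g x) =
  \int[leb]_(x in `[a, b]) f x + \int[leb]_(x in `[a, b]) g x.
Proof. by move=> cf cg; rewrite RintegralD//; exact: continuous_integrable. Qed.

Lemma RintegralZ_cont (c : R) (f : R -> R) a b : continuous f ->
  \int[leb]_(x in `[a, b]) (c * f x) = c * \int[leb]_(x in `[a, b]) f x.
Proof. by move=> cf; rewrite RintegralZl//; exact: continuous_integrable. Qed.

Lemma continuous_sum (I : Type) (r : seq I) (F : I -> R -> R) :
  (forall i, continuous (F i)) -> continuous (fun x => \sum_(i <- r) F i x).
Proof.
move=> cF; elim: r => [|i r IHr].
  rewrite (_ : (fun x => _) = cst 0); first exact: cst_continuous.
  by apply/funext => x; rewrite big_nil.
rewrite (_ : (fun x => _) = (fun x => F i x + \sum_(j <- r) F j x)).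
  by move=> x; apply: continuousD; [exact: cF|exact: IHr].
by apply/funext => x; rewrite big_cons.
Qed.

Lemma Rintegral_sum_cont (I : Type) (r : seq I) (F : I -> R -> R) a b :
  (forall i, continuous (F i)) ->
  \int[leb]_(x in `[a, b]) (\sum_(i <- r) F i x) =
  \sum_(i <- r) \int[leb]_(x in `[a, b]) F i x.
Proof.
move=> cF; elim: r => [|i r IHr].
  rewrite big_nil; under eq_Rintegral do rewrite big_nil.
  by rewrite /Rintegral integral0.
rewrite big_cons -IHr -RintegralD_cont//; last exact: continuous_sum.
by apply: eq_Rintegral => x _; rewrite big_cons.
Qed.

Lemma continuous_expn (f : R -> R) n : continuous f ->
  continuous (fun x => f x ^+ n).
Proof.
move=> cf; elim: n => [|n IHn]; first exact: cst_continuous.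
rewrite (_ : (fun x => _) = (fun x => f x * f x ^+ n)).
  by move=> x; exact: (continuousM (cf x) (IHn x)).
by apply/funext => x; rewrite exprS.
Qed.

Lemma continuous_mul (f g : R -> R) : continuous f -> continuous g ->
  continuous (fun x => f x * g x).
Proof. by move=> cf cg x; exact: (continuousM (cf x) (cg x)). Qed.

Lemma continuous_add (f g : R -> R) : continuous f -> continuous g ->
  continuous (fun x => f x + g x).
Proof. by move=> cf cg x; exact: (continuousD (cf x) (cg x)). Qed.

Lemma continuous_scale (c : R) (f : R -> R) : continuous f ->
  continuous (fun x => c * f x).
Proof. by move=> cf; apply: continuous_mul => //; exact: cst_continuous. Qed.

Lemma continuous_horner_comp (p : {poly R}) (f : R -> R) : continuous f ->
  continuous (fun x => p.[f x]).
Proof.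
move=> cf; rewrite (_ : (fun x => _) = (fun x => \sum_(i < size p) p`_i * f x ^+ i)).
  apply: (continuous_sum (F := fun (i : 'I_(size p)) x => p`_i * f x ^+ i)) => i.
  by apply: continuous_scale; exact: continuous_expn.
by apply/funext => x; rewrite horner_coef.
Qed.

Lemma Rintegral_FTC (f F : R -> R) a b : a < b -> continuous f ->
  (forall x : R, is_derive x 1 F (f x)) ->
  \int[leb]_(x in `[a, b]) f x = F b - F a.
Proof.
move=> ab cf dF.
have cF : continuous F.
  move=> x; apply: differentiable_continuous.
  by apply/derivable1_diffP; have [] := dF x.
rewrite /Rintegral (@continuous_FTC2 _ _ F)//.
- exact: continuous_subspaceT.
- split=> [x _||].
  + by have [] := dF x.
  + by apply: cvg_at_right_filter; exact: cF.
  + by apply: cvg_at_left_filter; exact: cF.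
- by move=> x _; rewrite derive1E; have [_ ->] := dF x.
Qed.

(** A derivative has no constant term. *)
Lemma trigpoly_deriv_sum D T T' N : trigpoly D T T' -> (D < N)%N ->
  \sum_(q < N) T' (grid R N q) = 0.
Proof.
move=> hT DN; elim: hT => [a m phi mD|T1 T1' T2 T2' _ h1 _ h2].
  have [->|m0] := eqVneq m 0%N.
    by rewrite big1// => q _; rewrite mulr0 mul0r oppr0.
  rewrite sumrN -mulr_sumr (_ : \sum_(_ < _) _ = 0) ?mulr0 ?oppr0//.
  rewrite -[RHS](@sum_grid_sin R N m 0%N phi)//.
  - by apply: eq_bigr => q _; rewrite mul0r subr0.
  - by rewrite addn0 (leq_ltn_trans mD).
  - by rewrite addn_gt0 (leq_ltn_trans _ DN).
by rewrite big_split/= h1 h2 addr0.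
Qed.

Definition cos_mean N i : R := N%:R^-1 * \sum_(q < N) cos (grid R N q) ^+ i.

Lemma cos_mean0 N : (0 < N)%N -> cos_mean N 0 = 1.
Proof.
move=> N0; rewrite /cos_mean; under eq_bigr do rewrite expr0.
by rewrite sumr_const card_ord mulVf// pnatr_eq0 -lt0n.
Qed.

Lemma cos_mean1 N : (1 < N)%N -> cos_mean N 1 = 0.
Proof.
move=> N1; rewrite /cos_mean; under eq_bigr do rewrite expr1.
by rewrite (trigpoly_deriv_sum (trigpoly_sin R) N1) mulr0.
Qed.

(** The sum over the grid of the derivative of [sin cos^(i+1)] vanishes. *)
Lemma cos_meanSS N i : (i.+2 < N)%N ->
  i.+2%:R * cos_mean N i.+2 = i.+1%:R * cos_mean N i.
Proof.
move=> iN; have hc : trigpoly 1 (@cos R) (fun t => - sin t).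
  apply: trigpoly_eq (trigpoly_cos 0 1 0) => t; first by rewrite add0r mul1r addr0.
  by rewrite mul1r addr0.
have := trigpoly_deriv_sum (trigpolyM (trigpoly_sin R) (trigpolyX i.+1 hc)).
rewrite muln1 => /(_ N iN) /=.
under eq_bigr => q _.
  rewrite (_ : _ + _ = i.+2%:R * cos (grid R N q) ^+ i.+2 -
      i.+1%:R * cos (grid R N q) ^+ i).
    over.
  have -> : sin (grid R N q) * (i.+1%:R * cos (grid R N q) ^+ i * - sin (grid R N q))
    = - (i.+1%:R * cos (grid R N q) ^+ i * sin (grid R N q) ^+ 2) by ring.
  by rewrite sin2cos2 -[i.+2%:R]natr1 !exprS; ring.
rewrite sumrB -!mulr_sumr /cos_mean => /eqP; rewrite subr_eq0 => /eqP h.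
by rewrite mulrCA h mulrCA.
Qed.

Lemma continuous_onem_sqr : continuous (fun u : R => 1 - u ^+ 2).
Proof.
have c1 : continuous (fun _ : R => 1 : R) by exact: cst_continuous.
have c2 : continuous (fun u : R => u ^+ 2) by apply: continuous_expn => x; exact: id.
by move=> u; exact: (continuousB (c1 u) (c2 u)).
Qed.

(** Wallis' integral [int cos^(2 j + 1)] over a quarter period, in the variable
    [u = sin]. *)
Definition wallis j : R := \int[leb]_(u in `[0, 1]) (1 - u ^+ 2) ^+ j.

Lemma wallis0 : wallis 0 = 1.
Proof.
rewrite /wallis (@Rintegral_FTC _ id)//; first by rewrite subr0.
by apply: continuous_expn; exact: continuous_onem_sqr.
Qed.

(** The derivative of [u (1 - u^2)^(j+1)] has integral [0]. *)
Lemma wallisS j : (2 * j + 3)%:R * wallis j.+1 = (2 * j + 2)%:R * wallis j.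
Proof.
have cw i : continuous (fun u : R => (1 - u ^+ 2) ^+ i).
  by apply: continuous_expn; exact: continuous_onem_sqr.
apply/eqP; rewrite -subr_eq0 -mulNr; apply/eqP.
rewrite /wallis -!RintegralZ_cont// -RintegralD_cont//; last 2 first.
- exact: continuous_scale.
- exact: continuous_scale.
have dF (u : R) : is_derive u 1 (fun u : R => u * (1 - u ^+ 2) ^+ j.+1)
    ((2 * j + 3)%:R * (1 - u ^+ 2) ^+ j.+1 + - (2 * j + 2)%:R * (1 - u ^+ 2) ^+ j).
  have d1 : is_derive u 1 (fun u : R => 1 - u ^+ 2) (- (2 * u)).
    have d0 := is_deriveX 2 (is_derive_id u (1 : R)).
    have dc : is_derive u (1 : R) (fun _ : R => 1 : R) 0 by exact: is_derive_cst.
    apply: (is_derive_eq (is_deriveB dc d0)).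
    by rewrite /GRing.scale/=; ring.
  have := is_deriveX j.+1 d1; rewrite exprfctE => d2.
  have d3 := is_deriveM (is_derive_id u (1 : R)) d2.
  apply: (is_derive_eq d3).
  have e3 : (2 * j + 3)%:R = 2 * j%:R + 3 :> R by rewrite natrD natrM.
  have e2 : (2 * j + 2)%:R = 2 * j%:R + 2 :> R by rewrite natrD natrM.
  by rewrite /GRing.scale/= e2 e3 -[j.+1%:R]natr1 !exprS; ring.
rewrite (Rintegral_FTC ltr01 _ dF).
  by rewrite expr1n subrr expr0n/= mulr0 mul0r subrr.
by apply: continuous_add; exact: continuous_scale.
Qed.

(** The two recurrences telescope.  The value is the moment of order [2 j] of the
    uniform law on [-1, 1]: this is Archimedes' theorem. *)
Lemma cos_mean_wallis N j : (2 * j < N)%N ->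
  cos_mean N (2 * j) * wallis j = (2 * j + 1)%:R^-1.
Proof.
elim: j => [|j IHj] jN.
  by rewrite muln0 add0n cos_mean0 ?(leq_ltn_trans _ jN)// wallis0 mulr1 invr1.
have eS : (2 * j.+1 = (2 * j).+2)%N by rewrite mulnS.
rewrite eS in jN *.
have h1 := cos_meanSS jN; have h2 := wallisS j.
have h := IHj (ltn_trans (leqnSn _) jN).
have e2 : (2 * j).+2%:R = (2 * j)%:R + 2 :> R by rewrite -addn2 natrD.
have e1 : (2 * j).+1%:R = (2 * j)%:R + 1 :> R by rewrite -natr1.
have e3 : ((2 * j).+2 + 1)%:R = (2 * j)%:R + 3 :> R by rewrite addn1 -addn3 natrD.
have f3 : (2 * j + 3)%:R = (2 * j)%:R + 3 :> R by rewrite natrD.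
have f2 : (2 * j + 2)%:R = (2 * j)%:R + 2 :> R by rewrite natrD.
have f1 : (2 * j + 1)%:R = (2 * j)%:R + 1 :> R by rewrite natrD.
move: h1 h2 h; rewrite e1 e2 e3 f1 f2 f3.
move: (cos_mean N (2 * j).+2) (cos_mean N (2 * j)) (wallis j.+1) (wallis j).
have z0 : 0 <= (2 * j)%:R :> R by [].
move: ((2 * j)%:R : R) z0 => z z0 a b c e h1 h2 h.
have z1 : z + 1 != 0 by rewrite gt_eqF//; lra.
have z2 : z + 2 != 0 by rewrite gt_eqF//; lra.
have z3 : z + 3 != 0 by rewrite gt_eqF//; lra.
have -> : a = (z + 1) / (z + 2) * b.
  by rewrite mulrAC -h1 mulrAC divff// mul1r.
have -> : c = (z + 2) / (z + 3) * e.
  by rewrite mulrAC -h2 mulrAC divff// mul1r.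
have -> : (z + 1) / (z + 2) * b * ((z + 2) / (z + 3) * e) =
    (z + 1) / (z + 3) * (b * e) by field; rewrite z2 z3.
by rewrite h; field; rewrite z1 z3.
Qed.

Lemma cos_mean_odd N j : (2 * j + 1 < N)%N -> cos_mean N (2 * j + 1) = 0.
Proof.
elim: j => [|j IHj] jN; first by rewrite cos_mean1.
have e : (2 * j.+1 + 1 = (2 * j + 1).+2)%N by rewrite mulnS -addnA add2n.
rewrite e in jN *.
have := cos_meanSS jN; rewrite IHj ?mulr0; last exact: (ltn_trans _ jN).
by move=> /eqP; rewrite mulf_eq0 pnatr_eq0/= => /eqP.
Qed.

Lemma Rintegral_monomial a b i : a < b ->
  \int[leb]_(x in `[a, b]) x ^+ i = (b ^+ i.+1 - a ^+ i.+1) / i.+1%:R.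
Proof.
move=> ab.
have dF (x : R) : is_derive x 1 (fun x : R => i.+1%:R^-1 * x ^+ i.+1) (x ^+ i).
  have := is_deriveX i.+1 (is_derive_id x (1 : R)); rewrite exprfctE => d0.
  have d := is_deriveZ i.+1%:R^-1 d0.
  apply: (is_derive_eq d).
  by rewrite /GRing.scale/=; field; rewrite ?pnatr_eq0 ?natr1 ?pnatr_eq0.
rewrite (Rintegral_FTC ab _ dF); first by ring.
by apply: continuous_expn => x; exact: id.
Qed.

(** The mean of [p] at one coordinate of a uniform point of the unit sphere, with
    weight the power [e] of the squared radius of the circle on which the point
    lies: [u] is the height of the circle and [sqrt (1 - u^2)] its radius.  By
    symmetry only heights in [0, 1] are needed. *)
Definition sphere_mean N e (p : {poly R}) : R :=
  \int[leb]_(u in `[0, 1]) ((1 - u ^+ 2) ^+ e *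
    (N%:R^-1 * \sum_(q < N) p.[Num.sqrt (1 - u ^+ 2) * cos (grid R N q)])).

Lemma continuous_sqrt_onem : continuous (fun u : R => Num.sqrt (1 - u ^+ 2)).
Proof.
move=> u.
exact: (continuous_comp (@continuous_onem_sqr u) (@sqrt_continuous R _)).
Qed.

Lemma sphere_mean_coef N e (p : {poly R}) : sphere_mean N e p =
  \sum_(i < size p) p`_i * (cos_mean N i *
    \int[leb]_(u in `[0, 1]) ((1 - u ^+ 2) ^+ e * Num.sqrt (1 - u ^+ 2) ^+ i)).
Proof.
have cE i : continuous (fun u : R => (1 - u ^+ 2) ^+ e * Num.sqrt (1 - u ^+ 2) ^+ i).
  apply: continuous_mul; apply: continuous_expn.
    exact: continuous_onem_sqr.
  exact: continuous_sqrt_onem.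
transitivity (\int[leb]_(u in `[0, 1]) (\sum_(i < size p)
    (p`_i * cos_mean N i) * ((1 - u ^+ 2) ^+ e * Num.sqrt (1 - u ^+ 2) ^+ i))).
  apply: eq_Rintegral => u _.
  under eq_bigr do rewrite horner_coef.
  rewrite exchange_big/= !mulr_sumr; apply: eq_bigr => i _.
  under eq_bigr do rewrite exprMn mulrA.
  by rewrite -mulr_sumr /cos_mean; ring.
rewrite Rintegral_sum_cont; last first.
  by move=> i; exact: continuous_scale.
by apply: eq_bigr => i _; rewrite RintegralZ_cont ?mulrA//; exact: cE.
Qed.

Lemma sphere_mean_even e j :
  \int[leb]_(u in `[0, 1]) ((1 - u ^+ 2) ^+ e * Num.sqrt (1 - u ^+ 2) ^+ (2 * j)) =
  wallis (j + e).
Proof.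
apply: eq_Rintegral => u; rewrite inE/= in_itv/= => /andP[u0 u1].
rewrite exprM sqr_sqrtr ?exprD 1?mulrC// subr_ge0 expr_le1//.
Qed.

Lemma Rintegral_horner_sym (p : {poly R}) :
  \int[leb]_(x in `[-1, 1]) p.[x] =
  \sum_(i < size p) p`_i * ((1 ^+ i.+1 - (-1) ^+ i.+1) / i.+1%:R).
Proof.
rewrite (_ : \int[_]_(x in _) _ = \int[leb]_(x in `[-1, 1]) (\sum_(i < size p) p`_i * x ^+ i)).
  rewrite Rintegral_sum_cont; last first.
    by move=> i; apply: continuous_scale; apply: continuous_expn => y; exact: id.
  have N11 : -1 < 1 :> R by lra.
  apply: eq_bigr => i _; rewrite RintegralZ_cont ?Rintegral_monomial//.
  by apply: continuous_expn => y; exact: id.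
by apply: eq_Rintegral => x _; rewrite horner_coef.
Qed.

(** Archimedes' theorem, compared moment by moment. *)
Lemma sphere_mean0 N (p : {poly R}) : (size p <= N)%N ->
  sphere_mean N 0 p = 2^-1 * \int[leb]_(x in `[-1, 1]) p.[x].
Proof.
move=> pN; rewrite sphere_mean_coef Rintegral_horner_sym mulr_sumr.
apply: eq_bigr => i _; rewrite [RHS]mulrCA; congr (_ * _).
have iN : (i < N)%N by exact: leq_trans (ltn_ord i) pN.
move: (nat_of_ord i) iN => {}i iN.
rewrite expr1n; case/boolP: (odd i) => io; last first.
  have iE : (i = 2 * i./2)%N by rewrite mul2n even_halfK.
  rewrite iE in iN *; rewrite sphere_mean_even addn0 cos_mean_wallis//.
  have n0 : (2 * i./2).+1%:R != 0 :> R by rewrite pnatr_eq0.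
  rewrite addn1 exprS exprM sqrrN !expr1n.
  by move: ((2 * i./2).+1%:R : R) n0 => z z0; field.
have iE : (i = 2 * i./2 + 1)%N by rewrite mul2n addn1 -[LHS]odd_double_half io.
rewrite iE in iN *; rewrite cos_mean_odd// mul0r.
have s1 : (-1) ^+ (2 * i./2 + 1).+1 = 1 :> R.
  by rewrite -signr_odd addn1 /= mul2n odd_double expr0.
by rewrite s1 subrr mul0r mulr0.
Qed.

(** Moment by moment, the weighted measure has density [(1 + x^2) / 4] on [-1, 1],
    which is at least half of the density [1 / 2] of the uniform law. *)
Lemma sphere_mean1 N (p : {poly R}) : (size p <= N)%N ->
  (forall x, 0 <= p.[x]) -> 2^-1 * sphere_mean N 0 p <= sphere_mean N 1 p.
Proof.
move=> pN p0; rewrite sphere_mean0//.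
suff -> : sphere_mean N 1 p =
    4^-1 * \int[leb]_(x in `[-1, 1]) (p * (1 + 'X^2)).[x].
  rewrite mulrA (_ : 2^-1 * 2^-1 = 4^-1); last by field.
  rewrite ler_wpM2l ?invr_ge0//; apply: le_Rintegral => //.
  - by apply: continuous_integrable; apply: continuous_horner_comp => x; exact: id.
  - by apply: continuous_integrable; apply: continuous_horner_comp => x; exact: id.
  - move=> x _; rewrite hornerM ler_peMr//.
    by rewrite hornerD hornerC hornerXn lerDl sqr_ge0.
rewrite (_ : \int[_]_(x in _) _ = \int[leb]_(x in `[-1, 1])
    (\sum_(i < size p) p`_i * (x ^+ i + x ^+ i.+2))); last first.
  apply: eq_Rintegral => x _; rewrite hornerM hornerD hornerC hornerXn horner_coef.
  rewrite mulr_suml; apply: eq_bigr => i _.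
  by rewrite -mulrA mulrDr mulr1 -exprD addn2.
have cX i : continuous (fun x : R => x ^+ i).
  by apply: continuous_expn => y; exact: id.
rewrite sphere_mean_coef Rintegral_sum_cont; last first.
  by move=> i; apply: continuous_scale; apply: continuous_add; exact: cX.
rewrite mulr_sumr; apply: eq_bigr => i _.
rewrite RintegralZ_cont; last by apply: continuous_add; exact: cX.
have N11 : -1 < 1 :> R by lra.
rewrite RintegralD_cont// !Rintegral_monomial//.
rewrite [RHS]mulrCA; congr (_ * _).
have iN : (i < N)%N by exact: leq_trans (ltn_ord i) pN.
move: (nat_of_ord i) iN => {}i iN.
rewrite !expr1n; case/boolP: (odd i) => io; last first.
  have iE : (i = 2 * i./2)%N by rewrite mul2n even_halfK.
  rewrite iE in iN *; rewrite sphere_mean_even.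
  move: (i./2) iN => j jN.
  have h := cos_mean_wallis jN; have h2 := wallisS j.
  rewrite addn1; have z0 : 0 <= (2 * j)%:R :> R by [].
  have -> : (-1) ^+ (2 * j).+1 = -1 :> R by rewrite exprS exprM sqrrN !expr1n mulr1.
  have -> : (-1) ^+ (2 * j).+3 = -1 :> R.
    by rewrite -signr_odd /= mul2n odd_double expr1.
  have e1 : (2 * j).+1%:R = (2 * j)%:R + 1 :> R by rewrite -natr1.
  have e3 : (2 * j).+3%:R = (2 * j)%:R + 3 :> R by rewrite -addn3 natrD.
  have f3 : (2 * j + 3)%:R = (2 * j)%:R + 3 :> R by rewrite natrD.
  have f2 : (2 * j + 2)%:R = (2 * j)%:R + 2 :> R by rewrite natrD.
  have f1 : (2 * j + 1)%:R = (2 * j)%:R + 1 :> R by rewrite natrD.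
  rewrite e1 e3; move: h h2; rewrite f1 f2 f3.
  move: (cos_mean N (2 * j)) (wallis j.+1) (wallis j).
  move: ((2 * j)%:R : R) z0 => z z0 b c e h h2.
  have z1 : z + 1 != 0 by rewrite gt_eqF//; lra.
  have z3 : z + 3 != 0 by rewrite gt_eqF//; lra.
  have -> : c = (z + 2) / (z + 3) * e.
    by rewrite mulrAC -h2 mulrAC divff// mul1r.
  have -> : b * ((z + 2) / (z + 3) * e) = (z + 2) / (z + 3) * (b * e) by ring.
  by rewrite h; field; rewrite z1 z3.
have iE : (i = 2 * i./2 + 1)%N by rewrite mul2n addn1 -[LHS]odd_double_half io.
rewrite iE in iN *; rewrite cos_mean_odd// mul0r.
have s1 : (-1) ^+ (2 * i./2 + 1).+1 = 1 :> R.
  by rewrite -signr_odd addn1 /= mul2n odd_double expr0.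
have s3 : (-1) ^+ (2 * i./2 + 1).+3 = 1 :> R.
  by rewrite !exprS in s1 *; rewrite s1; ring.
by rewrite s1 s3 !subrr !mul0r addr0 mulr0.
Qed.

(** The tangent at [1 / 2] of the power [a] of the weight reduces the claim to the
    exponents [0] and [1]. *)
Lemma sphere_mean_ge N a (p : {poly R}) : (size p <= N)%N ->
  (forall x, 0 <= p.[x]) -> 2^-1 ^+ a * sphere_mean N 0 p <= sphere_mean N a p.
Proof.
move=> pN p0.
pose g (u : R) := N%:R^-1 * \sum_(q < N) p.[Num.sqrt (1 - u ^+ 2) * cos (grid R N q)].
have g0 u : 0 <= g u by rewrite mulr_ge0 ?invr_ge0 ?ler0n// sumr_ge0.
have cg : continuous g.
  apply: continuous_scale.
  apply: (continuous_sum (F := fun (q : 'I_N) u =>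
    p.[Num.sqrt (1 - u ^+ 2) * cos (grid R N q)])) => q.
  apply: continuous_horner_comp; apply: continuous_mul.
    exact: continuous_sqrt_onem.
  exact: cst_continuous.
have cwg e : continuous (fun u : R => (1 - u ^+ 2) ^+ e * g u).
  apply: continuous_mul => //.
  by apply: continuous_expn; exact: continuous_onem_sqr.
have h1 := sphere_mean1 pN p0.
apply: (@le_trans _ _ (2^-1 ^+ a * sphere_mean N 0 p +
    a%:R * 2^-1 ^+ a.-1 * (sphere_mean N 1 p - 2^-1 * sphere_mean N 0 p))).
  by rewrite lerDl mulr_ge0 ?subr_ge0// mulr_ge0 ?exprn_ge0// invr_ge0.
rewrite [leLHS](_ : _ = (2^-1 ^+ a - a%:R * 2^-1 ^+ a.-1 * 2^-1) * sphere_mean N 0 p +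
   (a%:R * 2^-1 ^+ a.-1) * sphere_mean N 1 p); last by ring.
rewrite /sphere_mean -!RintegralZ_cont -?RintegralD_cont; try exact: cwg; last 2 first.
- exact: continuous_scale.
- exact: continuous_scale.
apply: le_Rintegral => //.
- by apply: continuous_integrable; apply: continuous_add; exact: continuous_scale.
- by apply: continuous_integrable; exact: cwg.
- move=> u; rewrite /= in_itv/= => /andP[u0 u1].
  have t0 : 0 <= 1 - u ^+ 2 by rewrite subr_ge0 expr_le1.
  rewrite -/(g u) [leLHS](_ : _ = (2^-1 ^+ a +
      a%:R * 2^-1 ^+ a.-1 * (1 - u ^+ 2 - 2^-1)) * g u).
    by rewrite ler_wpM2r// ?g0//; apply: tangent_exp; rewrite ?invr_ge0.
  by rewrite expr0 expr1; ring.
Qed.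

End Archimedes.

(** * Layers of a log-concave density *)

Section BoundedIntervals.
Variable R : realType.
Local Notation leb := (@lebesgue_measure R).

Lemma Rintegral_bounded_itv (b1 b2 : bool) (a c : R) (f : R -> R) : continuous f ->
  \int[leb]_(x in [set` Interval (BSide b1 a) (BSide b2 c)]) f x =
  \int[leb]_(x in `[a, c]) f x.
Proof.
move=> cf.
have int (d1 d2 : bool) : leb.-integrable
    [set` Interval (BSide d1 a) (BSide d2 c)] (EFin \o f).
  apply: integrableS (continuous_integrable a c cf) => //.
  by apply: subset_itvScc; rewrite bnd_simp; case: d1 d2 => [] [].
transitivity (\int[leb]_(x in [set` Interval (BSide b1 a) (BRight c)]) f x).
  by case: b2 => //; apply: Rintegral_itv_bndo_bndc; exact: int.
by case: b1 => //; apply: Rintegral_itv_obnd_cbnd; exact: int.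
Qed.

(** An interval differs from its closure by at most the end points. *)
Lemma Rintegral_bounded_interval (S : set R) (f : R -> R) :
  is_interval S -> has_lbound S -> has_ubound S -> continuous f ->
  \int[leb]_(x in S) f x = \int[leb]_(x in `[inf S, sup S]) f x.
Proof.
move=> itvS lbS ubS cf.
rewrite -(Rintegral_bounded_itv `[< S (inf S) >] (~~ `[< S (sup S) >]))//.
congr (Rintegral _ _ _); have /is_intervalP {1}-> := itvS.
by rewrite /Rhull (asboolT lbS) (asboolT ubS).
Qed.

Lemma is_derive_horner (p : {poly R}) (x : R) : is_derive x 1 (horner p) p^`().[x].
Proof.
apply: DeriveDef; first exact: derivable_horner.
by rewrite derivE derive1E.
Qed.

Definition antideriv (p : {poly R}) : {poly R} :=
  \poly_(i < (size p).+1) (p`_i.-1 / i%:R).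

Lemma deriv_antideriv (p : {poly R}) : (antideriv p)^`() = p.
Proof.
apply/polyP => i; rewrite coef_deriv coef_poly ltnS.
have [|pi] := ltnP i (size p).
  by move=> _; rewrite -[LHS]mulr_natr divfK// pnatr_eq0.
by rewrite mul0rn nth_default.
Qed.

Lemma Rintegral_horner (p : {poly R}) a b : a < b ->
  \int[leb]_(x in `[a, b]) p.[x] = (antideriv p).[b] - (antideriv p).[a].
Proof.
move=> ab; apply: Rintegral_FTC => //.
  by apply: continuous_horner_comp => x; exact: id.
by move=> x; rewrite -{2}(deriv_antideriv p); exact: is_derive_horner.
Qed.

Lemma Rintegral_affine (p : {poly R}) a b : a < b ->
  \int[leb]_(x in `[a, b]) p.[x] = (b - a) / 2 *
  \int[leb]_(x in `[-1, 1]) (p \Po (((a + b) / 2)%:P + ((b - a) / 2) *: 'X)).[x].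
Proof.
move=> ab; set L := _ + _ *: 'X; have N11 : -1 < 1 :> R by lra.
rewrite -RintegralZ_cont; last by apply: continuous_horner_comp => x; exact: id.
have dF (x : R) : is_derive x 1 (horner (antideriv p \Po L))
    ((b - a) / 2 * (p \Po L).[x]).
  have := is_derive_horner (antideriv p \Po L) x.
  rewrite deriv_comp deriv_antideriv hornerM [X in _ * X](_ : _ = (b - a) / 2).
    by rewrite mulrC.
  by rewrite /L derivD derivC derivZ derivX add0r hornerZ hornerC mulr1.
rewrite Rintegral_horner// (Rintegral_FTC N11 _ dF).
  by rewrite !horner_comp /L !hornerE; congr (_.[_] - _.[_]); field.
by apply: continuous_scale; apply: continuous_horner_comp => x; exact: id.
Qed.

End BoundedIntervals.

Section LevelMixture.
Variable R : realType.
Local Notation leb := (@lebesgue_measure R).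
Variables (P : probability R R) (rho : R -> R).
Hypothesis Prho : lc_density P rho.
Hypothesis mom : finite_moments P.
Variables (M t0 : R) (J : nat).
Hypothesis t0_gt0 : 0 < t0.
Hypothesis rho_leM : forall x, rho x <= M.
Hypothesis M_le : 3 * M <= 36 * t0.
Hypothesis wide : forall a b, (forall x, t0 < rho x -> a <= x <= b) ->
  5 / 13 <= (b - a) ^+ 2.
Hypothesis J0 : (0 < J)%N.

Let rho0 := lcd_ge0 Prho.
Let mrho := lcd_measurable Prho.

Definition step : R := t0 / J%:R.

Let J_gt0 : 0 < J%:R :> R. Proof. by rewrite ltr0n. Qed.

Lemma step_gt0 : 0 < step. Proof. by rewrite divr_gt0. Qed.

Definition level (j : nat) : set R := [set x | j.+1%:R * step < rho x].
Definition lo j := inf (level j).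
Definition hi j := sup (level j).

Lemma level_is_interval j : is_interval (level j).
Proof. exact: log_concave_levels (lcd_concave Prho) _. Qed.

Lemma measurable_level j : measurable (level j).
Proof. by apply: is_interval_measurable; exact: level_is_interval. Qed.

Let level_step j : (j < J)%N -> j.+1%:R * step <= t0.
Proof.
move=> jJ; rewrite /step mulrCA ger_pMr// ler_pdivrMr// mul1r.
by rewrite ler_nat.
Qed.

Lemma level_nonempty j : (j < J)%N -> level j !=set0.
Proof.
move=> jJ; apply: contrapT => h.
have : 5 / 13 <= (0 - 0 : R) ^+ 2.
  apply: wide => x tx; exfalso; apply: h; exists x.
  exact: le_lt_trans (level_step jJ) tx.
by rewrite subrr expr0n/=; lra.
Qed.

Lemma level_bounds j : (j < J)%N ->
  exists B, forall x, level j x -> - B <= x <= B.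
Proof.
move=> jJ; have [y ly] := level_nonempty jJ.
have t1 : 0 < j.+1%:R * step by rewrite mulr_gt0 ?step_gt0.
pose D := (j.+1%:R * step)^-1.
have close u v : level j u -> level j v -> v - u <= D.
  move=> lu lv; have [uv|vu] := ltP u v; last first.
    by rewrite (@le_trans _ _ 0) ?subr_le0// invr_ge0 ltW.
  rewrite -[leRHS]mul1r ler_pdivlMr// mulrC.
  by apply: (level_length Prho); rewrite ?ltW.
exists (`|y| + D) => x lx.
have h1 := close _ _ ly lx; have h2 := close _ _ lx ly.
have := ler_norm y; have := ler_norm (- y); rewrite normrN; lra.
Qed.

Lemma level_has_ubound j : (j < J)%N -> has_ubound (level j).
Proof. by move=> /level_bounds[B h]; exists B => x /h /andP[]. Qed.

Lemma level_has_lbound j : (j < J)%N -> has_lbound (level j).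
Proof. by move=> /level_bounds[B h]; exists (- B) => x /h /andP[]. Qed.

Lemma level_between j x : (j < J)%N -> level j x -> lo j <= x <= hi j.
Proof.
move=> jJ lx; rewrite ge_inf//=; last exact: level_has_lbound.
by rewrite ub_le_sup//; exact: level_has_ubound.
Qed.

Lemma level_width j : (j < J)%N -> lo j < hi j /\ 5 / 13 <= (hi j - lo j) ^+ 2.
Proof.
move=> jJ; have w : 5 / 13 <= (hi j - lo j) ^+ 2.
  apply: wide => x tx; apply: level_between => //.
  exact: le_lt_trans (level_step jJ) tx.
split=> //; have [y ly] := level_nonempty jJ.
have /andP[ay yb] := level_between jJ ly.
rewrite lt_neqAle (le_trans ay yb) andbT; apply/eqP => e.
by move: w; rewrite e subrr expr0n/=; lra.
Qed.

Lemma Rintegral_level j (p : {poly R}) : (j < J)%N ->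
  \int[leb]_(x in level j) p.[x] = \int[leb]_(x in `[lo j, hi j]) p.[x].
Proof.
move=> jJ; apply: Rintegral_bounded_interval.
- exact: level_is_interval.
- exact: level_has_lbound.
- exact: level_has_ubound.
- exact: continuous_horner.
Qed.

Lemma integrable_level j (p : {poly R}) : (j < J)%N ->
  leb.-integrable (level j) (EFin \o horner p).
Proof.
move=> jJ; have ci := continuous_integrable (lo j) (hi j) (@continuous_horner R p).
apply: integrableS ci => //; first exact: measurable_level.
by move=> x /(level_between jJ); rewrite /= in_itv.
Qed.

(** The part of the density below [t0], rounded down to a multiple of the step
    and written as a sum over layers. *)
Definition layered (x : R) : R := \sum_(j < J) step * \1_(level j) x.

(** If [rho x] is above all the levels then [layered x = t0 >= M / 12].
    Otherwise [layered x] differs from [rho x] by at most one step, which is less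
    than [rho x / 2] as soon as [rho x] exceeds two steps. *)
Lemma layered_bounds x : 0 <= layered x <= rho x /\
  (2 * step < rho x -> rho x <= 12 * layered x).
Proof.
have s0 := step_gt0.
pose f n := \sum_(j < n) step * \1_(level j) x.
have fS n : f n.+1 = f n + (if n.+1%:R * step < rho x then step else 0).
  rewrite /f big_ord_recr/=; congr (_ + _); rewrite indicE.
  case: ifPn => h; first by rewrite mem_set ?mulr1.
  by rewrite memNset ?mulr0//; exact/negP.
have fle n : 0 <= f n /\ f n <= rho x /\ f n <= n%:R * step.
  elim: n => [|n [h0 [h1 h2]]]; first by rewrite /f big_ord0 mul0r.
  rewrite fS -[n.+1%:R]natr1 mulrDl mul1r; by case: ifPn => h; split; [|split| |split]; lra.
have fge n : rho x - step <= f n \/ n%:R * step <= f n.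
  elim: n => [|n IHn]; first by right; rewrite /f big_ord0 mul0r.
  rewrite fS -[n.+1%:R]natr1 mulrDl mul1r; case: ifPn => h.
    by case: IHn => hn; [left|right]; lra.
  by move: h; rewrite -leNgt => h; case: IHn => hn; left; lra.
have [h0 [h1 _]] := fle J; split; first exact/andP.
move=> h; have JE : J%:R * step = t0 by rewrite /step mulrC divfK ?gt_eqF.
have rM := rho_leM x; rewrite -[layered x]/(f J).
have Ml := M_le.
by case: (fge J); rewrite ?JE => hJ; move: h1; lra.
Qed.

Lemma measurable_layered : measurable_fun [set: R] layered.
Proof.
apply: measurable_sum => j; apply: measurable_funM => //.
by apply: measurable_indic; exact: measurable_level.
Qed.

Lemma integral_layered (p : {poly R}) : (forall x, 0 <= p.[x]) ->
  ((\sum_(j < J) step * \int[leb]_(x in level j) p.[x])%:E =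
   \int[leb]_x (p.[x] * layered x)%:E)%E.
Proof.
move=> p0.
have mp : measurable_fun [set: R] (horner p) by exact: measurable_horner.
transitivity (\int[leb]_x (\sum_(j < J) (step * (p.[x] * \1_(level j) x))%:E))%E.
  rewrite ge0_integral_sum//; last 2 first.
  - move=> j; apply/measurable_EFinP; apply: measurable_funM => //.
    apply: measurable_funM => //.
    by apply: measurable_indic; exact: measurable_level.
  - move=> j x _; rewrite lee_fin mulr_ge0 ?(ltW step_gt0)// mulr_ge0//.
  rewrite -sumEFin; apply: eq_bigr => j _.
  rewrite EFinM /Rintegral fineK; last first.
    by apply: integrable_fin_num; [exact: measurable_level|exact: integrable_level].
  rewrite integral_mkcond.
  under [RHS]eq_integral do rewrite EFinM.
  rewrite ge0_integralZl_EFin ?(ltW step_gt0)//; last 2 first.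
  - by move=> x _; rewrite lee_fin mulr_ge0.
  - apply/measurable_EFinP; apply: measurable_funM => //.
    by apply: measurable_indic; exact: measurable_level.
  congr (_ * _)%E; apply: eq_integral => x _.
  rewrite patchE indicE; case: (x \in level j); first by rewrite mulr1.
  by rewrite mulr0.
apply: eq_integral => x _; rewrite sumEFin /layered mulr_sumr.
by congr EFin; apply: eq_bigr => j _; rewrite mulrCA.
Qed.

Lemma layered_le_P (p : {poly R}) : (forall x, 0 <= p.[x]) ->
  \sum_(j < J) step * \int[leb]_(x in level j) p.[x] <= \int[P]_x p.[x].
Proof.
move=> p0; rewrite -lee_fin integral_layered//.
rewrite fineK; last by apply: integrable_fin_num => //; exact: integrable_horner.
rewrite (integral_density_real Prho)//; last exact: measurable_horner.
apply: ge0_le_integral => //.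
- by move=> x _; rewrite lee_fin mulr_ge0//; case: (layered_bounds x) => /andP[].
- apply/measurable_EFinP; apply: measurable_funM; first exact: measurable_horner.
  exact: measurable_layered.
- by apply/measurable_EFinP; apply: measurable_funM => //; exact: measurable_horner.
- move=> x _; rewrite lee_fin ler_wpM2l//.
  by case: (layered_bounds x) => /andP[].
Qed.

Definition core : set R := [set x | 2 * step < rho x].

Lemma measurable_core : measurable core.
Proof.
apply: is_interval_measurable.
exact: log_concave_levels (lcd_concave Prho) _.
Qed.

Lemma core_le_layered (p : {poly R}) : (forall x, 0 <= p.[x]) ->
  \int[P]_(x in core) p.[x] <=
  12 * \sum_(j < J) step * \int[leb]_(x in level j) p.[x].
Proof.
move=> p0; rewrite -lee_fin EFinM integral_layered//.
have mp : measurable_fun [set: R] (horner p) by exact: measurable_horner.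
have ml := measurable_layered.
have mc := measurable_core.
rewrite fineK; last first.
  apply: integrable_fin_num => //.
  by apply: integrableS (integrable_horner p mom).
rewrite integral_mkcond.
rewrite (_ : _ \_ core = EFin \o (fun x => p.[x] * \1_core x)); last first.
  apply/funext => x; rewrite patchE /= indicE.
  by case: (x \in core); rewrite ?mulr1 ?mulr0.
rewrite (integral_density_real Prho); last 2 first.
- by apply: measurable_funM => //; exact: measurable_indic.
- by move=> x; rewrite mulr_ge0.
rewrite -ge0_integralZl_EFin//; last 2 first.
- by move=> x _; rewrite lee_fin mulr_ge0//; case: (layered_bounds x) => /andP[].
- by apply/measurable_EFinP; exact: measurable_funM.
apply: ge0_le_integral => //.
- by move=> x _; rewrite lee_fin !mulr_ge0.
- apply/measurable_EFinP; apply: measurable_funM => //.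
  by apply: measurable_funM => //; exact: measurable_indic.
- by apply/measurable_EFinP; apply: measurable_funM => //; exact: measurable_funM.
- move=> x _; rewrite -EFinM lee_fin -mulrA [leRHS]mulrCA ler_wpM2l//.
  have [/andP[l0 _] h] := layered_bounds x.
  rewrite indicE; case: (boolP (x \in core)) => [|_].
    by rewrite inE mul1r => /h.
  by rewrite mul0r mulr_ge0.
Qed.

End LevelMixture.

(** * Laws on circles with a log-concave abscissa *)

Section Mixture.
Variable R : realType.
Local Notation leb := (@lebesgue_measure R).
Variables (P : probability R R) (rho : R -> R).
Hypothesis Prho : lc_density P rho.
Hypothesis mom : finite_moments P.
Variables (M t0 : R) (J : nat).
Hypothesis t0_gt0 : 0 < t0.
Hypothesis rho_leM : forall x, rho x <= M.
Hypothesis M_le : 3 * M <= 36 * t0.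
Hypothesis wide : forall a b, (forall x, t0 < rho x -> a <= x <= b) ->
  5 / 13 <= (b - a) ^+ 2.
Hypothesis J0 : (0 < J)%N.

Local Notation eta := (step t0 J).
Local Notation lev := (level rho t0 J).
Local Notation a_ := (lo rho t0 J).
Local Notation b_ := (hi rho t0 J).

Let centre j : R := (a_ j + b_ j) / 2.
Let radius j : R := (b_ j - a_ j) / 2.

(** Each layer is the uniform law on an interval, realized on the circles through
    the sphere that has this interval as a diameter: centre in the middle,
    radius half the length times [sqrt (1 - u^2)].  What is left of [P] sits at
    circles of radius [0]. *)
Definition mixture (phi : R * R -> R) : R :=
  \sum_(j < J) eta * (b_ j - a_ j) * \int[leb]_(u in `[0, 1])
    phi ((a_ j + b_ j) / 2, (b_ j - a_ j) / 2 * Num.sqrt (1 - u ^+ 2)) +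
  (\int[P]_x phi (x, 0) -
   \sum_(j < J) eta * \int[leb]_(x in lev j) phi (x, 0)).

Lemma polyclass2_continuous (phi : R * R -> R) c r : polyclass2 phi ->
  continuous (fun u : R => phi (c, r * Num.sqrt (1 - u ^+ 2))).
Proof.
elim=> [a|||f g _ cf _ cg|f g _ cf _ cg].
- exact: cst_continuous.
- exact: cst_continuous.
- by apply: continuous_scale; exact: continuous_sqrt_onem.
- exact: continuous_add.
- exact: continuous_mul.
Qed.

Lemma polyclass2_axis (phi : R * R -> R) : polyclass2 phi ->
  exists p : {poly R}, (fun x => phi (x, 0)) = horner p.
Proof.
elim=> [a|||f g _ [p pE] _ [q qE]|f g _ [p pE] _ [q qE]].
- by exists a%:P; apply/funext => x; rewrite hornerC.
- by exists 'X; apply/funext => x; rewrite hornerX.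
- by exists 0; apply/funext => x; rewrite horner0.
- exists (p + q); apply/funext => x; rewrite hornerD -pE -qE//.
- exists (p * q); apply/funext => x; rewrite hornerM -pE -qE//.
Qed.

Lemma linear_mixture : linear_on (@polyclass2 R) mixture.
Proof.
split=> [f g pf pg|c f pf]; rewrite /mixture.
  have [p pE] := polyclass2_axis pf; have [q qE] := polyclass2_axis pg.
  have fE x : f (x, 0) = p.[x] by rewrite -pE.
  have gE x : g (x, 0) = q.[x] by rewrite -qE.
  rewrite addrACA; congr (_ + _).
    rewrite -big_split/=; apply: eq_bigr => j _.
    by rewrite RintegralD_cont ?mulrDr//; exact: polyclass2_continuous.
  rewrite addrACA -opprD -big_split/=; congr (_ - _).
    under eq_Rintegral do rewrite fE gE.
    under [X in _ = X + _]eq_Rintegral do rewrite fE.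
    under [X in _ = _ + X]eq_Rintegral do rewrite gE.
    by rewrite RintegralD//; exact: integrable_horner.
  apply: eq_bigr => j _; rewrite -mulrDr; congr (_ * _).
  under eq_Rintegral do rewrite fE gE.
  under [X in _ = X + _]eq_Rintegral do rewrite fE.
  under [X in _ = _ + X]eq_Rintegral do rewrite gE.
  rewrite RintegralD//; first exact: (measurable_level Prho).
  - by apply: (integrable_level Prho t0_gt0 wide J0).
  - by apply: (integrable_level Prho t0_gt0 wide J0).
have [p pE] := polyclass2_axis pf.
have fE x : f (x, 0) = p.[x] by rewrite -pE.
rewrite mulrDr mulrBr; congr (_ + (_ - _)).
- rewrite mulr_sumr; apply: eq_bigr => j _.
  by rewrite RintegralZ_cont; [ring|exact: polyclass2_continuous].
- under eq_Rintegral do rewrite fE.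
  under [X in _ = _ * X]eq_Rintegral do rewrite fE.
  by rewrite RintegralZl//; exact: integrable_horner.
- rewrite mulr_sumr; apply: eq_bigr => j _; rewrite mulrCA; congr (_ * _).
  under eq_Rintegral do rewrite fE.
  under [X in _ = _ * X]eq_Rintegral do rewrite fE.
  rewrite RintegralZl//; first exact: (measurable_level Prho).
  by apply: (integrable_level Prho t0_gt0 wide J0).
Qed.

(** The remainder is positive because the layers lie below the density. *)
Lemma positive_mixture : positive_on (@polyclass2 R) mixture.
Proof.
move=> f pf f0; have [p pE] := polyclass2_axis pf.
have fE x : f (x, 0) = p.[x] by rewrite -pE.
rewrite addr_ge0//.
  apply: sumr_ge0 => j _; rewrite mulr_ge0//; last exact: Rintegral_ge0.
  rewrite mulr_ge0 ?subr_ge0 ?(ltW (step_gt0 t0_gt0 J0))//.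
  by have [/ltW] := level_width Prho t0_gt0 wide J0 (ltn_ord j).
rewrite subr_ge0; under eq_bigr do under eq_Rintegral do rewrite fE.
under [leRHS]eq_Rintegral do rewrite fE.
by apply: (layered_le_P Prho mom t0_gt0 rho_leM M_le wide J0) => x; rewrite -fE.
Qed.

Variable N' : nat.
Local Notation N := N'.+1.

Lemma interval_sphere_mean j (p : {poly R}) a : (j < J)%N ->
  sphere_mean N a (p \Po ((centre j)%:P + radius j *: 'X)) =
  \int[leb]_(u in `[0, 1]) ((1 - u ^+ 2) ^+ a * (N%:R^-1 * \sum_(q < N)
    p.[centre j + radius j * Num.sqrt (1 - u ^+ 2) * cos (grid R N q)])).
Proof.
move=> jJ; apply: eq_Rintegral => u _; congr (_ * (_ * _)); apply: eq_bigr => q _.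
by rewrite horner_comp; congr (_.[_]); rewrite !hornerE.
Qed.

Lemma size_affine_comp (p : {poly R}) (c r : R) :
  (size (p \Po (c%:P + r *: 'X)) <= size p)%N.
Proof.
have [->|] := eqVneq p 0; first by rewrite comp_poly0 size_poly0.
rewrite -size_poly_gt0 => p0; rewrite (leq_trans (size_comp_poly_leq _ _))//.
have : (size (c%:P + r *: 'X : {poly R})%R <= 2)%N.
  rewrite (leq_trans (size_polyD _ _))// geq_max.
  rewrite (leq_trans (size_polyC_leq1 _))// (leq_trans (size_scale_leq _ _))//.
  by rewrite size_polyX.
case: (size _) => [|[|[|//]]] _; rewrite /= ?muln0 ?muln1//.
by rewrite prednK.
Qed.

Lemma level_sphere_mean j (p : {poly R}) : (j < J)%N -> (size p <= N)%N ->
  (b_ j - a_ j) * sphere_mean N 0 (p \Po ((centre j)%:P + radius j *: 'X)) =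
  \int[leb]_(x in lev j) p.[x].
Proof.
move=> jJ pN; have [ab _] := level_width Prho t0_gt0 wide J0 jJ.
rewrite (Rintegral_level Prho t0_gt0 wide J0)// Rintegral_affine//.
rewrite sphere_mean0; last exact: leq_trans (size_affine_comp _ _ _) pN.
by rewrite /centre /radius mulrA.
Qed.

(** The angular means of the layers are restored to the layers by Archimedes'
    theorem, and the two occurrences of the layers cancel. *)
Lemma mixture_mean (p : {poly R}) : (size p <= N)%N ->
  circle_mean (N' := N') mixture (fun z => p.[abscissa z]) = \int[P]_x p.[x].
Proof.
move=> pN; rewrite /circle_mean /mixture /abscissa/=.
have axis x : N%:R^-1 * (\sum_(q < N) p.[x + 0 * cos (grid R N q)]) = p.[x].
  under eq_bigr do rewrite mul0r addr0.
  by rewrite sumr_const card_ord -[p.[x] *+ _]mulr_natl mulKf// pnatr_eq0.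
under [X in _ + (X - _)]eq_Rintegral do rewrite axis.
under [X in _ + (_ - X)]eq_bigr do under eq_Rintegral do rewrite axis.
rewrite [X in X + _](_ : _ = \sum_(j < J) eta * \int[leb]_(x in lev j) p.[x]).
  by rewrite addrC subrK.
apply: eq_bigr => j _; rewrite -mulrA; congr (_ * _).
rewrite -(level_sphere_mean (ltn_ord j) pN) interval_sphere_mean//.
congr (_ * _); apply: eq_Rintegral => u _; rewrite expr0 mul1r//.
Qed.

(** In a layer [y = r sqrt (1 - u^2) sin t].  Averaging over [t] costs [kappa^a],
    averaging over [u] costs [2^-a], and [r^2 >= 5 / 52] is a quarter of
    the lower bound for the squared length. *)
Lemma mixture_weight kappa N0 (p : {poly R}) a : (0 < a)%N ->
  ((size p).-1 + a.*2 < N)%N -> ((size p).-1 + a.*2 < N0)%N -> 0 <= kappa ->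
  (forall q, kappa <= sin (grid R N0 q) ^+ 2) -> (forall x, 0 <= p.[x]) ->
  (kappa * (5 / 104)) ^+ a *
    (\sum_(j < J) eta * \int[leb]_(x in lev j) p.[x]) <=
  circle_mean (N' := N') mixture (fun z => ordinate z ^+ a.*2 * p.[abscissa z]).
Proof.
move=> a0 pN pN0 k0 kN0 p0.
have pN' : (size p <= N)%N.
  rewrite (leq_trans (leqSpred _))// ltnS -ltnS.
  exact: leq_ltn_trans (leq_addr _ _) pN.
rewrite /circle_mean /mixture /ordinate /abscissa/=.
have axis x : N%:R^-1 * (\sum_(q < N) (0 * sin (grid R N q)) ^+ a.*2 *
    p.[x + 0 * cos (grid R N q)]) = 0.
  rewrite big1 ?mulr0// => q _; rewrite mul0r expr0n.
  by rewrite double_eq0 eqn0Ngt a0 mul0r.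
under [X in _ <= _ + (X - _)]eq_Rintegral do rewrite axis.
under [X in _ <= _ + (_ - X)]eq_bigr do under eq_Rintegral do rewrite axis.
rewrite [X in _ <= _ + X](_ : _ = 0) ?addr0; last first.
  rewrite big1 ?subr0; first by rewrite /Rintegral integral0.
  by move=> j _; rewrite /Rintegral integral0 mulr0.
rewrite mulr_sumr; apply: ler_sum => j _.
have [ab w] := level_width Prho t0_gt0 wide J0 (ltn_ord j).
have ab0 : 0 <= b_ j - a_ j by rewrite subr_ge0 ltW.
rewrite -(level_sphere_mean (ltn_ord j) pN') mulrCA -mulrA ler_wpM2l//.
  by rewrite ltW// step_gt0.
rewrite mulrCA ler_wpM2l//.
set q_ := _ \Po _.
have q0 x : 0 <= q_.[x] by rewrite horner_comp.
have qN : (size q_ <= N)%N by exact: leq_trans (size_affine_comp _ _ _) pN'.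
have r2 : 5 / 52 <= radius j ^+ 2.
  rewrite /radius expr_div_n ler_pdivlMr ?exprn_gt0//.
  by apply: le_trans w; lra.
apply: (@le_trans _ _ ((kappa * radius j ^+ 2) ^+ a * sphere_mean N a q_)).
  apply: (@le_trans _ _ ((kappa * radius j ^+ 2) ^+ a * (2^-1 ^+ a * sphere_mean N 0 q_))).
    rewrite [leRHS]mulrA -exprMn ler_wpM2r//.
      rewrite sphere_mean0// mulr_ge0 ?invr_ge0//.
      by apply: Rintegral_ge0.
    rewrite lerXn2r ?nnegrE ?mulr_ge0 ?sqr_ge0 ?invr_ge0//.
    by rewrite -mulrA ler_wpM2l//; lra.
  rewrite ler_wpM2l ?exprn_ge0 ?mulr_ge0 ?sqr_ge0//.
  exact: sphere_mean_ge.
rewrite interval_sphere_mean//.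
have cs : continuous (fun u : R => Num.sqrt (1 - u ^+ 2)) by exact: continuous_sqrt_onem.
have cg (F : 'I_N -> R -> R) : (forall q, continuous (F q)) ->
    continuous (fun u : R => N%:R^-1 * \sum_(q < N) F q u).
  by move=> cF; apply: continuous_scale; exact: continuous_sum.
have cp q : continuous (fun u : R =>
    p.[centre j + radius j * Num.sqrt (1 - u ^+ 2) * cos (grid R N q)]).
  apply: continuous_horner_comp; apply: continuous_add; first exact: cst_continuous.
  apply: continuous_mul; last exact: cst_continuous.
  exact: continuous_scale.
have cl : continuous (fun u : R => (1 - u ^+ 2) ^+ a * (N%:R^-1 * \sum_(q < N)
    p.[centre j + radius j * Num.sqrt (1 - u ^+ 2) * cos (grid R N q)])).
  apply: continuous_mul; last exact: (cg _ cp).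
  by apply: continuous_expn; exact: continuous_onem_sqr.
rewrite -RintegralZ_cont//.
apply: le_Rintegral => //.
- by apply: continuous_integrable; exact: continuous_scale.
- apply: continuous_integrable.
  apply: (cg (fun q u => (radius j * Num.sqrt (1 - u ^+ 2) * sin (grid R N q)) ^+ a.*2 *
    p.[centre j + radius j * Num.sqrt (1 - u ^+ 2) * cos (grid R N q)])) => q.
  apply: continuous_mul => //; apply: continuous_expn.
  by apply: continuous_mul; [exact: continuous_scale|exact: cst_continuous].
move=> u; rewrite /= in_itv/= => /andP[u0 u1].
have t1 : 0 <= 1 - u ^+ 2 by rewrite subr_ge0 expr_le1.
set s := radius j * Num.sqrt (1 - u ^+ 2).
have h := grid_mean_weight (centre j) s pN pN0 k0 kN0 p0.
have s2 : s ^+ 2 = radius j ^+ 2 * (1 - u ^+ 2) by rewrite /s exprMn sqr_sqrtr.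
apply: (@le_trans _ _ (N%:R^-1 * ((s ^+ 2) ^+ a * (kappa ^+ a *
    \sum_(q < N) p.[centre j + s * cos (grid R N q)])))).
  rewrite s2; move: (radius j ^+ 2) => rr; rewrite !exprMn; set S := \sum_(q < N) _; set A := (1 - u ^+ 2) ^+ a.
  set B := rr ^+ a; set K := kappa ^+ a; set v := N%:R^-1.
  by rewrite (_ : K * B * (A * (v * S)) = v * (B * A * (K * S)))//; ring.
rewrite ler_wpM2l ?invr_ge0//.
under [leRHS]eq_bigr do rewrite exprMn -mulrA.
have sa : s ^+ a.*2 = (s ^+ 2) ^+ a by rewrite -mul2n exprM.
by rewrite -mulr_sumr sa ler_wpM2l// exprn_ge0// sqr_ge0.
Qed.

(** Compared with the integral against [P], the part where the rounding of the
    layers is not negligible with respect to the density is left out. *)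
Definition core_mean (phi : R -> R) : R :=
  \int[P]_(x in core rho t0 J) phi x.

Lemma linear_core_mean D : linear_on (@polyclass R D) core_mean.
Proof.
have mc := measurable_core Prho t0 J.
have ic (p : {poly R}) : P.-integrable (core rho t0 J) (EFin \o horner p).
  by apply: integrableS (integrable_horner p mom).
split=> [f g [p _ ->] [q _ ->]|c f [p _ ->]]; rewrite /core_mean.
  by rewrite RintegralD.
by rewrite RintegralZl.
Qed.

Lemma positive_core_mean D : positive_on (@polyclass R D) core_mean.
Proof. by move=> f _ f0; exact: Rintegral_ge0. Qed.

(** The factor [1 / 12] lost on the core is paid with one of the [a] factors [K].
    For [a = 0] there is no such factor, but there the whole mixture is
    available and has mean [P]. *)
Lemma mixture_weight_core kappa N0 D a phi :
  (D + a.*2 < N)%N -> (D + a.*2 < N0)%N -> 0 <= kappa ->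
  (forall q, kappa <= sin (grid R N0 q) ^+ 2) ->
  polyclass D phi -> (forall x, 0 <= phi x) ->
  (kappa * (5 / 1248)) ^+ a * core_mean phi <=
  circle_mean (N' := N') mixture (fun z => ordinate z ^+ a.*2 * phi (abscissa z)).
Proof.
move=> DN DN0 k0 kN0 [p pD ->] p0.
have pD' : ((size p).-1 <= D)%N by case: (size p) pD.
have pN : ((size p).-1 + a.*2 < N)%N by apply: leq_ltn_trans DN; rewrite leq_add2r.
have pN0 : ((size p).-1 + a.*2 < N0)%N by apply: leq_ltn_trans DN0; rewrite leq_add2r.
have core0 : 0 <= core_mean (horner p) by exact: Rintegral_ge0.
have [->|a0] := posnP a.
  rewrite expr0 mul1r double0.
  have -> : (fun z => ordinate z ^+ 0 * p.[abscissa z]) =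
      (fun z : R * R * 'I_N => p.[abscissa z]).
    by apply/funext => z; rewrite expr0 mul1r.
  rewrite mixture_mean; last first.
    rewrite (leq_trans (leqSpred _))// ltnS -ltnS.
    exact: leq_ltn_trans (leq_addr _ _) pN.
  have mc := measurable_core Prho t0 J.
  have ic := integrableS measurableT mc (@subsetT _ _) (integrable_horner p mom).
  rewrite -lee_fin /core_mean /Rintegral !fineK; last 2 first.
  - by apply: integrable_fin_num => //; exact: integrable_horner.
  - exact: integrable_fin_num.
  apply: ge0_subset_integral => //.
    by apply/measurable_EFinP; exact: measurable_horner.
  by move=> x _; rewrite lee_fin.
apply: le_trans (mixture_weight a0 pN pN0 k0 kN0 p0).
have -> : kappa * (5 / 1248) = kappa * (5 / 104) * 12^-1 by field.
rewrite exprMn -mulrA ler_wpM2l ?exprn_ge0 ?mulr_ge0//.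
have h := core_le_layered Prho mom t0_gt0 rho_leM M_le wide J0 p0.
rewrite (@le_trans _ _ (12^-1 * core_mean (horner p)))//.
  rewrite ler_wpM2r// -[leRHS]expr1 ler_wiXn2l//; lra.
by rewrite ler_pdivrMl.
Qed.

End Mixture.

(** * Isotropy and exhaustion by cores *)

Section Isotropic.
Variable R : realType.
Local Notation leb := (@lebesgue_measure R).

(** The second moment about [x0] is [1 + x0^2]. *)
Lemma isotropic_spread (P : probability R R) x0 : finite_moments P -> isotropic P ->
  (1 <= \int[P]_x ((x - x0) ^+ 2)%:E)%E.
Proof.
move=> mom [E0 V1].
have lin := linear_on_Rintegral 2 mom.
have c k : (k <= 2)%N -> polyclass 2 (fun x : R => x ^+ k) by exact: polyclass_exp.
have fin k : (\int[P]_x (x ^+ k)%:E \is a fin_num)%E.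
  by apply: integrable_fin_num => //; exact: mom.
have m1 : \int[P]_x x ^+ 1 = 0.
  by rewrite /Rintegral; move: E0; rewrite unlock => ->.
have m2 : \int[P]_x x ^+ 2 = 1.
  move: V1; rewrite /variance unlock E0/= unlock /Rintegral => V1.
  rewrite -[RHS]/(fine 1%:E) -V1; congr fine; apply: eq_integral => x _.
  by congr EFin; rewrite expr2 -{1 2}[x]subr0.
have m0 : \int[P]_x x ^+ 0 = 1.
  rewrite /Rintegral; under eq_integral do rewrite expr0.
  by rewrite integral_cst// mul1e; exact: congr1 (probability_setT P).
have -> : (fun x : R => ((x - x0) ^+ 2)%:E) =
    EFin \o (fun x => x ^+ 2 + ((- (2 * x0)) * x ^+ 1 + x0 ^+ 2 * x ^+ 0)).
  by apply/funext => x /=; congr EFin; ring.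
set g := (X in EFin \o X).
have lc := @linear_polyclass R 2.
have g1 : polyclass 2 (fun x : R => - (2 * x0) * x ^+ 1) by apply: (lcZ lc); exact: c.
have g0 : polyclass 2 (fun x : R => x0 ^+ 2 * x ^+ 0) by apply: (lcZ lc); exact: c.
have g10 := lcD lc g1 g0.
have gp : polyclass 2 g by apply: (lcD lc) => //; exact: c.
have -> : (\int[P]_x (EFin \o g) x = (\int[P]_x g x)%:E)%E.
  rewrite /Rintegral fineK//; have [p _ ->] := gp.
  by apply: integrable_fin_num => //; exact: integrable_horner.
rewrite (loD lin)//; last exact: c.
rewrite (loD lin)// !(loZ lin); try exact: c.
rewrite m0 m1 m2 mulr0 add0r mulr1 lee_fin lerDl; exact: sqr_ge0.
Qed.

Lemma density_gt0_ae (P : probability R R) rho : lc_density P rho ->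
  {ae P, forall x, 0 < rho x}.
Proof.
move=> Prho; have mA : measurable [set x | 0 < rho x].
  apply: is_interval_measurable.
  exact: (log_concave_levels (lcd_ge0 Prho) (lcd_concave Prho)).
exists (~` [set x | 0 < rho x]); split=> //.
  exact: measurableC.
apply: eq_trans (lcd_density Prho (measurableC mA)) _.
apply: integral0_eq => x /= /negP; rewrite -leNgt => h.
by congr EFin; apply/eqP; rewrite eq_le h (lcd_ge0 Prho).
Qed.

(** Dominated convergence: a point of positive density belongs to the core as soon
    as the step is small, and the density is positive almost surely. *)
Lemma core_mean_cvg (P : probability R R) rho t0 (p : {poly R}) :
  lc_density P rho -> finite_moments P -> 0 < t0 ->
  core_mean P rho t0 J.+1 (horner p) @[J --> \oo] --> \int[P]_x p.[x].
Proof.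
move=> Prho mom t00.
have ip := integrable_horner p mom.
pose f_ J := ((EFin \o horner p) \_ (core rho t0 J.+1)).
have mf J : measurable_fun [set: R] (f_ J).
  apply/(measurable_restrictT _ _).1; first exact: (measurable_core Prho).
  apply: measurable_funTS; apply/measurable_EFinP; exact: measurable_horner.
have ptw : {ae P, forall x, [set: R] x -> f_ ^~ x @ \oo --> (EFin \o horner p) x}.
  apply: filterS (density_gt0_ae Prho) => x rx _.
  apply: cvg_near_cst; near=> J; rewrite /f_ patchE mem_set//= /core/=.
  rewrite /step mulrA ltr_pdivrMr// -ltr_pdivrMl//.
  apply: (@lt_le_trans _ _ J%:R); last by rewrite ler_nat.
  by near: J; exact: nbhs_infty_gtr.
have dom : {ae P, forall x J, [set: R] x ->
    (`|f_ J x| <= (abse \o (EFin \o horner p)) x)%E}.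
  by apply: aeW => x J _; rewrite /f_ patchE; case: ifP => // _; rewrite abse0 abse_ge0.
have [_ _ cv] := dominated_convergence measurableT mf (measurable_int _ ip) ptw
  (integrable_abse ip) dom.
rewrite /core_mean /Rintegral.
under eq_fun do rewrite integral_mkcond.
apply: fine_cvg.
rewrite fineK//; exact: integrable_fin_num.
Unshelve. all: end_near.
Qed.
End Isotropic.

(** * Moments of the gradient *)

Section ArcModels.
Variable R : realType.

(** What the product inequality needs to know about one marginal: a functional
    [lam] on circles whose abscissa has law [P], and the functional [E] to which
    it is compared. *)
Record arc_model (P : probability R R) (lam : (R * R -> R) -> R)
    (E : (R -> R) -> R) : Prop := ArcModel {
  am_linear : linear_on (@polyclass2 R) lam;
  am_positive : positive_on (@polyclass2 R) lam;
  am_linear_core D : linear_on (@polyclass R D) E;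
  am_positive_core D : positive_on (@polyclass R D) E;
  am_mean N' (p : {poly R}) : (size p <= N'.+1)%N ->
    circle_mean (N' := N') lam (fun z => p.[abscissa z]) = \int[P]_x p.[x];
  am_weight N' kappa N0 D a phi :
    (D + a.*2 < N'.+1)%N -> (D + a.*2 < N0)%N -> 0 <= kappa ->
    (forall q, kappa <= sin (grid R N0 q) ^+ 2) ->
    polyclass D phi -> (forall x, 0 <= phi x) ->
    (kappa * (5 / 1248)) ^+ a * E phi <=
    circle_mean (N' := N') lam (fun z => ordinate z ^+ a.*2 * phi (abscissa z)) }.

Lemma exists_arc_models (P : probability R R) : isotropic P -> log_concave P ->
  finite_moments P /\ exists lam E,
    (forall J, arc_model P (lam J) (E J)) /\
    (forall p : {poly R}, E J (horner p) @[J --> \oo] --> \int[P]_x p.[x]).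
Proof.
move=> isoP /log_concave_density[rho Prho].
have mom := lc_density_moments Prho.
have [M [t0 [t00 rM Mt wide]]] :=
  level_geometry Prho (fun x0 => isotropic_spread x0 mom isoP).
split=> //.
exists (fun J => mixture P rho t0 J.+1), (fun J => core_mean P rho t0 J.+1).
split=> [J|p]; last exact: core_mean_cvg.
split.
- exact: (linear_mixture Prho mom t00 wide (ltn0Sn J)).
- exact: (positive_mixture Prho mom t00 rM Mt wide (ltn0Sn J)).
- by move=> D; exact: linear_core_mean.
- by move=> D; exact: positive_core_mean.
- by move=> N' p; exact: (mixture_mean Prho t00 wide (ltn0Sn J)).
- move=> N' kappa N0 D a phi.
  exact: (mixture_weight_core Prho mom t00 rM Mt wide (ltn0Sn J)).
Qed.

Lemma cvg_bigprod (I : Type) (r : seq I) (u : I -> nat -> R) (l : I -> R) :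
  (forall i, u i J @[J --> \oo] --> l i) ->
  \prod_(i <- r) u i J @[J --> \oo] --> \prod_(i <- r) l i.
Proof.
move=> ul; elim: r => [|i r IHr].
  by rewrite big_nil; under eq_fun do rewrite big_nil; exact: cvg_cst.
by rewrite big_cons; under eq_fun do rewrite big_cons; exact: cvgM.
Qed.

Lemma cvg_bigsum (I : Type) (r : seq I) (u : I -> nat -> R) (l : I -> R) :
  (forall i, u i J @[J --> \oo] --> l i) ->
  \sum_(i <- r) u i J @[J --> \oo] --> \sum_(i <- r) l i.
Proof.
move=> ul; elim: r => [|i r IHr].
  by rewrite big_nil; under eq_fun do rewrite big_nil; exact: cvg_cst.
by rewrite big_cons; under eq_fun do rewrite big_cons; exact: cvgD.
Qed.

Lemma iterE_meval_cvg n D (E : nat -> 'I_n -> (R -> R) -> R)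
    (M : 'I_n -> (R -> R) -> R) (h : mpoly n R) :
  (forall J i, linear_on (@polyclass R D) (E J i)) ->
  (forall i, linear_on (@polyclass R D) (M i)) -> degree_le D h ->
  (forall i a, E J i (fun x => x ^+ a) @[J --> \oo] --> M i (fun x => x ^+ a)) ->
  iterE (E J) (fun t => meval t h) @[J --> \oo] --> iterE M (fun t => meval t h).
Proof.
move=> linE linM hD EM; rewrite (iterE_meval linM hD).
under eq_fun do rewrite (iterE_meval (linE _) hD).
apply: (@cvg_bigsum _ _ (fun m J => mcoeff m h * \prod_i E J i (fun x => x ^+ m i))).
move=> m; apply: cvgMr; apply: (@cvg_bigprod _ _ (fun i J => _)) => i; exact: EM.
Qed.

Lemma degree_le_sum n D (I : finType) (F : I -> mpoly n R) :
  (forall i, degree_le D (F i)) -> degree_le D (\sum_i F i).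
Proof.
move=> FD; apply: (big_ind (degree_le D)) => // [|f g fD gD].
  by rewrite /degree_le msize0.
by rewrite /degree_le (leq_trans (msizeD_le _ _))// geq_max fD.
Qed.

(** The squared length of the gradient, as a polynomial. *)
Definition grad_sq n (f : mpoly n R) : mpoly n R := \sum_i mderiv i f ^+ 2.

Lemma meval_grad_sq n (f : mpoly n R) t :
  meval t (grad_sq f) = \sum_i meval t (mderiv i f) ^+ 2.
Proof.
by rewrite /grad_sq raddf_sum/=; apply: eq_bigr => i _; rewrite rmorphXn.
Qed.

Lemma degree_le_grad_sq n d (f : mpoly n R) :
  degree_le d f -> degree_le d.-1.*2 (grad_sq f).
Proof.
move=> fd; apply: degree_le_sum => i; rewrite -mul2n.
by apply: degree_leX; exact: degree_le_deriv.
Qed.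

(** The product inequality for the models with step tending to [0]; on the left
    hand side the moments of the cores tend to those of the [mu i].  The grid
    has [4 d k] nodes, a multiple of [4 d] above all the degrees. *)
Lemma gradient_moment_le n d k (mu : 'I_n -> probability R R) (f : mpoly n R)
    N0 kappa : (0 < d)%N -> (0 < k)%N ->
  (forall i, isotropic (mu i) /\ log_concave (mu i)) -> degree_le d f ->
  ((k * d).*2 < N0)%N -> 0 <= kappa ->
  (forall q, kappa <= sin (grid R N0 q) ^+ 2) ->
  (kappa * (5 / 1248)) ^+ k *
    iterE (fun i phi => \int[mu i]_x phi x) (fun t => meval t (grad_sq f ^+ k)) <=
  d%:R ^+ k.*2 *
    iterE (fun i phi => \int[mu i]_x phi x) (fun t => meval t (f ^+ k.*2)).
Proof.
move=> d0 k0 ilc fd N0k kap0 kapN0.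
have arc i := exists_arc_models (proj1 (ilc i)) (proj2 (ilc i)).
have mom i : finite_moments (mu i) := proj1 (arc i).
have [lam /choice[E models]] := choice (fun i => proj2 (arc i)).
have model i J : arc_model (mu i) (lam i J) (E i J) := proj1 (models i) J.
have lim i p : E i J (horner p) @[J --> \oo] --> \int[mu i]_x p.[x].
  exact: (proj2 (models i)).
pose D := (k * d.-1).*2.
have hD : degree_le D (grad_sq f ^+ k).
  rewrite /D doubleMr; apply: degree_leX; exact: degree_le_grad_sq.
have bound J : (kappa * (5 / 1248)) ^+ k *
    iterE (fun i => E i J) (fun t => meval t (grad_sq f ^+ k)) <=
  d%:R ^+ k.*2 *
    iterE (fun i phi => \int[mu i]_x phi x) (fun t => meval t (f ^+ k.*2)).
  have -> : (fun t => meval t (grad_sq f ^+ k)) =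
      (fun t => (\sum_i meval t (mderiv i f) ^+ 2) ^+ k).
    by apply/funext => t; rewrite rmorphXn/= meval_grad_sq.
  have -> : (fun t => meval t (f ^+ k.*2)) = (fun t => meval t f ^+ k.*2).
    by apply/funext => t; rewrite rmorphXn.
  have [N' N4] : exists N', N'.+1 = (4 * d * k)%N.
    by exists (4 * d * k).-1; rewrite prednK// !muln_gt0 d0 k0.
  have N4k : ((k * d).*2 < 4 * d * k)%N.
    by rewrite -mulnA (mulnC d k) -mul2n ltn_pmul2r ?muln_gt0 ?d0 ?k0.
  have Da a : (a <= k)%N -> (D + a.*2 <= (k * d).*2)%N.
    move=> ak; rewrite /D -doubleD leq_double.
    by rewrite -{2}(prednK d0) mulnS addnC leq_add2r.
  have K0 : 0 <= kappa * (5 / 1248) by apply: mulr_ge0; [exact: kap0|lra].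
  refine (product_inequality d0 N4 K0 (lam := fun i => lam i J)
    (M := fun i phi => \int[mu i]_x phi x) (E := fun i => E i J) _ _ _ _ _ _ fd).
  - by move=> i; exact: am_linear (model i J).
  - by move=> i; exact: am_positive (model i J).
  - move=> i phi [p pD ->]; rewrite (am_mean (model i J))//.
    rewrite N4 (leq_trans pD)// (leq_trans _ N4k)// ltnS.
    by rewrite doubleMl.
  - by move=> i; exact: am_linear_core (model i J) _.
  - by move=> i; exact: am_positive_core (model i J) _.
  - move=> i a phi ak pD p0; apply: (am_weight (model i J) _ _ kap0 kapN0 pD p0).
      by rewrite N4; exact: leq_ltn_trans (Da _ ak) N4k.
    exact: leq_ltn_trans (Da _ ak) N0k.
have cv := @iterE_meval_cvg n D (fun J i => E i J)
  (fun i phi => \int[mu i]_x phi x) (grad_sq f ^+ k).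
have {}cv := cv (fun J i => am_linear_core (model i J) D)
  (fun i => linear_on_Rintegral D (mom i)) hD.
have {}cv : (fun J => (kappa * (5 / 1248)) ^+ k *
    iterE (fun i => E i J) (fun t => meval t (grad_sq f ^+ k))) @ \oo -->
    (kappa * (5 / 1248)) ^+ k *
    iterE (fun i phi => \int[mu i]_x phi x) (fun t => meval t (grad_sq f ^+ k)).
  apply: cvgMr; apply: cv => i a.
  have -> : (fun x : R => x ^+ a) = horner 'X^a by apply/funext => x; rewrite hornerXn.
  exact: lim.
apply: (cvgr_to_le cv).
by apply: nearW => J; exact: bound.
Qed.

End ArcModels.

(** * Numerical constants *)

Section Constants.
Variable R : realType.

Definition bernstein_constant (k : nat) : R :=
  if k == 1%N then 24 else 736 * k%:R ^+ 3.

Lemma bernstein_constant_gt0 k : (0 < k)%N -> 0 < bernstein_constant k.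
Proof.
move=> k0; rewrite /bernstein_constant; case: ifP => _; first by lra.
apply: mulr_gt0; first by lra.
by rewrite exprn_gt0// ltr0n.
Qed.

Lemma bernstein_constant_sqr k : (0 < k)%N ->
  576 * k%:R ^+ 2 <= bernstein_constant k ^+ 2.
Proof.
move=> k0; rewrite /bernstein_constant; have [->|k1] := eqVneq k 1%N; first by lra.
have k2 : 2 <= k%:R :> R by rewrite ler_nat ltn_neqAle eq_sym k1.
have -> : (736 * k%:R ^+ 3) ^+ 2 = (736 * k%:R ^+ 2) ^+ 2 * k%:R ^+ 2 :> R by ring.
apply: ler_wpM2r; first exact: sqr_ge0.
have : 24 <= 736 * k%:R ^+ 2 :> R by nra.
move: (736 * _) => u u24; nra.
Qed.

(** For [k d >= 2] take [kappa = 1 / (k d + 1)^2] and bound [k d + 1] by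
    [(3/2) k d]; the requirement becomes [1248 * 9 / 4 <= 5 * 576].
    For [k = d = 1] that bound fails, but on four nodes [kappa = 1 / 2]. *)
Lemma exists_angular_weight k d : (0 < k)%N -> (0 < d)%N ->
  exists N0 (kappa : R), [/\ ((k * d).*2 < N0)%N, 0 < kappa,
    forall q, kappa <= sin (grid R N0 q) ^+ 2 &
    1 <= kappa * (5 / 1248) * (bernstein_constant k * d%:R) ^+ 2].
Proof.
move=> k0 d0.
have kd0 : (0 < k * d)%N by rewrite muln_gt0 k0.
have dsq : 1 <= d%:R ^+ 2 :> R by apply: exprn_ege1; rewrite ler1n.
have ksq : 1 <= k%:R ^+ 2 :> R by apply: exprn_ege1; rewrite ler1n.
rewrite exprMn; set C := bernstein_constant k ^+ 2.
have [kd1|kd1] := eqVneq (k * d)%N 1%N.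
  exists 4%N, 2^-1; split.
  - by rewrite kd1.
  - by rewrite invr_gt0 ltr0n.
  - by move=> q; rewrite sin_grid4.
  - have hC : 576 * k%:R ^+ 2 <= C := bernstein_constant_sqr k0.
    have c0 : 576 <= C by lra.
    have : 576 <= C * d%:R ^+ 2; [nra|lra].
have kd2 : 2 <= k%:R * d%:R :> R.
  by rewrite -natrM ler_nat; move: (k * d)%N kd0 kd1 => [|[]].
exists (k * d).+1.*2, (((k * d).+1%:R ^+ 2)^-1); split.
- by rewrite ltn_double.
- by rewrite invr_gt0 exprn_gt0// ltr0n.
- by move=> q; exact: sin_grid_ge.
- have t0 : 0 < (k * d).+1%:R ^+ 2 :> R by rewrite exprn_gt0// ltr0n.
  rewrite -mulrA ler_pdivlMl// mulr1 -[_.+1%:R]natr1 natrM.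
  have hs : (k%:R * d%:R + 1) ^+ 2 <= 9 / 4 * (k%:R ^+ 2 * d%:R ^+ 2) :> R.
    by rewrite -exprMn; nra.
  have hC : 576 * k%:R ^+ 2 <= C := bernstein_constant_sqr k0.
  have d2 : 0 <= d%:R ^+ 2 :> R by exact: sqr_ge0.
  have hd := ler_wpM2r d2 hC.
  have q0 : 0 <= k%:R ^+ 2 * d%:R ^+ 2 :> R by rewrite mulr_ge0// sqr_ge0.
  lra.
Qed.

End Constants.

(** * Comparison of norms *)

Section EvenNorms.
Variable R : realType.
Variables (n : nat) (mu : 'I_n -> probability R R).
Hypothesis mom : forall i, finite_moments (mu i).

(** An even power of [g] that is a polynomial makes the norm a root of a moment. *)
Lemma Lnorm_even_poly k (g : n.-tuple R -> R) (h : mpoly n R) : (0 < k)%N ->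
  (forall x, g x ^+ k.*2 = peval h x) ->
  ('N[prod_probability mu]_((2 * k)%N%:R%:E) [EFin \o g] =
   (iterE (fun i phi => \int[mu i]_x phi x) (fun t => meval t h) `^
     ((2 * k)%N%:R)^-1)%:E)%E.
Proof.
move=> k0 gh; rewrite unlock /Lnorm.
rewrite (_ : (\int[_]_x _)%E = (\int[prod_probability mu]_x (peval h x)%:E)%E).
  by rewrite integral_prod_peval.
apply: eq_integral => x _; rewrite /comp abse_EFin poweR_EFin powR_mulrn//.
by congr EFin; rewrite -gh mul2n -[LHS]normrX ger0_norm// -mul2n exprM exprn_ge0// sqr_ge0.
Qed.

End EvenNorms.

Section RootComparison.
Variable R : realType.

Lemma root_le (a b c : R) m : (0 < m)%N -> 0 <= a -> 0 <= b -> 0 <= c ->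
  a <= c ^+ m * b -> a `^ (m%:R)^-1 <= c * b `^ (m%:R)^-1.
Proof.
move=> m0 a0 b0 c0 ab; have m1 : 0 <= (m%:R : R)^-1 by rewrite invr_ge0.
apply: le_trans (ge0_ler_powR m1 _ _ ab) _.
- by rewrite nnegrE.
- by rewrite nnegrE mulr_ge0// exprn_ge0.
rewrite powRM ?exprn_ge0// -powR_mulrn// -powRrM mulfV ?powRr1//.
by rewrite pnatr_eq0 -lt0n.
Qed.

End RootComparison.

Theorem corollary1p7 (R : realType) :
  exists C : nat -> R,
    [/\ forall k : nat, (1 <= k)%N -> 0 < C k,
        C 1%N = 24,
        forall k : nat, (2 <= k)%N -> C k = 736 * k%:R ^+ 3
      & forall k : nat, (1 <= k)%N ->
        forall n d : nat, (1 <= n)%N -> (1 <= d)%N ->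
        forall mu : 'I_n -> probability R R,
        (forall i, isotropic (mu i) /\ log_concave (mu i)) ->
        forall f : mpoly n R, degree_le d f ->
        ('N[prod_probability mu]_((2 * k)%N%:R%:E) [EFin \o grad_norm f]
         <= (C k * d%:R ^+ 2)%:E *
            'N[prod_probability mu]_((2 * k)%N%:R%:E) [EFin \o peval f])%E].
Proof.
exists (bernstein_constant R); split.
- exact: bernstein_constant_gt0.
- by rewrite /bernstein_constant eqxx.
- move=> k k2; rewrite /bernstein_constant ifF//.
  by apply/negbTE; rewrite gtn_eqF.
move=> k k0 n d _ d0 mu ilc f fd.
have mom i : finite_moments (mu i).
  by have [iso lc] := ilc i; case: (exists_arc_models iso lc).
have gradE x : grad_norm f x ^+ k.*2 = peval (grad_sq f ^+ k) x.
  rewrite /grad_norm -mul2n exprM sqr_sqrtr; last by apply: sumr_ge0 => i _; exact: sqr_ge0.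
  by rewrite /peval rmorphXn/= meval_grad_sq.
have fE x : peval f x ^+ k.*2 = peval (f ^+ k.*2) x by rewrite /peval rmorphXn.
rewrite (Lnorm_even_poly mom k0 gradE) (Lnorm_even_poly mom k0 fE).
have [N0 [kappa [N0k kap0 kapN0 kapC]]] := exists_angular_weight R k0 d0.
have := gradient_moment_le d0 k0 ilc fd N0k (ltW kap0) kapN0.
set a := iterE _ _; set b := iterE _ _ => ab.
have pos (h : mpoly n R) : (forall x, 0 <= peval h x) ->
    0 <= iterE (fun i phi => \int[mu i]_x phi x) (fun t => meval t h).
  move=> h0; rewrite -lee_fin -integral_prod_peval//.
  by apply: integral_ge0 => x _; rewrite lee_fin.
have a0 : 0 <= a.
  by apply: pos => x; rewrite -gradE -mul2n exprM exprn_ge0// sqr_ge0.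
have b0 : 0 <= b.
  by apply: pos => x; rewrite -fE -mul2n exprM exprn_ge0// sqr_ge0.
rewrite -EFinM lee_fin; apply: root_le => //.
- by rewrite mul2n double_gt0.
- apply: mulr_ge0; [exact: ltW (bernstein_constant_gt0 _ k0)|exact: sqr_ge0].
move: ab kapC; rewrite -(mul2n k) !exprM.
set K := kappa * _; set c := bernstein_constant R k => ab kapC.
have K0 : 0 < K by apply: mulr_gt0; [exact: kap0|lra].
rewrite -(ler_pM2l (exprn_gt0 k K0)); apply: le_trans ab _.
rewrite mulrA ler_wpM2r// -exprMn lerXn2r ?nnegrE ?sqr_ge0//.
  by apply: mulr_ge0; [exact: ltW|exact: sqr_ge0].
have -> : K * (c * d%:R ^+ 2) ^+ 2 = K * (c * d%:R) ^+ 2 * d%:R ^+ 2 by ring.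
by rewrite ler_peMl// sqr_ge0.
Qed.
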